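(* Let $(M^n,g)$ be a complete noncompact $n$-dimensional Riemannian manifold, $u\in C^\infty(M)$, $V=e^u$, $\lambda,\mu\in\mathbb{R}$, $D=D^{\lambda,\mu}$, and $\tau=(n+1)\lambda+\mu$. Let $\rho$ be a nonnegative function on $M$ such that $|\nabla^D\rho|=1$ in the sense of distributions. Then for every $\phi\in C_0^\infty(M\setminus\rho^{-1}\{0\})$: (i) If $\Delta^D\rho\le\frac{C}{\rho}V^{\lambda-\mu}$ in the sense of distributions, where $C<1$ is a constant, then for $2<\alpha<3-C$, $$\int_M\rho^\alpha(\Delta^D\phi)^2V^{\tau+\mu-\lambda}\,dv_g\ \ge\ 2(\alpha-2)(3-\alpha-C)\int_M\rho^{\alpha-2}|\nabla^D\phi|^2V^{\tau+\lambda-\mu}\,dv_g.$$ (ii) If $\Delta^D\rho\ge\frac{C}{\rho}V^{\lambda-\mu}$ in the sense of distributions, where $C>1$ is a constant, then for $\frac{7-C}{3}<\alpha<2$, $$\int_M\rho^\alpha(\Delta^D\phi)^2V^{\tau+\mu-\lambda}\,dv_g\ \ge\ \frac{(C-\alpha+1)^2}{4}\int_M\rho^{\alpha-2}|\nabla^D\phi|^2V^{\tau+\lambda-\mu}\,dv_g.$$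
   Context: $\nabla$, $\Delta=\mathrm{div}\,\nabla$, $dv_g$ denote the Levi-Civita connection/gradient, Laplacian and Riemannian volume of $g$; $\langle\cdot,\cdot\rangle=g$ and $|\cdot|$ is the norm of $g$. The affine connection $D=D^{\lambda,\mu}$ is $D_XY=\nabla_XY+\lambda\,du(X)Y+\lambda\,du(Y)X+\mu\,g(X,Y)\nabla u$. The affine gradient of a function $f$ is $\nabla^Df=V^{\mu-\lambda}\nabla f$. The affine Laplacian is $\Delta^Df=V^{\mu-\lambda}\left[\Delta f+(2\mu+n\lambda)\langle\nabla u,\nabla f\rangle\right]$; equivalently $V^\tau\Delta^Df=\mathrm{div}(V^\tau\nabla^Df)$. Distributional conditions: ''$|\nabla^D\rho|=1$ in the sense of distributions'' means that $\rho$ is locally Lipschitz and its (weak) gradient satisfies $|\nabla^D\rho|=1$ almost everywhere. ''$\Delta^D\rho\ge\frac{C}{\rho}V^{\lambda-\mu}$ in the sense of distributions'' means that $-\int_M\langle\nabla\psi,\nabla^D\rho\rangle V^\tau\,dv_g\ge\int_M\frac{C}{\rho}\psi V^{\tau+\lambda-\mu}\,dv_g$ for all nonnegative compactly supported Lipschitz $\psi$ with support in $M\setminus\rho^{-1}\{0\}$; the condition with $\le$ is the same with the inequality reversed. *)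

(* Defs.v *)
From HB Require Import structures.
From mathcomp Require Import all_boot all_order all_algebra.
From mathcomp Require Import all_classical all_reals all_analysis.

Set Implicit Arguments.
Unset Strict Implicit.
Unset Printing Implicit Defensive.

Import Order.TTheory GRing.Theory Num.Theory.
Import numFieldNormedType.Exports.

Local Open Scope classical_set_scope.
Local Open Scope ring_scope.

Section EuclideanSpace.
Variable R : realType.

(* The differential 'd f x is 0 when f is not differentiable at x, so that
   [partial] is 0 there too. *)
Definition partial n (i : 'I_n) (f : 'rV[R]_n -> R) (x : 'rV[R]_n) : R :=
  'd f x (delta_mx 0 i).

Fixpoint Ck n (k : nat) (O : set 'rV[R]_n) (f : 'rV[R]_n -> R) : Prop :=
  match k with
  | 0 => forall x, O x -> {for x, continuous f}
  | k'.+1 => (forall x, O x -> differentiable f x) /\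
             (forall i, Ck k' O (partial i f))
  end.

(* Meant for an open set O. *)
Definition smooth_on n (O : set 'rV[R]_n) (f : 'rV[R]_n -> R) : Prop :=
  forall k, Ck k O f.

(* Integral with respect to Lebesgue measure on R^n of a nonnegative Borel
   function, as an iterated integral (Tonelli). *)
Fixpoint Rn_integral n : ('rV[R]_n -> \bar R) -> \bar R :=
  match n with
  | 0 => fun f => f 0
  | m.+1 => fun f =>
      (\int[lebesgue_measure]_t
         Rn_integral (fun y : 'rV[R]_m =>
           f (row_mx (t%:M : 'rV[R]_1) y : 'rV[R]_(1 + m))))%E
  end.

End EuclideanSpace.

(* A smooth n-dimensional manifold structure on M. A chart c is given by its
   domain, its coordinate map, and an inverse which is only meaningful on
   [chart_img c]. *)
Record smooth_atlas (R : realType) (n : nat) (M : topologicalType) :=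
  SmoothAtlas {
  chart : Type ;
  dom : chart -> set M ;
  coord : chart -> M -> 'rV[R]_n ;
  cinv : chart -> 'rV[R]_n -> M ;
  chart_at : M -> chart ;
  atlas_hausdorff : hausdorff_space M ;
  atlas_second_countable : @second_countable M ;
  dom_open : forall c, open (dom c) ;
  img_open : forall c, open (coord c @` dom c) ;
  coordK : forall c p, dom c p -> cinv c (coord c p) = p ;
  coord_continuous : forall c p, dom c p -> {for p, continuous (coord c)} ;
  cinv_continuous : forall c x, (coord c @` dom c) x ->
    {for x, continuous (cinv c)} ;
  chart_at_dom : forall p, dom (chart_at p) p ;
  transition_smooth : forall (c c' : chart) (i : 'I_n),
    smooth_on (coord c @` (dom c `&` dom c'))
      (fun x => coord c' (cinv c x) 0 i)
}.

Definition chart_img (R : realType) n (M : topologicalType)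
    (A : smooth_atlas R n M) (c : chart A) : set 'rV[R]_n :=
  coord c @` dom c.

(* [gmx g c x] is the matrix (g_ij) of the metric in the chart c at the point
   of coordinates x. With J i k = d_i y^k the Jacobian matrix of the change of
   coordinates (row vector convention), g_ij = J_ik g'_kl J_jl. *)
Record riemannian_metric (R : realType) n (M : topologicalType)
    (A : smooth_atlas R n M) := RiemannianMetric {
  gmx : chart A -> 'rV[R]_n -> 'M[R]_n ;
  gmx_smooth : forall (c : chart A) i j,
    smooth_on (chart_img c) (fun x => gmx c x i j) ;
  gmx_sym : forall (c : chart A) x, chart_img c x -> (gmx c x)^T = gmx c x ;
  gmx_pos : forall (c : chart A) x, chart_img c x ->
    forall v : 'rV[R]_n, v != 0 -> 0 < (v *m gmx c x *m v^T) 0 0 ;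
  gmx_transition : forall (c c' : chart A) p, dom c p -> dom c' p ->
    let J := 'J (coord c' \o cinv c) (coord c p) in
    gmx c (coord c p) = J *m gmx c' (coord c' p) *m J^T
}.

Section RiemannianGeometry.
Variables (R : realType) (n : nat) (M : topologicalType).
Variables (A : smooth_atlas R n M) (g : riemannian_metric A).
Implicit Types (c : chart A) (f : M -> R) (p q : M) (x v w : 'rV[R]_n).

Definition smooth f : Prop :=
  forall c, smooth_on (chart_img c) (f \o cinv c).

Definition closed_support f : set M := closure [set p | f p != 0].

(* A C^1 curve on [0, 1] is the restriction of a C^1 curve on the whole line, so
   x is taken to be C^1 on R. *)
Definition C1_arc (p q : M) (l : R) : Prop :=
  exists (c : chart A) (x : R -> 'rV[R]_n),
    [/\ (forall t, derivable x t 1) /\ continuous (derive1 x),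
        forall t, 0 <= t <= 1 -> chart_img c (x t),
        cinv c (x 0) = p, cinv c (x 1) = q &
        l = (\int[lebesgue_measure]_(t in `[0, 1])
               Num.sqrt
                 ((derive1 x t *m gmx g c (x t) *m (derive1 x t)^T) 0 0))%R].

(* Piecewise C^1 curves, cut into C^1 arcs each contained in one chart. *)
Inductive curve_length : M -> M -> R -> Prop :=
| curve_nil p : curve_length p p 0
| curve_cons p q r l l' :
    C1_arc p q l -> curve_length q r l' -> curve_length p r (l + l').

(* +oo between distinct connected components. *)
Definition riemannian_dist (p q : M) : \bar R :=
  ereal_inf (EFin @` curve_length p q).

Definition complete_metric : Prop :=
  forall s : nat -> M,
    (forall e : R, 0 < e -> exists N : nat, forall i j : nat,
       (N <= i)%N -> (N <= j)%N -> (riemannian_dist (s i) (s j) < e%:E)%E) ->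
    exists p, s @ \oo --> p.

Definition lipschitz_in (U : set M) f : Prop :=
  exists K : R, forall p q, U p -> U q ->
    (`|f p - f q|%:E <= K%:E * riemannian_dist p q)%E.

Definition locally_lipschitz f : Prop :=
  forall p, exists2 U, nbhs p U & lipschitz_in U f.

(* A tangent vector at p is represented by the row of its components in the
   chart [chart_at p]. *)
Definition metric_inner p v w : R :=
  (v *m gmx g (chart_at A p) (coord (chart_at A p) p) *m w^T) 0 0.

Definition metric_norm p v : R := Num.sqrt (metric_inner p v v).

(* Components g^ij d_j f of the gradient in the chart c. *)
Definition grad_in c f x : 'rV[R]_n :=
  (\row_j partial j (f \o cinv c) x) *m invmx (gmx g c x).

(* For a locally Lipschitz f the weak gradient is the almost everywhere
   defined pointwise gradient (Rademacher). *)
Definition grad f p : 'rV[R]_n :=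
  grad_in (chart_at A p) f (coord (chart_at A p) p).

(* Symbols Gamma^k_ij of the Levi-Civita connection. *)
Definition christoffel c x (i j k : 'I_n) : R :=
  2^-1 * \sum_l invmx (gmx g c x) k l *
    (partial i (fun y => gmx g c y j l) x
     + partial j (fun y => gmx g c y i l) x
     - partial l (fun y => gmx g c y i j) x).

(* (nabla_i X)^k *)
Definition covariant_derivative c (X : 'rV[R]_n -> 'rV[R]_n) x : 'M[R]_n :=
  \matrix_(i, k) (partial i (fun y => X y 0 k) x
                  + \sum_j christoffel c x i j k * X x 0 j).

Definition div_in c (X : 'rV[R]_n -> 'rV[R]_n) x : R :=
  \tr (covariant_derivative c X x).

Definition laplacian f p : R :=
  div_in (chart_at A p) (grad_in (chart_at A p) f) (coord (chart_at A p) p).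

End RiemannianGeometry.

(* [ptopologicalType] because measurable types are pointed in the library. *)
Definition borelType (M : ptopologicalType) := g_sigma_algebraType (@open M).

(* dv_g = sqrt (det g_ij) dx in each chart. This determines the measure, by
   second countability. *)
Definition is_riemannian_volume (R : realType) n (M : ptopologicalType)
    (A : smooth_atlas R n M) (g : riemannian_metric A)
    (vol : {measure set (borelType M) -> \bar R}) : Prop :=
  forall (c : chart A) (B : set (borelType M)), measurable B -> B `<=` dom c ->
    vol B = Rn_integral (fun x =>
      (Num.sqrt (\det (gmx g c x)) * \1_(coord c @` B) x)%:E).

Section AffineOperators.
Variables (R : realType) (n : nat) (M : ptopologicalType).
Variables (A : smooth_atlas R n M) (g : riemannian_metric A).
Variables (u : M -> R) (lambda mu : R).

Definition V (p : M) : R := expR (u p).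

Definition affine_grad (f : M -> R) (p : M) : 'rV[R]_n :=
  V p `^ (mu - lambda) *: grad g f p.

Definition affine_laplacian (f : M -> R) (p : M) : R :=
  V p `^ (mu - lambda) *
  (laplacian g f p +
   (2 * mu + n%:R * lambda) * metric_inner g p (grad g u p) (grad g f p)).

Definition tau : R := n.+1%:R * lambda + mu.

Variable vol : {measure set (borelType M) -> \bar R}.

Definition affine_eikonal (rho : M -> R) : Prop :=
  locally_lipschitz g rho /\
  {ae vol, forall p : M, metric_norm g p (affine_grad rho p) = 1}.

Definition test_function (rho psi : M -> R) : Prop :=
  [/\ forall p, 0 <= psi p, lipschitz_in g setT psi,
      compact (closed_support psi) &
      closed_support psi `<=` [set p | rho p != 0]].

(* - int <grad psi, grad^D rho> V^tau dv_g *)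
Definition weak_laplacian_pairing (rho psi : M -> R) : \bar R :=
  (- \int[vol]_p
       (metric_inner g p (grad g psi p) (affine_grad rho p) * V p `^ tau)%:E)%E.

Definition weak_bound_pairing (C : R) (rho psi : M -> R) : \bar R :=
  (\int[vol]_p
     (C / rho p * psi p * V p `^ (tau + lambda - mu))%:E)%E.

(* Delta^D rho >= (C / rho) V^(lambda - mu) in the sense of distributions. *)
Definition affine_laplacian_ge (C : R) (rho : M -> R) : Prop :=
  forall psi, test_function rho psi ->
    (weak_bound_pairing C rho psi <= weak_laplacian_pairing rho psi)%E.

Definition affine_laplacian_le (C : R) (rho : M -> R) : Prop :=
  forall psi, test_function rho psi ->
    (weak_laplacian_pairing rho psi <= weak_bound_pairing C rho psi)%E.

End AffineOperators.

(* Main.v *)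
(* Write [a = V^(mu - lambda)], [w = V^tau], [L] for the affine Laplacian of [phi]
   and [<,>] for the metric. Testing [L] against the Lipschitz function
   [rho^(alpha - 2) phi] gives [G + (alpha - 2) P + Q = 0], with
     G = int rho^(alpha - 2) |grad phi|^2 a w,
     P = int rho^(alpha - 3) phi <grad rho, grad phi> a w,
     Q = int rho^(alpha - 2) phi L w.
   Since [a |grad rho| = 1], testing the hypothesis on [rho] against
   [rho^(alpha - 3) phi^2] compares [-((alpha - 3) H + 2 P)] with [C H], where
   [H = int rho^(alpha - 4) phi^2 w / a]. Bounding [Q] by Cauchy-Schwarz in terms of
   [H] and of the left-hand side [B = int rho^alpha L^2 a w] gives (i); in (ii) one
   also needs the Hardy inequality [(C + alpha - 3)^2 H <= 4 G], obtained by
   Cauchy-Schwarz on [P].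

   The Green identity for a compactly supported Lipschitz function that is
   differentiable almost everywhere is proved in one chart from the vanishing of
   Lebesgue integrals of partial derivatives, then summed over bump functions. That
   the coordinate expressions of the Laplacian agree is deduced from the Green
   identity in two charts, so no second derivatives of transition maps are computed. *)

Require Import Defs.
From HB Require Import structures.
From mathcomp Require Import all_boot all_order all_algebra.
From mathcomp Require Import all_classical all_reals all_analysis.
From mathcomp Require Import perm measurable_realfun ring lra.

Set Implicit Arguments.
Unset Strict Implicit.
Unset Printing Implicit Defensive.

Import Defs.
Import Order.TTheory GRing.Theory Num.Theory.
Import numFieldNormedType.Exports.

Local Open Scope classical_set_scope.
Local Open Scope ring_scope.

(** * Lebesgue measure on row vectors *)

(** Two features of the definitions shape the proof. The volume is prescribed only on Borel sets
    inside a chart, by an iterated integral that is not attached to a measure; a sigma-finite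
    measure representing this integral is therefore built on row vectors, so that null sets and
    dominated convergence make sense there. And the gradient of [rho] is meaningful only almost
    everywhere, with default value 0, so an integrand containing it is not known to be measurable;
    integral identities are stated through [has_integral], that is, up to a null set.

    The integral [P] is where this matters most. Its integrand involves the gradient of [rho],
    whereas those of [G], [Q], [H] and [B] are continuous with compact support. Solving the Green
    identity for it gives both its integrability and its value, which is possible because [alpha]
    differs from 2.

    Cauchy-Schwarz is kept in the form of nonnegative quadratic polynomials in a free parameter; the
    constants of the theorem come from choosing this parameter. *)

Notation borel_rV R n := (borelType 'rV[R]_n).

Section borel_rV.
Variable R : realType.

Lemma open_borel (T : ptopologicalType) (U : set T) :
  open U -> measurable (U : set (borelType T)).
Proof. by move=> oU; exact: sub_sigma_algebra. Qed.

Lemma continuous_borel (T1 T2 : ptopologicalType) (f : T1 -> T2) :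
  continuous f -> measurable_fun setT (f : borelType T1 -> borelType T2).
Proof.
move=> cf; apply: (@measurability _ _ _ (borelType T2) _ _ (@open T2)) => //.
move=> _ [U oU <-]; rewrite setTI; apply: open_borel.
by move/continuousP: cf; exact.
Qed.

Lemma continuous_borel_real (T : ptopologicalType) (f : T -> R) :
  continuous f -> measurable_fun setT (f : borelType T -> R).
Proof.
move=> cf; apply: (@measurability _ _ (borelType T) (measurableTypeR R) _ _ _ (RGenOInfty.measurableE R)).
move=> _ [_ [x ->] <-]; rewrite setTI; apply: open_borel.
by move/continuousP: cf; apply; exact: interval_open.
Qed.

(** An open set is the countable union of the boxes [bx q], with rational centre and half-width
    [k.+1%:R^-1], that it contains, and the preimage of a box is a finite intersection of measurable
    sets. *)
Lemma measurable_fun_rV d (T : measurableType d) n (f : T -> 'rV[R]_n) :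
  (forall i, measurable_fun setT (fun t => f t 0 i)) ->
  measurable_fun setT (f : T -> borel_rV R n).
Proof.
move=> mf; apply: (@measurability _ _ _ (borel_rV R n) _ _ (@open _)) => //.
move=> _ [U oU <-]; rewrite setTI.
pose bx (q : 'rV[rat]_n * nat) : set 'rV[R]_n :=
  [set x | forall i, x 0 i \in `](ratr (q.1 0 i) - q.2.+1%:R^-1),
                                (ratr (q.1 0 i) + q.2.+1%:R^-1)[].
have mbx q : measurable (f @^-1` bx q).
  rewrite (_ : _ @^-1` _ = \bigcap_(i in [set: 'I_n])
     ((fun t => f t 0 i) @^-1` `](ratr (q.1 0 i) - q.2.+1%:R^-1),
                                (ratr (q.1 0 i) + q.2.+1%:R^-1)[%classic)).
    apply: fin_bigcap_measurable => // i _.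
    by rewrite -[X in measurable X]setTI; apply: mf.
  by apply/seteqP; split=> [t /= h i _|t /= h i]; [exact: h|exact: (h i Logic.I)].
rewrite (_ : f @^-1` U = \bigcup_q
   (if pselect (bx q `<=` U) then f @^-1` bx q else set0)).
  apply: countable_bigcupT_measurable => // q.
  by case: pselect => [_|_] /=; [exact: mbx|exact: measurable0].
apply/seteqP; split=> [t /= Uft|t [q _]]; last by case: pselect => // bU; exact: bU.
have /nbhs_ballP [e /= e0 eU] : nbhs (f t) U by exact: open_nbhs_nbhs.
(* [f t] and every other point of the box are within one half-width of the rational centre, so a
   half-width below [e / 2] keeps the box in the ball of radius [e]. *)
have [k /= ke] : exists k : nat, k.+1%:R^-1 < e / 2.
  have e20 : 0 < e / 2 by rewrite divr_gt0.
  have [k _ /(_ k (leqnn k)) kP] := near_infty_natSinv_lt (PosNum e20).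
  by exists k.
have rq i : exists q : rat, `|f t 0 i - ratr q| < k.+1%:R^-1.
  have [q] : exists q : rat, ratr q \in `](f t 0 i - k.+1%:R^-1), (f t 0 i + k.+1%:R^-1)[.
    by apply: rat_in_itvoo; rewrite ltrD2l gtrN // invr_gt0 ltr0n.
  rewrite in_itv /= => /andP[h1 h2]; exists q.
  by rewrite ltr_distlC h1 h2.
have [q qf] := choice rq.
exists (\row_i q i, k) => //.
case: pselect => [?|] /=; first by move=> i /=; rewrite in_itv /= mxE -ltr_distl; exact: qf.
case=> x /= xb; apply: eU; split=> // i j; rewrite ord1.
have := xb j; have := qf j; rewrite mxE in_itv /= -ltr_distl => h1 h2.
rewrite /ball /= (le_lt_trans (ler_distD (ratr (q j)) _ _)) // (splitr e).
rewrite ltrD // ?(lt_trans h1) // distrC (lt_trans h2) //.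
Qed.

Lemma measurable_coord n (i : 'I_n) :
  measurable_fun setT (fun x : borel_rV R n => x 0 i).
Proof. by apply: continuous_borel_real => x; exact: matrix_normedtype.coord_continuous. Qed.

(** The [row_mx] of [Rn_integral], so that one step of the iterated integral is an integral over
    slices of [rV_cons]. *)
Definition rV_cons n (p : R * 'rV[R]_n) : 'rV[R]_n.+1 :=
  row_mx (p.1%:M : 'rV_1) p.2.

Lemma rV_cons0 n (p : R * 'rV[R]_n) (i : 'I_n.+1) : 
  rV_cons p 0 i = if unlift ord0 i is Some j then p.2 0 j else p.1.
Proof.
rewrite /rV_cons; case: unliftP => [j|] ->.
  have <- := @row_mxEr R 1 1 n (p.1%:M) p.2 0 j.
  by congr (row_mx _ _ _ _); apply: val_inj.
transitivity ((p.1%:M : 'M[R]_1) 0 0); last by rewrite mxE eqxx mulr1n.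
rewrite -(@row_mxEl R 1 1 n (p.1%:M) p.2 0 0).
by congr (row_mx _ _ _ _); apply: val_inj.
Qed.

Lemma measurable_rV_cons n :
  measurable_fun setT (@rV_cons n : R * borel_rV R n -> borel_rV R n.+1).
Proof.
apply: measurable_fun_rV => i.
under eq_fun do rewrite rV_cons0.
case: unlift => [j|]; last exact: measurable_fst.
exact: (measurableT_comp (measurable_coord j) measurable_snd).
Qed.

Lemma measurable_rV_cons1 n (f : borel_rV R n.+1 -> \bar R) (t : R) :
  measurable_fun setT f ->
  measurable_fun setT (fun y : borel_rV R n => f (rV_cons (t, y))).
Proof.
move=> mf; apply: (measurableT_comp mf).
apply: (measurableT_comp (@measurable_rV_cons n)).
exact: pair1_measurable.
Qed.

Definition rV_split n (x : 'rV[R]_n.+1) : R * 'rV[R]_n :=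
  (x 0 0, \row_i x 0 (lift ord0 i)).

Lemma rV_consK n : cancel (@rV_cons n) (@rV_split n).
Proof.
move=> [t y]; rewrite /rV_split rV_cons0 unlift_none; congr pair.
by apply/rowP => i; rewrite mxE rV_cons0 liftK.
Qed.

Lemma measurable_rV_split n :
  measurable_fun setT (@rV_split n : borel_rV R n.+1 -> R * borel_rV R n).
Proof.
apply/measurable_fun_pair; first exact: measurable_coord.
apply: measurable_fun_rV => i; under eq_fun do rewrite mxE.
exact: measurable_coord.
Qed.

End borel_rV.

Section rV_lebesgue_step.
Variables (R : realType) (n : nat).
Variable nu : {sigma_finite_measure set (borel_rV R n) -> \bar R}.

Definition rV_step : set (borel_rV R n.+1) -> \bar R :=
  pushforward (lebesgue_measure \x nu)%E
    (@rV_cons R n : measurableTypeR R * borel_rV R n -> borel_rV R n.+1).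

Let mcons := @measurable_rV_cons R n.

Let step_measure : {measure set (borel_rV R n.+1) -> \bar R} :=
  measure_function_pushforward__canonical__measure_function_Measure
    (lebesgue_measure \x nu)%E mcons.

HB.instance Definition _ := isMeasure.Build _ _ _ rV_step
  (measure0 step_measure) (measure_ge0 step_measure)
  (@measure_semi_sigma_additive _ _ _ step_measure).

(** The next product measure and its Tonelli formula call for a sigma-finite factor, so
    sigma-finiteness is carried through the induction on the dimension. The exhausting sets are
    products pulled back by [rV_split]. *)
Lemma rV_step_sigma_finite : sigma_finite setT rV_step.
Proof.
have /sigma_finiteP[F [TF ndF Foo]] := @sigma_finiteT _ _ _ (@lebesgue_measure R).
have /sigma_finiteP[G [TG ndG Goo]] := sigma_finiteT nu.
exists (fun i => @rV_split R n @^-1` (F i `*` G i)).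
  apply/esym/seteqP; split=> // x _.
  have [i _ Fi] : (\bigcup_i F i) (rV_split x).1 by rewrite -TF.
  have [j _ Gj] : (\bigcup_i G i) (rV_split x).2 by rewrite -TG.
  exists (maxn i j) => //; split.
    by move: Fi; exact/subsetPset/ndF/leq_maxl.
  by move: Gj; exact/subsetPset/ndG/leq_maxr.
move=> i; have [mF Fi] := Foo i; have [mG Gi] := Goo i; split.
  rewrite -[X in measurable X]setTI; apply: (measurable_rV_split measurableT).
  exact: measurableX.
rewrite /rV_step /pushforward -comp_preimage.
rewrite (_ : _ @^-1` _ = F i `*` G i); last first.
  by rewrite (_ : _ \o _ = id) //; apply/funext => x; exact: rV_consK.
by rewrite product_measure1E// lte_mul_pinfty// ge0_fin_numE.
Qed.

HB.instance Definition _ :=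
  Measure_isSigmaFinite.Build _ _ _ rV_step rV_step_sigma_finite.

Lemma integral_rV_step (f : borel_rV R n.+1 -> \bar R) :
  measurable_fun setT f -> (forall x, 0 <= f x)%E ->
  (\int[rV_step]_x f x =
   \int[lebesgue_measure]_t \int[nu]_y f (rV_cons (t, y)))%E.
Proof.
move=> mf f0; rewrite ge0_integral_pushforward //= preimage_setT.
rewrite fubini_tonelli1 //; exact: measurableT_comp mf mcons.
Qed.

Lemma measurable_rV_slice (f : borel_rV R n.+1 -> \bar R) :
  measurable_fun setT f -> (forall x, 0 <= f x)%E ->
  measurable_fun setT (fun t : R => \int[nu]_y f (rV_cons (t, y)))%E.
Proof.
move=> mf f0.
apply: (@measurable_fun_fubini_tonelli_F _ _ _ _ _ nu (f \o @rV_cons R n)).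
  exact: measurableT_comp.
by move=> x; exact: f0.
Qed.

End rV_lebesgue_step.

Section rV_lebesgue.
Variable R : realType.

(** The base case is a Dirac mass because ['rV_0] has a single point; each further dimension is one
    application of Tonelli. *)
Lemma rV_lebesgue_exists n :
  {nu : {sigma_finite_measure set (borel_rV R n) -> \bar R} |
    forall f : borel_rV R n -> \bar R, measurable_fun setT f ->
      (forall x, 0 <= f x)%E -> (\int[nu]_x f x = Rn_integral f)%E}.
Proof.
elim: n => [|n [nu IH]].
  exists (dirac (0 : borel_rV R 0)) => f mf f0.
  by rewrite integral_dirac //= diracT mul1e.
exists (rV_step nu) => f mf f0.
rewrite integral_rV_step //=; apply: eq_integral => t _; rewrite IH //.
exact: measurable_rV_cons1.
Qed.

Definition rV_lebesgue n := sval (rV_lebesgue_exists n).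

Lemma rV_lebesgueE n (f : borel_rV R n -> \bar R) : measurable_fun setT f ->
  (forall x, 0 <= f x)%E -> (\int[rV_lebesgue n]_x f x = Rn_integral f)%E.
Proof. exact: (svalP (rV_lebesgue_exists n)). Qed.

Lemma rV_lebesgueS n (f : borel_rV R n.+1 -> \bar R) : measurable_fun setT f ->
  (forall x, 0 <= f x)%E ->
  (\int[rV_lebesgue n.+1]_x f x =
   \int[lebesgue_measure]_t \int[rV_lebesgue n]_y f (rV_cons (t, y)))%E.
Proof.
move=> mf f0; rewrite rV_lebesgueE //=; apply: eq_integral => t _.
rewrite rV_lebesgueE //.
exact: measurable_rV_cons1.
Qed.

(** The pushforward of the Lebesgue measure under the translation has the right value on half-open
    intervals, which determines it. *)
Lemma integral_lebesgue_shift (f : R -> \bar R) (a : R) :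
  measurable_fun setT f -> (forall x, 0 <= f x)%E ->
  (\int[lebesgue_measure]_t f (t + a)%R = \int[lebesgue_measure]_t f t)%E.
Proof.
move=> mf f0.
have ms : measurable_fun setT
    ((fun t : R => t + a) : measurableTypeR R -> measurableTypeR R).
  exact: (@measurable_funD _ (measurableTypeR R)).
pose shifted : {measure set (measurableTypeR R) -> \bar R} :=
  measure_function_pushforward__canonical__measure_function_Measure
    lebesgue_measure ms.
transitivity (\int[shifted]_t f t)%E.
  by rewrite ge0_integral_pushforward //= ?preimage_setT.
apply: (@eq_measure_integral _ _ _ _ lebesgue_measure shifted) => A mA _.
apply/esym; apply: (@lebesgue_measure_unique R shifted) => // X [[x y] _ <-].
transitivity (lebesgue_measure `](x - a), (y - a)]%classic : \bar R); last first.
  by rewrite /= /pushforward; congr lebesgue_measure;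
    apply/seteqP; split=> t /=; rewrite !in_itv /= ltrBlDr lerBrDr.
rewrite !lebesgue_measure_itv /= !lte_fin ltrD2r; case: ifPn => // _.
by rewrite -!EFinB; congr EFin; ring.
Qed.

Lemma rV_lebesgue_shift n (f : borel_rV R n -> \bar R) (v : 'rV[R]_n) :
  measurable_fun setT f -> (forall x, 0 <= f x)%E ->
  (\int[rV_lebesgue n]_x f (x + v)%R = \int[rV_lebesgue n]_x f x)%E.
Proof.
have madd m (w : 'rV[R]_m) :
    measurable_fun setT ((fun x => x + w) : borel_rV R m -> borel_rV R m).
  have cw : continuous (fun x : 'rV[R]_m => x + w).
    by move=> x; exact: (cvgD cvg_id (cvg_cst w)).
  exact: (continuous_borel cw).
elim: n f v => [|n IH] f v mf f0.
  by apply: eq_integral => x _; congr f; apply/rowP => -[].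
have mfv : measurable_fun setT ((fun x => f (x + v)) : borel_rV R n.+1 -> _).
  exact: (measurableT_comp mf (madd _ v)).
have f0v (x : 'rV[R]_n.+1) : (0 <= f (x + v)%R)%E by exact: f0.
apply: (etrans (rV_lebesgueS mfv f0v)); apply: (etrans _ (esym (rV_lebesgueS mf f0))).
have mF : measurable_fun setT
    (fun t : R => \int[rV_lebesgue n]_y f (rV_cons (t, y)))%E.
  exact: measurable_rV_slice.
rewrite -(integral_lebesgue_shift (v 0 0) mF); last first.
  by move=> t; apply: integral_ge0.
apply: eq_integral => t _.
rewrite -[RHS](IH _ (rV_split v).2); last 2 first.
- exact: measurable_rV_cons1.
- by move=> y.
apply: eq_integral => y _; congr f; apply/rowP => i.
rewrite mxE !rV_cons0; case: unliftP => [j|] -> //=.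
by rewrite !mxE.
Qed.

Lemma measurable_EFin_indic d (T : measurableType d) (A : set T) :
  measurable A -> measurable_fun setT (fun x => (\1_A x : R)%:E).
Proof. by move=> mA; apply/measurable_EFinP; exact: measurable_indic. Qed.

Lemma measurable_rV_ball n (x : 'rV[R]_n) (r : R) :
  measurable (ball x r : set (borel_rV R n)).
Proof. by apply: open_borel; exact: ball_open. Qed.

Lemma rV_ball_cons n (x : 'rV[R]_n.+1) (r : R) t y :
  ball x r (rV_cons (t, y)) <->
  ball (x 0 0) r t /\ ball (rV_split x).2 r y.
Proof.
split=> [[r0 h]|[h1 [r0 h2]]].
  split.
    by have := h 0 0; rewrite rV_cons0 unlift_none.
  split=> // i j; rewrite ord1 mxE; have := h 0 (lift ord0 j).
  by rewrite rV_cons0 liftK.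
split=> // i j; rewrite ord1 rV_cons0; case: unliftP => [k|] -> //=.
by have := h2 0 k; rewrite mxE.
Qed.

(** Balls of the sup norm are cubes, and each coordinate contributes an interval of length
    [2 * r]. *)
Lemma rV_lebesgue_ball n (x : 'rV[R]_n) (r : R) : 0 < r ->
  rV_lebesgue n (ball x r) = ((2 * r) ^+ n)%:E.
Proof.
move=> r0; elim: n x => [|n IH] x.
  rewrite -[X in rV_lebesgue _ X]setIT.
  rewrite -(@integral_indic _ _ _ _ _ measurableT _ (measurable_rV_ball x r)).
  rewrite rV_lebesgueE; last 2 first.
  - exact: measurable_EFin_indic (measurable_rV_ball _ _).
  - by move=> y; rewrite lee_fin.
  by rewrite /= indicE mem_set //; split => // i [].
rewrite -[X in rV_lebesgue _ X]setIT.
rewrite -(@integral_indic _ _ _ _ _ measurableT _ (measurable_rV_ball x r)).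
have mf : measurable_fun setT
    ((fun y => (\1_(ball x r) y)%:E) : borel_rV R n.+1 -> \bar R).
  exact: measurable_EFin_indic (measurable_rV_ball _ _).
have f0 (y : borel_rV R n.+1) : (0 <= ((\1_(ball x r) y : R)%:E))%E.
  by rewrite lee_fin.
apply: (etrans (rV_lebesgueS mf f0)).
transitivity (\int[lebesgue_measure]_t
    (((2 * r) ^+ n)%:E * (\1_(ball (x 0%R 0%R) r) t)%:E))%E.
  apply: eq_integral => t _.
  have mg : measurable (ball (rV_split x).2 r : set (borel_rV R n)).
    exact: measurable_rV_ball.
  rewrite -(IH (rV_split x).2) -[X in rV_lebesgue _ X]setIT.
  rewrite -(@integral_indic _ _ _ _ _ measurableT _ mg) muleC.
  rewrite -ge0_integralZl //; last exact: measurable_EFin_indic mg.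
  apply: eq_integral => y _; rewrite -EFinM; congr EFin; rewrite !indicE.
  rewrite -natrM mulnb; congr (nat_of_bool _)%:R.
  apply/idP/andP => [|[]]; rewrite !inE; first by move/rV_ball_cons.
  by move=> h1 h2; apply/rV_ball_cons.
rewrite ge0_integralZl //; last 2 first.
- by apply: measurable_EFin_indic; exact: measurable_ball.
- by rewrite lee_fin exprn_ge0 // mulr_ge0 // ltW.
rewrite integral_indic //= ?setIT; last exact: measurable_ball.
by rewrite lebesgue_measure_ball ?ltW // -EFinM exprS mulrC mulr_natl.
Qed.

End rV_lebesgue.

(** * Integrals of functions known up to a null set *)

Section has_integral.
Context d (T : measurableType d) (R : realType).
Variable mu : {measure set T -> \bar R}.

Import HBNNSimple.

(** The integral of a nonnegative function, measurable or not, is a supremum over the simple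
    functions below it. Cutting such a function off on the exceptional null set keeps its integral
    and puts it below [g]. *)
Lemma ae_ge0_le_integral_nonmeasurable (f g : T -> \bar R) :
  (forall x, 0 <= f x)%E -> (forall x, 0 <= g x)%E ->
  {ae mu, forall x, (f x <= g x)%E} -> (\int[mu]_x f x <= \int[mu]_x g x)%E.
Proof.
move=> f0 g0 [N [mN N0 fgN]].
rewrite [leLHS]ge0_integralTE // [leRHS]ge0_integralTE //.
apply: ge_ereal_sup => _ [h /= hf <-].
have mNC : measurable (~` N) by exact: measurableC.
pose h' : {nnsfun T >-> R} := mul_nnsfun h (indic_nnsfun R mNC).
rewrite (_ : sintegral mu h = sintegral mu h'); last first.
  rewrite -!integralT_nnsfun; apply: ge0_ae_eq_integral => //.
  - exact/measurable_EFinP.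
  - exact/measurable_EFinP.
  - by move=> x _; rewrite lee_fin.
  - by move=> x _; rewrite lee_fin.
  exists N; split => // x /= /not_implyP[_ hx]; apply: contrapT => Nx.
  by apply: hx; rewrite /h' /= /mindic indicE mem_set // mulr1.
apply: ereal_sup_ubound; exists h' => //= x.
rewrite /h' /= /mindic indicE; case: (boolP (x \in ~` N)) => [xN|_]; last by rewrite mulr0.
rewrite mulr1; apply: (le_trans (hf x)).
by apply: contrapT => fgx; move: xN; rewrite inE; apply; exact: fgN.
Qed.

Lemma ae_eq_integral_nonmeasurable (f g : T -> \bar R) :
  {ae mu, forall x, f x = g x} -> (\int[mu]_x f x = \int[mu]_x g x)%E.
Proof.
move=> fg; rewrite integralE [RHS]integralE.
have gf : {ae mu, forall x, g x = f x}.
  by apply: filterS fg => x.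
congr (_ - _)%E; apply/eqP; rewrite eq_le; apply/andP; split;
  apply: ae_ge0_le_integral_nonmeasurable => //.
- by apply: filterS fg => x fgx; rewrite !funeposE fgx.
- by apply: filterS fg => x fgx; rewrite !funeposE fgx.
- by apply: filterS fg => x fgx; rewrite !funenegE fgx.
- by apply: filterS fg => x fgx; rewrite !funenegE fgx.
Qed.

Lemma ae_mono (P Q : T -> Prop) : (forall x, P x -> Q x) ->
  {ae mu, forall x, P x} -> {ae mu, forall x, Q x}.
Proof. by move=> PQ; apply: filterS. Qed.

Lemma ae_mono2 (P Q S : T -> Prop) : (forall x, P x -> Q x -> S x) ->
  {ae mu, forall x, P x} -> {ae mu, forall x, Q x} -> {ae mu, forall x, S x}.
Proof. by move=> PQ; apply: filterS2. Qed.

Lemma integrable_le_indic (f : T -> R) (A : set T) (M : R) :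
  measurable_fun setT f -> measurable A -> (mu A < +oo)%E ->
  (forall x, `|f x| <= M * \1_A x) -> mu.-integrable setT (EFin \o f).
Proof.
move=> mf mA muA fA.
have iA : mu.-integrable setT (fun x => (M%:E * (\1_A x)%:E)%E).
  apply: integrableZl => //; apply/integrableP; split.
    by apply/measurable_EFinP; exact: measurable_indic.
  under eq_integral do rewrite gee0_abs ?lee_fin //.
  by rewrite integral_indic // setIT.
apply: le_integrable iA => //; first exact/measurable_EFinP.
move=> x _; rewrite -EFinM /= lee_fin (le_trans (fA x)) //; exact: ler_norm.
Qed.

(* [f] itself need not be measurable: gradients of Lipschitz functions are only
   controlled almost everywhere. *)
Definition has_integral (f : T -> R) (s : R) := exists h : T -> R,
  [/\ mu.-integrable setT (EFin \o h), {ae mu, forall x, f x = h x} &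
      (\int[mu]_x (h x)%:E = s%:E)%E].

Lemma has_integralE f s : has_integral f s -> (\int[mu]_x (f x)%:E = s%:E)%E.
Proof.
move=> [h [_ fh <-]]; apply: ae_eq_integral_nonmeasurable.
by apply: filterS fh => x ->.
Qed.

Lemma integrable_has_integral f : mu.-integrable setT (EFin \o f) ->
  exists s, has_integral f s.
Proof.
move=> fi; exists (fine (\int[mu]_x (f x)%:E)), f; split => //.
  exact: aeW.
rewrite fineK //; exact: integrable_fin_num.
Qed.

Lemma eq_has_integral f g s : {ae mu, forall x, f x = g x} ->
  has_integral f s -> has_integral g s.
Proof.
move=> fg [h [hi fh hs]]; exists h; split => //.
by apply: filterS2 fg fh => x <-.
Qed.

Lemma has_integral0 : has_integral (fun=> 0) 0.
Proof.
exists (fun=> 0); split; [exact: integrable0|exact: aeW|].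
by rewrite integral0.
Qed.

Lemma has_integralD f g s t : has_integral f s -> has_integral g t ->
  has_integral (fun x => f x + g x) (s + t).
Proof.
move=> [h [hi fh hs]] [k [ki gk kt]]; exists (fun x => h x + k x); split.
- have -> : EFin \o (fun x => h x + k x) = (EFin \o h) \+ (EFin \o k) by [].
  exact: integrableD.
- by apply: filterS2 fh gk => x -> ->.
- by rewrite integralD_EFin // hs kt.
Qed.

Lemma has_integralZ f s (c : R) : has_integral f s ->
  has_integral (fun x => c * f x) (c * s).
Proof.
move=> [h [hi fh hs]]; exists (fun x => c * h x); split.
- have -> : EFin \o (fun x => c * h x) = (fun x => c%:E * (EFin \o h) x)%E by [].
  exact: integrableZl.
- by apply: filterS fh => x ->.
- under eq_integral do rewrite EFinM.
  by rewrite integralZl // hs.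
Qed.

Lemma has_integral_sum (I : Type) (r : seq I) (f : I -> T -> R) (s : I -> R) :
  (forall i, has_integral (f i) (s i)) ->
  has_integral (fun x => \sum_(i <- r) f i x) (\sum_(i <- r) s i).
Proof.
move=> fs; elim: r => [|i r IH].
  rewrite big_nil; apply: eq_has_integral has_integral0.
  by apply: aeW => x; rewrite big_nil.
rewrite big_cons; apply: eq_has_integral (has_integralD (fs i) IH).
by apply: aeW => x; rewrite big_cons.
Qed.

Lemma le_has_integral f g s t : {ae mu, forall x, f x <= g x} ->
  has_integral f s -> has_integral g t -> s <= t.
Proof.
move=> fg fs gt; rewrite -subr_ge0.
have [k [ki kE ks]] := has_integralD gt (has_integralZ (-1) fs).
rewrite -mulN1r -lee_fin -ks.
(* The representative [k] is nonnegative only almost everywhere, so its positive part takes its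
   place. *)
rewrite (_ : \int[mu]_x _ = \int[mu]_x (Num.max (k x) 0)%:E)%E.
  by apply: integral_ge0 => x _; rewrite lee_fin le_max lexx orbT.
apply: ae_eq_integral_nonmeasurable; apply: filterS2 fg kE => x fgx <-.
by congr EFin; apply/esym/max_idPl; rewrite mulN1r subr_ge0.
Qed.

Lemma has_integral_eq0 (f : T -> R) :
  (forall x, 0 <= f x) -> has_integral f 0 -> {ae mu, forall x, f x = 0}.
Proof.
move=> f0 [h [hi fh hs]].
have mh : measurable_fun setT (EFin \o h) by exact: measurable_int hi.
have : ae_eq mu setT (EFin \o h) (cst 0%E).
  have [H _] := ae_eq_integral_abs mu measurableT mh; apply: H.
  apply: etrans hs; apply: ae_eq_integral_nonmeasurable; apply: ae_mono fh => x fhx.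
  by rewrite /= -fhx ger0_norm.
by move=> h0; apply: ae_mono2 fh h0 => x -> /= /(_ I) [->].
Qed.

End has_integral.

(** * Vanishing of integrals of partial derivatives *)

Section integral_partial.
Variable R : realType.

Definition lipschitz_near (U V : normedModType R) (f : U -> V) (x : U) :=
  exists L : R, exists2 A, nbhs x A &
    forall y z, A y -> A z -> `|f y - f z| <= L * `|y - z|.

Lemma lipschitz_near_continuous (U V : normedModType R) (f : U -> V) x :
  lipschitz_near f x -> {for x, continuous f}.
Proof.
move=> [L [A xA fA]]; apply/cvgrPdist_le => e e0.
have Ax : A x by exact: nbhs_singleton.
have L1 : 0 < `|L| + 1 by rewrite ltr_wpDl.
near=> y.
have Ay : A y by near: y.
apply: (le_trans (fA _ _ Ax Ay)).
have : `|x - y| <= e / (`|L| + 1).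
  by near: y; apply: (@cvgr_dist_le _ _ _ (nbhs x)); [exact: cvg_id|rewrite divr_gt0].
rewrite ler_pdivlMr // mulrC; apply: le_trans.
apply: ler_wpM2r => //; rewrite (le_trans (ler_norm L)) // lerDl //.
Unshelve. all: by end_near. Qed.

Lemma near_lipschitz_near (U W : normedModType R) (f h : U -> W) x :
  (\forall y \near x, f y = h y) -> lipschitz_near f x -> lipschitz_near h x.
Proof.
move=> fh [L [B nB LB]]; exists L, (B `&` [set y | f y = h y]); first exact: filterI.
by move=> y z [By /= <-] [Bz /= <-]; exact: LB.
Qed.

Lemma lipschitz_near_cst (U W : normedModType R) (b : W) (x : U) :
  lipschitz_near (fun=> b) x.
Proof.
exists 0, setT; first exact: filterT.
by move=> y z _ _; rewrite subrr normr0 mul0r.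
Qed.

Lemma norm_delta_mx n (i : 'I_n) : `|delta_mx 0 i : 'rV[R]_n| <= 1.
Proof.
rewrite /Num.norm /= mx_normrE; apply: bigmax_le => // -[j k] _ /=.
by rewrite mxE; case: (_ && _); rewrite ?normr1 ?normr0.
Qed.

(** One integer serves both as Lipschitz constant and, inverted, as radius. The local bounds then
    hold for all large integers, and compactness, in its form for the filter of large integers,
    makes the choice uniform on [K]. *)
Lemma lipschitz_compact n (F : 'rV[R]_n -> R) (K : set 'rV[R]_n) :
  (forall x, lipschitz_near F x) -> compact K ->
  exists N : nat, forall x v, K x -> `|v| <= N.+1%:R^-1 ->
    `|F (x + v) - F x| <= N%:R * `|v|.
Proof.
move=> lF /compact_near_coveringP cK.
pose P (k : nat) (x : 'rV[R]_n) := forall v, `|v| <= k.+1%:R^-1 ->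
    `|F (x + v) - F x| <= k%:R * `|v|.
have [|N _ /(_ N (leqnn N)) NP] := cK nat \oo P _.
  move=> x Kx; have [L [A /nbhs_ballP[e /= e0 eA] LA]] := lF x.
  have e20 : 0 < e / 2 by rewrite divr_gt0.
  near=> y k => v; rewrite /= => vk.
  have : ball x (e / 2) y by near: y; exact: nbhsx_ballx.
  rewrite -ball_normE /= => xy.
  have ke : k.+1%:R^-1 < e / 2.
    by near: k; exact: (near_infty_natSinv_lt (PosNum e20)).
  have Lk : L <= k%:R by near: k; exact: nbhs_infty_ger.
  apply: (@le_trans _ _ (L * `|y + v - y|)).
    apply: LA; apply: eA; rewrite -ball_normE /=.
      rewrite opprD addrA (le_lt_trans (ler_normB _ _)) // (splitr e) ltrD //.
      exact: le_lt_trans ke.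
    by rewrite (lt_le_trans xy) // ler_pdivrMr // ler_pMr // ler1n.
  by rewrite addrAC subrr add0r ler_wpM2r.
by exists N => x v Kx vN; exact: NP.
Unshelve. all: by end_near. Qed.

Lemma cvg_diff_quotient n (F : 'rV[R]_n -> R) (x v : 'rV[R]_n) (h : nat -> R) :
  (forall k, h k != 0) -> h @ \oo --> 0 -> differentiable F x ->
  (fun k => (F (x + h k *: v) - F x) / h k) @ \oo --> 'd F x v.
Proof.
move=> h0 hcvg dF; rewrite -deriveE //.
have /= := @diff_derivable _ _ _ F x v dF; rewrite /derivable -/(derive F x v).
have h0' : h @ \oo --> 0^'.
  move=> A A0; have /hcvg [k _ kA] : nbhs (0 : R) (fun y => y != 0 -> A y) by [].
  by exists k => // j /kA; apply.
move=> /(cvg_comp _ _ h0'); apply: cvg_trans.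
apply: near_eq_cvg; apply: nearW => k /=.
by rewrite [h k *: v + x]addrC mulrC.
Qed.

Lemma integral_shiftB n (F : borel_rV R n -> R) (v : 'rV[R]_n) :
  (rV_lebesgue R n).-integrable setT (EFin \o F) ->
  has_integral (rV_lebesgue R n) (fun x => F (x + v) - F x) 0.
Proof.
move=> iF; set mu := rV_lebesgue R n.
have /measurable_EFinP mF := measurable_int _ iF.
have cv : continuous (fun x : 'rV[R]_n => x + v).
  by move=> x; exact: (cvgD cvg_id (cvg_cst v)).
have mFv : measurable_fun setT ((fun x => F (x + v)) : borel_rV R n -> R).
  exact: (measurableT_comp mF (continuous_borel cv)).
have shiftE (G : borel_rV R n -> R) : measurable_fun setT G ->
    (\int[mu]_x (G (x + v))%:E = \int[mu]_x (G x)%:E)%E.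
  move=> mG; rewrite integralE [RHS]integralE; congr (_ - _)%E.
    under eq_integral do rewrite funeposE.
    rewrite (@rV_lebesgue_shift R n (fun x => Order.max (G x)%:E 0%E) v).
    - by apply: eq_integral => x _; rewrite funeposE.
    - by apply: measurable_maxe => //; exact/measurable_EFinP.
    - by move=> x; rewrite le_max lexx orbT.
  under eq_integral do rewrite funenegE.
  rewrite (@rV_lebesgue_shift R n (fun x => Order.max (- (G x)%:E) 0)%E v).
  - by apply: eq_integral => x _; rewrite funenegE.
  - by apply: measurable_maxe => //; apply: measurableT_comp => //; exact/measurable_EFinP.
  - by move=> x; rewrite le_max lexx orbT.
have iFv : mu.-integrable setT (EFin \o (fun x => F (x + v))).
  apply/integrableP; split; first exact/measurable_EFinP.
  have /integrableP[_] := iF; apply: le_lt_trans.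
  rewrite (_ : integral _ _ _ = \int[mu]_x (`|F x|)%:E)%E //.
  have := shiftE (fun x => `|F x|).
  by rewrite /= => -> //; apply: measurableT_comp.
have [s sF] := integrable_has_integral iF.
have [t tF] := integrable_has_integral iFv.
have := has_integralD tF (has_integralZ (-1) sF).
have -> : t = s.
  have := has_integralE sF; rewrite -shiftE // (has_integralE tF).
  by case.
rewrite mulN1r subrr; apply: eq_has_integral; apply: aeW => x.
by rewrite mulN1r.
Qed.

(* No Rademacher theorem is needed since differentiability is a hypothesis: the
   difference quotients integrate to 0 by translation invariance, converge almost
   everywhere and are dominated by the Lipschitz constant near [K]. *)
Lemma integral_partial n (i : 'I_n) (F : 'rV[R]_n -> R) (K : set 'rV[R]_n) :
  compact K -> (forall x, ~ K x -> F x = 0) ->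
  (forall x, lipschitz_near F x) ->
  {ae rV_lebesgue R n, forall x, differentiable F x} ->
  has_integral (rV_lebesgue R n) (partial i F) 0.
Proof.
move=> cK F0 lF dF; set mu := rV_lebesgue R n.
have [N NP] := lipschitz_compact lF cK.
have [r r0 Kr] : exists2 r, 0 < r & K `<=` ball 0 r.
  have [M [_ MP]] := compact_bounded cK.
  exists (`|M| + 2); first by rewrite ltr_wpDl.
  move=> x Kx; rewrite -ball_normE /= sub0r normrN.
  have := MP (`|M| + 1) _ x Kx; rewrite (le_lt_trans (ler_norm M)) ?ltrDl //.
  by move=> /(_ isT) /le_lt_trans; apply; rewrite ltrD2l ltr1n.
have cF : continuous F by move=> x; exact: lipschitz_near_continuous.
have mF : measurable_fun setT (F : borel_rV R n -> R) by exact: continuous_borel_real.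
pose e : 'rV[R]_n := delta_mx 0 i.
(* Starting the steps at [N.+1%:R^-1] makes the uniform bound [NP] available for every [k]. *)
pose h (k : nat) : R := (N + k).+1%:R^-1.
have h0 k : 0 < h k by rewrite invr_gt0 ltr0n.
have hN k : h k <= N.+1%:R^-1.
  by rewrite lef_pV2 ?posrE ?ltr0n // ler_nat ltnS leq_addr.
have h1 k : h k <= 1 by rewrite invf_le1 ?ltr0n // ler1n.
have hcvg : h @ \oo --> 0.
  apply: (@squeeze_cvgr _ _ _ _ (fun=> 0) (@harmonic R)).
  - apply: nearW => k; rewrite (ltW (h0 k)) /= lef_pV2 ?posrE ?ltr0n //.
    by rewrite ler_nat ltnS leq_addl.
  - exact: cvg_cst.
  - exact: cvg_harmonic.
pose q k x := (F (x + h k *: e) - F x) / h k.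
have he k : `|h k *: e| <= h k.
  rewrite normrZ gtr0_norm // -[leRHS]mulr1 ler_wpM2l ?(ltW (h0 k)) //.
  exact: norm_delta_mx.
(* Steps have length at most 1, so a ball of radius [r + 1] contains the supports of all difference
   quotients. *)
pose B : set (borel_rV R n) := ball 0 (r + 1).
have mB : measurable B by exact: measurable_rV_ball.
have qB k x : `|q k x| <= N%:R * \1_B x.
  rewrite /q indicE normrM normfV (gtr0_norm (h0 k)) ler_pdivrMr //.
  have [xB|xB] := boolP (x \in B).
    rewrite mulr1; have [Kx|Kx] := pselect (K x).
      apply: (le_trans (NP x (h k *: e) Kx _)); first exact: le_trans (hN k).
      by rewrite ler_wpM2l.
    have [Kxe|Kxe] := pselect (K (x + h k *: e)).
      have := NP (x + h k *: e) (- (h k *: e)) Kxe; rewrite normrN addrK distrC.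
      move=> /(_ _)/le_trans; apply; first exact: le_trans (hN k).
      by rewrite ler_wpM2l.
    by rewrite !F0 // subrr normr0 mulr_ge0 // ltW.
  have Kx : ~ K x.
    move/Kr => xr; move/negP: xB; apply; rewrite inE.
    by apply: le_ball xr; rewrite lerDl.
  have Kxe : ~ K (x + h k *: e).
    move/Kr => xr; move/negP: xB; apply; rewrite inE.
    move: xr; rewrite /B -!ball_normE /= !sub0r !normrN => xr.
    rewrite -[x in `|x|](addrK (h k *: e)) (le_lt_trans (ler_normB _ _)) //.
    by rewrite ltr_leD // (le_trans (he k)).
  by rewrite !F0 // subrr normr0 !mulr0 mul0r.
have muB : (mu B < +oo)%E by rewrite rV_lebesgue_ball ?ltry // addr_gt0.
have iB : mu.-integrable setT (fun x => (N%:R * \1_B x)%:E).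
  apply: (@integrable_le_indic _ _ _ mu _ B N%:R) => //.
    by apply: measurable_funM => //; exact: measurable_indic.
  by move=> x; rewrite ger0_norm ?mulr_ge0.
have iF : mu.-integrable setT (EFin \o (F : borel_rV R n -> R)).
  have [M [_ MP]] := compact_bounded (continuous_compact (continuous_subspaceT cF) cK).
  apply: (@integrable_le_indic _ _ _ mu _ B (`|M| + 1)) => // x.
  have [Kx|Kx] := pselect (K x); last by rewrite F0 // normr0 mulr_ge0.
  rewrite indicE mem_set ?mulr1; last by apply: le_ball (Kr _ Kx); rewrite lerDl.
  by apply: (MP (`|M| + 1)); [rewrite (le_lt_trans (ler_norm M)) // ltrDl|exists x].
have Iq k : has_integral mu (q k) 0.
  have := has_integralZ (h k)^-1 (integral_shiftB (h k *: e) iF).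
  by rewrite mulr0; apply: eq_has_integral; apply: aeW => x; rewrite /q mulrC.
have mq k : measurable_fun setT (q k : borel_rV R n -> R).
  apply: measurable_funM; last exact: measurable_cst.
  apply: measurable_funB => //; apply: (measurableT_comp mF).
  apply: (@continuous_borel 'rV[R]_n 'rV[R]_n (fun x => x + h k *: e)).
  by move=> x; exact: (cvgD cvg_id (cvg_cst _)).
(* The upper limit of the quotients is measurable everywhere and equals the partial derivative
   wherever [F] is differentiable. *)
pose ft (x : borel_rV R n) : R := fine (limn_esup (fun k => (q k x)%:E)).
have mft : measurable_fun setT ft.
  apply: (measurableT_comp (@fine_measurable R setT measurableT)).
  by apply: measurable_fun_limn_esup => k; exact/measurable_EFinP.
have cq x : differentiable F x -> (q ^~ x) @ \oo --> partial i F x.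
  by move=> dFx; apply: cvg_diff_quotient => // k; rewrite gt_eqF.
have qft x : differentiable F x -> partial i F x = ft x.
  move=> dFx; rewrite /ft.
  have cqx : (fun k => (q k x)%:E) @ \oo --> (partial i F x)%:E.
    by apply: cvg_EFin; [exact: nearW|exact: cq].
  rewrite is_cvg_limn_esupE; last by apply/cvg_ex; exists (partial i F x)%:E.
  by move/cvg_lim: cqx => ->.
have [||||| ift _ cft] := @dominated_convergence _ _ _ mu _ measurableT
  (fun k x => (q k x)%:E) (EFin \o ft) (fun x => (N%:R * \1_B x)%:E).
- by move=> k; exact/measurable_EFinP.
- exact/measurable_EFinP.
- apply: ae_mono dF => x dFx _; rewrite /= -qft //.
  by apply: cvg_EFin; [exact: nearW|exact: cq].
- exact: iB.
- by apply: aeW => x k _; rewrite /= lee_fin.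
exists ft; split => //.
- by apply: ae_mono dF => x /qft.
- have c0 : (fun k => (\int[mu]_x (q k x)%:E)%E) @ \oo --> (0 : \bar R)%E.
    have -> : (fun k => (\int[mu]_x (q k x)%:E)%E) = (fun=> 0 : \bar R)%E.
      by apply/funext => k; rewrite (has_integralE (Iq k)).
    exact: cvg_cst.
  exact: (cvg_unique _ cft c0).
Qed.

End integral_partial.

(** * Functions of class C1 *)

Section calculus.
Variable R : realType.

Lemma near0_is_diff (V W : normedModType R) (h : V -> W) (x : V) :
  (\forall y \near x, h y = 0) -> is_diff x h (0 : V -> W).
Proof.
move=> h0.
have hd : continuous (0 : V -> W) /\ h \o shift x = cst (h x) + 0 +o_ 0 id.
  split; first exact: cst_continuous.
  apply/eqaddoP => e e0; rewrite (nbhs_singleton h0).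
  have := h0; rewrite (near_shift 0) subr0; apply: filterS => y /= hy.
  by rewrite !fctE /= addr0 subr0 hy normr0 mulr_ge0 // ltW.
have hE : 'd h x = (0 : V -> W) :> (V -> W) by apply: diff_unique; have [] := hd.
by apply: DiffDef => //; apply/diff_locallyP; rewrite hE.
Qed.

Lemma near_differentiable (V W : normedModType R) (f g : V -> W) (x : V) :
  (\forall y \near x, f y = g y) -> differentiable f x -> differentiable g x.
Proof.
move=> fg df.
have : is_diff x (g - f) 0.
  by apply: near0_is_diff; apply: filterS fg => y fgy; rewrite !fctE fgy subrr.
move=> [dgf _]; rewrite -[g](subrK f); exact: differentiableD.
Qed.

(* ['d f x] is obtained by choice, with a default value of 0. *)
Lemma not_differentiable_diff (V W : normedModType R) (f : V -> W) (x v : V) :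
  ~ differentiable f x -> 'd f x v = 0.
Proof.
move=> df; rewrite /diff getPN // => g [gc gE]; apply: df; apply/diffP.
exact: (@getPex {linear V -> W} (fun df => continuous df /\
  forall y, f y = f (lim (nbhs x)) + df (y - lim (nbhs x))
                  +o_(y \near x) (y - lim (nbhs x))) (ex_intro _ g (conj gc gE))).
Qed.

Lemma near_partial n (f g : 'rV[R]_n -> R) i x : differentiable f x ->
  (\forall y \near x, f y = g y) -> partial i f x = partial i g x.
Proof.
move=> df fg; have dg := near_differentiable fg df.
by rewrite /partial -!deriveE //; exact: near_eq_derive.
Qed.

Lemma diff_partial n (f : 'rV[R]_n -> R) x v :
  'd f x v = \sum_k v 0 k * partial k f x.
Proof.
rewrite {1}(row_sum_delta v) linear_sum; apply: eq_bigr => k _.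
by rewrite linearZ.
Qed.

Lemma partial_cst n (a : R) i (x : 'rV[R]_n) : partial i (fun=> a) x = 0.
Proof.
exact: (congr1 (fun h : _ -> R => h (delta_mx 0 i)) (diff_cst _ _)).
Qed.

Section partial_rules.
Variables (n : nat) (f g : 'rV[R]_n -> R) (i : 'I_n) (x : 'rV[R]_n).
Hypotheses (df : differentiable f x) (dg : differentiable g x).

Lemma partialD : partial i (fun y => f y + g y) x = partial i f x + partial i g x.
Proof. exact: (congr1 (fun h : _ -> R => h (delta_mx 0 i)) (diffD df dg)). Qed.

Lemma partialM : partial i (fun y => f y * g y) x =
  partial i f x * g x + f x * partial i g x.
Proof.
apply: (etrans (congr1 (fun h : _ -> R => h (delta_mx 0 i)) (diffM df dg))).
by rewrite [RHS]addrC [_ * g x]mulrC.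
Qed.

Lemma differentiable_partialM : differentiable (fun y => f y * g y) x.
Proof. exact: differentiableM. Qed.

End partial_rules.

Lemma partialZ n (a : R) (f : 'rV[R]_n -> R) i x : differentiable f x ->
  partial i (fun y => a * f y) x = a * partial i f x.
Proof.
move=> df; rewrite (@partialM _ (fun=> a)) //.
by rewrite partial_cst mul0r add0r.
Qed.

Lemma partial_comp n (f : 'rV[R]_n -> R) (h : R -> R) (dh : R) i x :
  differentiable f x -> is_derive (f x) 1 h dh ->
  partial i (h \o f) x = dh * partial i f x.
Proof.
move=> df [hd hE]; have dh1 : differentiable h (f x) by exact/derivable1_diffP.
rewrite /partial diff_comp //= deriv1E // derive1E hE.
by rewrite -[LHS]/(_ * _) mulrC.
Qed.

Lemma differentiable_rV (V : normedModType R) n (T : V -> 'rV[R]_n) x :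
  (forall k, differentiable (fun y => T y 0 k) x) -> differentiable T x.
Proof.
move=> dT.
have -> : T = \sum_(k < n) (fun y => T y 0 k *: (delta_mx 0 k : 'rV[R]_n)).
  apply/funext => y; rewrite [LHS]row_sum_delta.
  by rewrite fct_sumE.
by apply: differentiable_sum => k; exact: differentiableZl.
Qed.

Lemma diff_rV n m (T : 'rV[R]_m -> 'rV[R]_n) x v k : differentiable T x ->
  ('d T x v) 0 k = 'd (fun y => T y 0 k) x v.
Proof.
move=> dT.
pose c (y : 'rV[R]_n) : R := y 0 k.
have lc : linear c by move=> a y z; rewrite /c !mxE.
pose cl : {linear 'rV[R]_n -> R} :=
  HB.pack c (GRing.isLinear.Build _ _ _ _ c lc).
have cc : continuous cl by move=> y; exact: matrix_normedtype.coord_continuous.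
have dc : differentiable cl (T x) by exact: linear_differentiable.
have := @diff_comp _ _ _ _ T cl x dT dc.
move=> /(congr1 (fun h : _ -> R => h v)) hv; apply/esym/(etrans hv).
by rewrite /= (diff_lin _ cc).
Qed.

Lemma partial_chain n m (f : 'rV[R]_n -> R) (T : 'rV[R]_m -> 'rV[R]_n) x i :
  differentiable T x -> differentiable f (T x) ->
  partial i (f \o T) x =
  \sum_k partial i (fun y => T y 0 k) x * partial k f (T x).
Proof.
move=> dT df; rewrite /partial diff_comp //= diff_partial.
by apply: eq_bigr => k _; rewrite diff_rV.
Qed.

Lemma jacobianE n m (T : 'rV[R]_m -> 'rV[R]_n) x i k : differentiable T x ->
  ('J T x) i k = partial i (fun y => T y 0 k) x.
Proof. by move=> dT; rewrite /jacobian /partial -diff_rV // !mxE. Qed.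

Section C1.
Variables (n : nat) (O : set 'rV[R]_n).
Hypothesis oO : open O.
Implicit Types f g : 'rV[R]_n -> R.

Notation C1 := (Ck 1 O).

Lemma C1_differentiable f x : C1 f -> O x -> differentiable f x.
Proof. by move=> [df _]; exact: df. Qed.

Lemma C1_continuous_partial f x i : C1 f -> O x ->
  {for x, continuous (partial i f)}.
Proof. by move=> [_ cf]; exact: cf. Qed.

Lemma C1_continuous f x : C1 f -> O x -> {for x, continuous f}.
Proof.
by move=> Cf Ox; apply: differentiable_continuous; exact: C1_differentiable.
Qed.

Lemma continuous_on_near f g x : O x -> (forall y, O y -> f y = g y) ->
  {for x, continuous f} -> {for x, continuous g}.
Proof.
move=> Ox fg; rewrite /prop_for /continuous_at -fg // => cf.
have nfg : {near x, f =1 g}.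
  have nO : nbhs x O by exact: open_nbhs_nbhs.
  by apply: filterS nO => y Oy; rewrite fg.
exact: (cvg_trans (near_eq_cvg nfg) cf).
Qed.

Lemma C1_make f (df : 'I_n -> 'rV[R]_n -> R) :
  (forall x, O x -> differentiable f x) ->
  (forall i x, O x -> partial i f x = df i x) ->
  (forall i x, O x -> {for x, continuous (df i)}) -> C1 f.
Proof.
move=> dif pf cdf; split => // i x Ox /=.
by apply: continuous_on_near (cdf i x Ox) => // y Oy; rewrite pf.
Qed.

Lemma C1_cst a : C1 (fun=> a).
Proof.
apply: (@C1_make _ (fun _ _ => 0)).
- by move=> x _; exact: differentiable_cst.
- by move=> i x _; exact: partial_cst.
- by move=> i x _; exact: cst_continuous.
Qed.

Lemma C1_ext f g : (forall x, O x -> f x = g x) -> C1 f -> C1 g.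
Proof.
move=> fg Cf.
have near_fg x : O x -> \forall y \near x, f y = g y.
  move=> Ox; have nO : nbhs x O by exact: open_nbhs_nbhs.
  by apply: filterS nO => y Oy; rewrite fg.
apply: (@C1_make _ (fun i => partial i f)).
- by move=> x Ox; exact: near_differentiable (near_fg x Ox) (C1_differentiable Cf Ox).
- by move=> i x Ox; rewrite (@near_partial _ f g) //; [exact: C1_differentiable|exact: near_fg].
- by move=> i x Ox; exact: C1_continuous_partial.
Qed.

Lemma C1_add f g : C1 f -> C1 g -> C1 (fun x => f x + g x).
Proof.
move=> Cf Cg; apply: (@C1_make _ (fun i x => partial i f x + partial i g x)).
- by move=> x Ox; apply: differentiableD; exact: C1_differentiable.
- by move=> i x Ox; rewrite partialD //; exact: C1_differentiable.
- by move=> i x Ox; apply: continuousD; exact: C1_continuous_partial.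
Qed.

Lemma C1_mul f g : C1 f -> C1 g -> C1 (fun x => f x * g x).
Proof.
move=> Cf Cg; apply: (@C1_make _
  (fun i x => partial i f x * g x + f x * partial i g x)).
- by move=> x Ox; apply: differentiableM; exact: C1_differentiable.
- by move=> i x Ox; rewrite partialM //; exact: C1_differentiable.
- move=> i x Ox; apply: continuousD; apply: continuousM;
    by [exact: C1_continuous_partial|exact: C1_continuous].
Qed.

Lemma C1_comp f (h dh : R -> R) : C1 f ->
  (forall x, O x -> is_derive (f x) 1 h (dh (f x))) ->
  (forall x, O x -> {for f x, continuous dh}) -> C1 (h \o f).
Proof.
move=> Cf hd hc; apply: (@C1_make _ (fun i x => dh (f x) * partial i f x)).
- move=> x Ox; apply: differentiable_comp; first exact: C1_differentiable.
  by have [+ _] := hd x Ox => /derivable1_diffP.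
- move=> i x Ox; rewrite (partial_comp _ _ (hd x Ox)) //.
  exact: C1_differentiable.
- move=> i x Ox; apply: continuousM; last exact: C1_continuous_partial.
  apply: continuous_comp; [exact: C1_continuous|exact: hc].
Qed.

Lemma C1_sum I (r : seq I) (P : pred I) (f : I -> 'rV[R]_n -> R) :
  (forall i, C1 (f i)) -> C1 (fun x => \sum_(i <- r | P i) f i x).
Proof.
move=> Cf; elim: r => [|i r IH].
  by apply: C1_ext (C1_cst 0) => x _; rewrite big_nil.
case Pi : (P i); last by apply: C1_ext IH => x _; rewrite big_cons Pi.
by apply: C1_ext (C1_add (Cf i) IH) => x _; rewrite big_cons Pi.
Qed.

Lemma C1_prod I (r : seq I) (P : pred I) (f : I -> 'rV[R]_n -> R) :
  (forall i, C1 (f i)) -> C1 (fun x => \prod_(i <- r | P i) f i x).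
Proof.
move=> Cf; elim: r => [|i r IH].
  by apply: C1_ext (C1_cst 1) => x _; rewrite big_nil.
case Pi : (P i); last by apply: C1_ext IH => x _; rewrite big_cons Pi.
by apply: C1_ext (C1_mul (Cf i) IH) => x _; rewrite big_cons Pi.
Qed.

Lemma C1_inv f : C1 f -> (forall x, O x -> f x != 0) -> C1 (fun x => (f x)^-1).
Proof.
move=> Cf f0; apply: (@C1_comp f (@GRing.inv R) (fun y => - y ^- 2)) => // x Ox.
  have := f0 x Ox => fx0.
  have dI : differentiable (@GRing.inv R) (f x) by exact: differentiable_Rinv.
  apply: DeriveDef; first exact/derivable1_diffP.
  by rewrite deriveE // diff_Rinv // -[LHS]/(_ * _) mulr1.
apply: continuousN; apply: continuousV; first by rewrite expf_neq0 // f0.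
exact: exprn_continuous.
Qed.

Lemma C1_det m (G : 'rV[R]_n -> 'M[R]_m) :
  (forall j k, C1 (fun x => G x j k)) -> C1 (fun x => \det (G x)).
Proof.
move=> CG; rewrite /determinant; apply: C1_sum => s.
by apply: C1_mul; [exact: C1_cst|apply: C1_prod].
Qed.

Lemma C1_cofactor m (G : 'rV[R]_n -> 'M[R]_m) j k :
  (forall j k, C1 (fun x => G x j k)) -> C1 (fun x => cofactor (G x) j k).
Proof.
move=> CG; rewrite /cofactor; apply: C1_mul; first exact: C1_cst.
apply: C1_det => j' k'.
by apply: C1_ext (CG (lift j j') (lift k k')) => x _; rewrite !mxE.
Qed.

Lemma C1_invmx m (G : 'rV[R]_n -> 'M[R]_m) j k :
  (forall j k, C1 (fun x => G x j k)) -> (forall x, O x -> G x \in unitmx) ->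
  C1 (fun x => invmx (G x) j k).
Proof.
move=> CG uG.
have d0 x : O x -> \det (G x) != 0.
  by move=> Ox; have := uG x Ox; rewrite unitmxE unitfE.
apply: C1_ext (C1_mul (C1_inv (C1_det CG) d0) (C1_cofactor k j CG)) => x Ox.
by rewrite /invmx uG // !mxE.
Qed.

End C1.

Lemma continuous_at_sum (T : topologicalType) I (r : seq I) (f : I -> T -> R) x :
  (forall i, {for x, continuous (f i)}) ->
  {for x, continuous (fun y => \sum_(i <- r) f i y)}.
Proof.
move=> cf; elim: r => [|i r IH].
  rewrite (_ : (fun _ => _) = fun=> 0); first exact: cst_continuous.
  by apply/funext => y; rewrite big_nil.
rewrite (_ : (fun _ => _) = fun y => f i y + (fun y => \sum_(i <- r) f i y) y).
  exact: continuousD.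
by apply/funext => y; rewrite big_cons.
Qed.

Lemma C1_chain n m (O : set 'rV[R]_m) (O' : set 'rV[R]_n)
    (f : 'rV[R]_n -> R) (T : 'rV[R]_m -> 'rV[R]_n) :
  open O -> (forall x, O x -> O' (T x)) -> Ck 1 O' f ->
  (forall k, Ck 1 O (fun x => T x 0 k)) -> Ck 1 O (f \o T).
Proof.
move=> oO OO' Cf CT.
have dT x : O x -> differentiable T x.
  by move=> Ox; apply: differentiable_rV => k; exact: C1_differentiable (CT k) Ox.
have df x : O x -> differentiable f (T x).
  by move=> /OO'; exact: C1_differentiable.
apply: (@C1_make _ _ oO _ (fun i x =>
  \sum_k partial i (fun y => T y 0 k) x * partial k f (T x))).
- by move=> x Ox; apply: differentiable_comp; [exact: dT|exact: df].
- by move=> i x Ox; rewrite partial_chain //; [exact: dT|exact: df].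
- move=> i x Ox.
  have cTk k : {for x, continuous
      (fun y => partial i (fun y => T y 0 k) y * partial k f (T y))}.
    apply: continuousM; first exact: C1_continuous_partial (CT k) Ox.
    apply: continuous_comp; first exact: differentiable_continuous (dT _ Ox).
    by apply: C1_continuous_partial Cf _; exact: OO'.
  exact: continuous_at_sum.
Qed.

Lemma is_derive_along n (f : 'rV[R]_n -> R) (x : R -> 'rV[R]_n) t :
  derivable x t 1 -> differentiable f (x t) ->
  is_derive t 1 (f \o x) ('d f (x t) (derive1 x t)).
Proof.
move=> /derivable1_diffP dx df.
have dfx : differentiable (f \o x) t by exact: differentiable_comp.
apply: DeriveDef; first exact/derivable1_diffP.
by rewrite deriveE // diff_comp //= derive1E deriveE.
Qed.

Lemma is_derive_line n (z v : 'rV[R]_n) (t : R) :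
  is_derive t (1 : R) (fun s : R => z + s *: v) v.
Proof.
have [dZ dE] : is_diff t (fun s : R => s *: v) (fun s : R => s *: v).
  exact: is_diff_scalel.
have dz : is_derive t (1 : R) (fun s : R => s *: v) v.
  apply: DeriveDef; first exact/derivable1_diffP.
  by rewrite deriveE // dE scale1r.
have := is_deriveD (is_derive_cst z t (1 : R)) dz.
by rewrite add0r.
Qed.

Lemma ler_norm_coord n (v : 'rV[R]_n) k : `|v 0 k| <= `|v|.
Proof.
rewrite [leRHS]/Num.norm /= mx_normrE.
exact: (le_bigmax _ (fun ij : 'I_1 * 'I_n => `|v ij.1 ij.2|) (0, k)).
Qed.

Lemma norm_diff_le n (f : 'rV[R]_n -> R) x v (L : 'I_n -> R) :
  (forall k, `|partial k f x| <= L k) -> `|'d f x v| <= (\sum_k L k) * `|v|.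
Proof.
move=> fL; rewrite diff_partial (le_trans (ler_norm_sum _ _ _)) // mulr_suml.
apply: ler_sum => k _; rewrite normrM mulrC ler_pM //; exact: ler_norm_coord.
Qed.

Lemma norm_segment (U : normedModType R) (x y z : U) (e t : R) :
  `|x - y| < e -> `|x - z| < e -> 0 <= t <= 1 -> `|x - (z + t *: (y - z))| < e.
Proof.
move=> xy xz /andP[t0 t1].
have -> : x - (z + t *: (y - z)) = (1 - t) *: (x - z) + t *: (x - y).
  transitivity (x - z - t *: (y - z)); first by rewrite opprD addrA.
  rewrite scalerBl scale1r -[RHS]addrA; congr (_ + _).
  rewrite [RHS]addrC -scalerBr -scalerN; congr (_ *: _).
  by rewrite !opprB [RHS]addrC addrA subrK.
rewrite (le_lt_trans (ler_normD _ _)) // !normrZ ger0_norm ?subr_ge0 //.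
rewrite (ger0_norm t0) (@le_lt_trans _ _ (Num.max `|x - z| `|x - y|)) //.
  set m := Num.max _ _.
  have hz : `|x - z| <= m by rewrite le_max lexx.
  have hy : `|x - y| <= m by rewrite le_max lexx orbT.
  by nra.
by rewrite gt_max xz xy.
Qed.

(** Mean value theorem along a segment of a ball on which every partial derivative is bounded by its
    absolute value at [x] plus 1. *)
Lemma C1_lipschitz_near n (O : set 'rV[R]_n) f x : open O -> Ck 1 O f -> O x ->
  lipschitz_near f x.
Proof.
move=> oO Cf Ox; pose L k : R := `|partial k f x| + 1.
have nL : \forall y \near x, O y /\ forall k, `|partial k f y| <= L k.
  apply: filterI; first exact: open_nbhs_nbhs.
  have /= := @filter_forall _ _ (fun k y => `|partial k f y| <= L k) (nbhs x) _; apply => k.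
  have := C1_continuous_partial Cf Ox (i := k).
  move=> /cvgrPdist_le /(_ 1 ltr01); apply: filterS => y yx.
  have := lerB_dist (partial k f y) (partial k f x); rewrite distrC.
  by move=> /le_trans /(_ yx); rewrite lerBlDl.
move: nL => /nbhs_ballP[e /= e0 eL].
exists (\sum_k L k), (ball x e); first exact: nbhsx_ballx.
move=> y z; rewrite -ball_normE /= => xy xz.
pose c t : 'rV[R]_n := z + t *: (y - z).
have cb t : 0 <= t <= 1 -> ball x e (c t).
  by rewrite -ball_normE; exact: norm_segment.
have dc (t : R) : is_derive t (1 : R) c (y - z) by exact: is_derive_line.
have [t t01 E] : exists2 t, t \in `[0, 1]%R &
    f (c 1) - f (c 0) = 'd f (c t) (y - z) * (1 - 0).
  apply: (@MVT_segment R (f \o c) (fun t => 'd f (c t) (y - z))) => //.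
    move=> t /subset_itv_oo_cc t01.
    have ct : derive1 c t = y - z by rewrite derive1E derive_val.
    rewrite -ct; apply: is_derive_along => //.
    by apply: (C1_differentiable Cf); have [] := eL (c t) (cb t t01).
  apply: derivable_within_continuous => t t01.
  apply/derivable1_diffP/differentiable_comp; first exact/derivable1_diffP.
  by apply: (C1_differentiable Cf); have [] := eL (c t) (cb t t01).
have -> : f y - f z = f (c 1) - f (c 0).
  by congr (f _ - f _); rewrite /c ?scale1r ?scale0r ?addr0 // addrC subrK.
rewrite E subr0 mulr1; apply: norm_diff_le => k.
have [] := eL (c t); first by apply: cb; move: t01; rewrite in_itv.
by move=> _; exact.
Qed.

Lemma differentiable_big_prod n (I : eqType) (r : seq I)
    (f : I -> 'rV[R]_n -> R) x : (forall j, differentiable (f j) x) ->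
  differentiable (fun y => \prod_(j <- r) f j y) x.
Proof.
move=> df; elim: r => [|j r IH].
  rewrite (_ : (fun _ => _) = cst 1); first exact: differentiable_cst.
  by apply/funext => y; rewrite big_nil.
rewrite (_ : (fun _ => _) = f j * (fun y => \prod_(j <- r) f j y)).
  exact: differentiableM.
by apply/funext => y; rewrite big_cons.
Qed.

Lemma partial_big_prod n (I : eqType) (r : seq I)
    (f : I -> 'rV[R]_n -> R) i x : uniq r ->
  (forall j, differentiable (f j) x) ->
  partial i (fun y => \prod_(j <- r) f j y) x =
  \sum_(j <- r) partial i (f j) x * \prod_(k <- r | k != j) f k x.
Proof.
move=> + df; elim: r => [_|j r IH /= /andP[jr ur]].
  rewrite big_nil (_ : (fun _ => _) = fun=> 1) ?partial_cst //.
  by apply/funext => y; rewrite big_nil.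
rewrite (_ : (fun _ => _) = fun y => f j y * (fun y => \prod_(j <- r) f j y) y); last first.
  by apply/funext => y; rewrite big_cons.
rewrite partialM //; last exact: differentiable_big_prod.
rewrite IH // big_cons big_cons eqxx /=; congr (_ * _ + _).
  rewrite big_seq [RHS]big_seq_cond; apply: eq_bigl => k.
  by case: eqP => [->|]; rewrite ?(negPf jr) // andbT.
rewrite mulr_sumr; apply: eq_big_seq => k kr.
rewrite big_cons; have -> : j != k by apply: contraNneq jr => ->.
by rewrite mulrCA.
Qed.

Lemma partial_sum n I (r : seq I) (f : I -> 'rV[R]_n -> R) i x :
  (forall j, differentiable (f j) x) ->
  differentiable (fun y => \sum_(j <- r) f j y) x /\
  partial i (fun y => \sum_(j <- r) f j y) x = \sum_(j <- r) partial i (f j) x.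
Proof.
move=> df; elim: r => [|j r [IHd IHp]].
  rewrite big_nil (_ : (fun _ => _) = fun=> 0); last first.
    by apply/funext => y; rewrite big_nil.
  by rewrite partial_cst; split => //; exact: differentiable_cst.
rewrite (_ : (fun _ => _) = fun y => f j y + (fun y => \sum_(j <- r) f j y) y); last first.
  by apply/funext => y; rewrite big_cons.
by rewrite big_cons partialD // IHp; split => //; exact: differentiableD.
Qed.

(** Differentiating the Leibniz formula factor by factor, the terms for row [j] add up to the
    determinant of [G] with row [j] replaced by its derivative, which is then expanded along that
    row. *)
Lemma partial_det n m (G : 'rV[R]_n -> 'M[R]_m) i x :
  (forall j k, differentiable (fun y => G y j k) x) ->
  partial i (fun y => \det (G y)) x =
  \sum_j \sum_k partial i (fun y => G y j k) x * cofactor (G x) j k.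
Proof.
move=> dG.
have dp (s : {perm 'I_m}) : differentiable (fun y => \prod_j G y j (s j)) x.
  exact: differentiable_big_prod.
have dsp (s : {perm 'I_m}) : differentiable (fun y => (-1) ^+ s * \prod_j G y j (s j)) x.
  by apply: differentiableM => //; exact: differentiable_cst.
rewrite /determinant (partial_sum _ i dsp).2.
have E (s : {perm 'I_m}) :
    partial i (fun y => (-1) ^+ s * \prod_j G y j (s j)) x =
    \sum_j (-1) ^+ s * (partial i (fun y => G y j (s j)) x *
                        \prod_(k | k != j) G x k (s k)).
  by rewrite partialZ // partial_big_prod ?index_enum_uniq // mulr_sumr.
rewrite (eq_bigr _ (fun s _ => E s)).
rewrite exchange_big /=; apply: eq_bigr => j _.
pose H : 'M[R]_m := \matrix_(a, b)
  if a == j then partial i (fun y => G y a b) x else G x a b.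
transitivity (\det H).
  rewrite /determinant; apply: eq_bigr => s _; congr (_ * _).
  rewrite [RHS](bigD1 j) //= mxE eqxx; congr (_ * _).
  by apply: eq_bigr => k kj; rewrite mxE (negPf kj).
rewrite (expand_det_row H j); apply: eq_bigr => k _.
rewrite mxE eqxx; congr (_ * _); rewrite /cofactor; congr (_ * \det _).
by apply/matrixP => a b; rewrite !mxE eq_sym (negPf (neq_lift _ _)).
Qed.

(** Jacobi's formula, obtained by writing cofactors as entries of the inverse times the
    determinant. *)
Lemma partial_det_unit n m (G : 'rV[R]_n -> 'M[R]_m) i x :
  (forall j k, differentiable (fun y => G y j k) x) -> G x \in unitmx ->
  partial i (fun y => \det (G y)) x =
  \det (G x) *
    \sum_j \sum_k invmx (G x) k j * partial i (fun y => G y j k) x.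
Proof.
move=> dG uG; have d0 : \det (G x) != 0 by rewrite -unitfE -unitmxE.
rewrite partial_det // mulr_sumr; apply: eq_bigr => j _.
rewrite mulr_sumr; apply: eq_bigr => k _.
by rewrite /invmx uG !mxE; field.
Qed.

End calculus.

(** * Positive definite bilinear forms *)

Section forms.
Variables (R : realType) (n : nat).
Implicit Types (G : 'M[R]_n) (v w : 'rV[R]_n).

Definition gform G v w : R := (v *m G *m w^T) 0 0.

Definition posdef G := G^T = G /\ forall v, v != 0 -> 0 < gform G v v.

Lemma gformDl G v v' w : gform G (v + v') w = gform G v w + gform G v' w.
Proof. by rewrite /gform !mulmxDl mxE. Qed.

Lemma gformZl G a v w : gform G (a *: v) w = a * gform G v w.
Proof. by rewrite /gform -!scalemxAl mxE. Qed.

Lemma gformC G v w : G^T = G -> gform G v w = gform G w v.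
Proof.
move=> GT; rewrite /gform -[in LHS](trmxK (v *m G *m w^T)) mxE.
by rewrite !trmx_mul trmxK GT mulmxA.
Qed.

Lemma gformDr G v v' w : gform G w (v + v') = gform G w v + gform G w v'.
Proof. by rewrite /gform linearD mulmxDr mxE. Qed.

Lemma gformZr G a v w : gform G w (a *: v) = a * gform G w v.
Proof. by rewrite /gform linearZ -scalemxAr mxE. Qed.

Lemma gform_ge0 G v : posdef G -> 0 <= gform G v v.
Proof.
move=> [_ Gp]; have [->|/Gp/ltW //] := eqVneq v 0.
by rewrite /gform mul0mx mul0mx mxE.
Qed.

Lemma gform_eq0 G v : posdef G -> gform G v v = 0 -> v = 0.
Proof.
by move=> [_ Gp]; have [//|/Gp /[swap] ->] := eqVneq v 0; rewrite ltxx.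
Qed.

Lemma gform_cauchy_schwarz G v w : posdef G ->
  gform G v w ^+ 2 <= gform G v v * gform G w w.
Proof.
move=> pG; have [GT _] := pG.
have [->|w0] := eqVneq w 0.
  by rewrite /gform trmx0 !mulmx0 mxE mulr0 expr0n.
have cw : 0 < gform G w w by apply pG.2.
have := gform_ge0 (v + (- (gform G v w / gform G w w)) *: w) pG.
rewrite !(gformDl, gformDr, gformZl, gformZr) (gformC w v GT) => h.
set b := gform G v w in h *; set c := gform G w w in h cw *; set a := gform G v v in h *.
have cn : c != 0 by rewrite gt_eqF.
have E : c * (a + - (b / c) * b + (- (b / c) * b + - (b / c) * (- (b / c) * c)))
    = a * c - b ^+ 2 by field.
by rewrite -subr_ge0 -E mulr_ge0 // ltW.
Qed.

Lemma posdef_unitmx G : posdef G -> G \in unitmx.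
Proof.
move=> pG; rewrite -row_free_unit -kermx_eq0; apply/eqP/row_matrixP => i.
rewrite row0; apply: (gform_eq0 pG).
have : row i (kermx G) *m G = 0 by rewrite -row_mul mulmx_ker row0.
by rewrite /gform => ->; rewrite mul0mx mxE.
Qed.

Lemma trmx_invmx G : posdef G -> (invmx G)^T = invmx G.
Proof. by move=> [GT _]; rewrite trmx_inv GT. Qed.

Lemma gform_invmx G v w : posdef G ->
  gform G (v *m invmx G) (w *m invmx G) = gform (invmx G) v w.
Proof.
move=> pG; have uG := posdef_unitmx pG.
by rewrite /gform trmx_mul trmx_invmx // mulmxA mulmxKV.
Qed.

Lemma posdef_invmx G : posdef G -> posdef (invmx G).
Proof.
move=> pG; split; first exact: trmx_invmx.
move=> v v0; rewrite -gform_invmx //; apply pG.2.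
have uG := posdef_unitmx pG.
by apply: contra_neq v0 => vG; rewrite -(mulmxKV uG v) vG mul0mx.
Qed.

(** The transformation law of inverse metrics, which absorbs the Jacobians of [dchart_change].
    Taking determinants shows that [J] is invertible because [G] is. *)
Lemma invmx_congr (J G' G : 'M[R]_n) : G \in unitmx -> G = J *m G' *m J^T ->
  J^T *m invmx G *m J = invmx G'.
Proof.
move=> uG GE; have dJ : J \in unitmx.
  move: uG; rewrite GE !unitmxE !det_mulmx !unitrM => /andP[/andP[]] //.
have uG' : G' \in unitmx.
  move: uG; rewrite GE !unitmxE !det_mulmx !unitrM => /andP[/andP[_]] //.
apply: (can_inj (mulKmx uG')); rewrite mulmxV //.
have : G *m invmx G = 1%:M by rewrite mulmxV.
rewrite {1}GE => E.
have -> : G' *m (J^T *m invmx G *m J) =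
    invmx J *m (J *m G' *m J^T *m invmx G) *m J.
  by rewrite !mulmxA mulVmx // mul1mx.
by rewrite E mulmx1 mulVmx.
Qed.

(* [det] does not vanish on the segment from the identity to [G]. *)
Lemma posdef_det_gt0 G : posdef G -> 0 < \det G.
Proof.
move=> pG; pose A (t : R) := t *: (G - 1%:M) + 1%:M.
have pA t : 0 <= t <= 1 -> \det (A t) != 0.
  move=> /andP[t0 t1]; rewrite -unitfE -unitmxE; apply: posdef_unitmx; split.
    by rewrite /A linearD linearZ linearB /= trmx1 pG.1.
  move=> v v0.
  have -> : gform (A t) v v = t * gform G v v + (1 - t) * gform 1%:M v v.
    rewrite /gform /A mulmxDr mulmxDl -scalemxAr -scalemxAl mulmxBr mulmxBl.
    by rewrite !mxE; ring.
  have p1 : 0 < gform 1%:M v v.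
    rewrite /gform mulmx1 mxE lt_def; apply/andP; split; last first.
      by apply: sumr_ge0 => k _; rewrite mxE -expr2 sqr_ge0.
    apply: contra_neq v0; under eq_bigr do rewrite mxE -expr2.
    move/eqP; rewrite psumr_eq0 => [/allP vk|k _]; last exact: sqr_ge0.
    apply/rowP => k; rewrite mxE; apply/eqP.
    by rewrite -sqrf_eq0; exact: (implyP (vk k (mem_index_enum k))).
  have [->|tn0] := eqVneq t 0; first by rewrite mul0r add0r subr0 mul1r.
  apply: ltr_pwDl; first by rewrite mulr_gt0 ?pG.2 // lt_def tn0.
  by rewrite mulr_ge0 ?subr_ge0 // ltW.
(* The determinant along the segment is a polynomial in [t] with value 1 at 0, so the intermediate
   value theorem for polynomials would give a zero if [\det G] were nonpositive. *)
pose P : {poly R} := \det ('X *: map_mx polyC (G - 1%:M) + 1%:M).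
have PE t : P.[t] = \det (A t).
  rewrite -[LHS]/(horner_eval t P) /P -det_map_mx; congr (\det _).
  apply/matrixP => j k; rewrite !mxE rmorphD rmorphM rmorph_nat /=.
  by rewrite /horner_eval hornerX hornerC.
have G1 : \det G = P.[1] by rewrite PE /A scale1r subrK.
have P0 : P.[0] = 1 by rewrite PE /A scale0r add0r det1.
rewrite G1 ltNge; apply/negP => P1.
have [|t /pA + /eqP] := @poly_ivt _ (- P) 0 1 ler01.
  by rewrite !hornerN P0 oppr_le0 oppr_ge0 ler01.
by rewrite hornerN PE => /negPf h /eqP; rewrite oppr_eq0 h.
Qed.

Lemma gform_quadratic G v w a b : posdef G ->
  0 <= a ^+ 2 * gform G v v + 2 * (a * b) * gform G v w + b ^+ 2 * gform G w w.
Proof.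
move=> pG; have := gform_ge0 (a *: v + b *: w) pG.
rewrite gformDl !gformZl !gformDr !gformZr (gformC w v (proj1 pG)).
by move: (gform G v v) (gform G v w) (gform G w w) => x y z; lra.
Qed.

End forms.

(** * Charts and gradients *)

Section charts.
Variables (R : realType) (n : nat) (M : topologicalType).
Variables (A : smooth_atlas R n M) (g : riemannian_metric A).
Implicit Types (c : chart A) (f h : M -> R) (p q : M).

Definition overlap c c' : set 'rV[R]_n := coord c @` (dom c `&` dom c').

Definition transition c c' : 'rV[R]_n -> 'rV[R]_n := coord c' \o cinv c.

Lemma open_chart_img c : open (chart_img c).
Proof. exact: img_open. Qed.

Lemma chart_img_coord c p : dom c p -> chart_img c (coord c p).
Proof. by move=> cp; exists p. Qed.

Lemma dom_cinv c x : chart_img c x -> dom c (cinv c x).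
Proof. by move=> [p cp <-]; rewrite coordK. Qed.

Lemma cinvK c x : chart_img c x -> coord c (cinv c x) = x.
Proof. by move=> [p cp <-]; rewrite coordK. Qed.

Lemma near_dom c p : dom c p -> \forall q \near p, dom c q.
Proof. by move=> cp; apply: open_nbhs_nbhs; split => //; exact: dom_open. Qed.

Lemma near_chart_img c x : chart_img c x -> \forall y \near x, chart_img c y.
Proof.
by move=> cx; apply: open_nbhs_nbhs; split => //; exact: open_chart_img.
Qed.

Lemma near_cinv c p (P : set M) : dom c p ->
  (\forall q \near p, P q) -> \forall y \near coord c p, P (cinv c y).
Proof.
move=> cp nP; have := cinv_continuous (chart_img_coord cp).
by rewrite /prop_for /continuous_at coordK // => /(_ _ nP).
Qed.

Lemma near_coord c p (P : set 'rV[R]_n) : dom c p ->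
  (\forall y \near coord c p, P y) -> \forall q \near p, P (coord c q).
Proof. by move=> cp nP; exact: (coord_continuous cp). Qed.

Lemma overlapE c c' : overlap c c' = chart_img c `&` (cinv c @^-1` dom c').
Proof.
apply/seteqP; split=> [_ [p [cp c'p] <-]|x [[p cp <-]]] /=.
  by split; [exact: chart_img_coord|rewrite /= coordK].
by rewrite coordK // => c'p; exists p.
Qed.

Lemma open_overlap c c' : open (overlap c c').
Proof.
rewrite openE => _ [p [cp c'p] <-] /=; rewrite overlapE /interior.
apply: filterI; first exact/near_chart_img/chart_img_coord.
exact/near_cinv/near_dom.
Qed.

Lemma transition_C1 c c' k :
  Ck 1 (overlap c c') (fun x => transition c c' x 0 k).
Proof. exact: (@transition_smooth _ _ _ A c c' k 1). Qed.

Lemma transition_coord c c' p : dom c p -> transition c c' (coord c p) = coord c' p.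
Proof. by move=> cp; rewrite /transition /= coordK. Qed.

Lemma chart_changeE f c c' x : overlap c c' x ->
  (f \o cinv c' \o transition c c') x = (f \o cinv c) x.
Proof. by move=> [p [cp c'p] <-]; rewrite /= transition_coord // !coordK. Qed.

Lemma overlap_coord c c' p : dom c p -> dom c' p -> overlap c c' (coord c p).
Proof. by move=> cp c'p; exists p. Qed.

Lemma near_chart_change f c c' p : dom c p -> dom c' p ->
  \forall y \near coord c p, (f \o cinv c' \o transition c c') y = (f \o cinv c) y.
Proof.
move=> cp c'p; have : nbhs (coord c p) (overlap c c').
  by apply: open_nbhs_nbhs; split; [exact: open_overlap|exact: overlap_coord].
by apply: filterS => y; exact: chart_changeE.
Qed.

Lemma differentiable_transition c c' p : dom c p -> dom c' p ->
  differentiable (transition c c') (coord c p).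
Proof.
move=> cp c'p; apply: differentiable_rV => k.
apply: C1_differentiable (@transition_C1 c c' k) _; exact: overlap_coord.
Qed.

(** Stated in the chart used by [grad]; the choice is immaterial by [differentiable_atP]. *)
Definition differentiable_at f p := differentiable (f \o cinv (chart_at A p)) (coord (chart_at A p) p).

Lemma differentiable_chart f c c' p : dom c p -> dom c' p ->
  differentiable (f \o cinv c') (coord c' p) ->
  differentiable (f \o cinv c) (coord c p).
Proof.
move=> cp c'p df; apply: near_differentiable (near_chart_change f cp c'p) _.
apply: differentiable_comp; first exact: differentiable_transition.
by rewrite transition_coord.
Qed.

Lemma differentiable_atP f c p : dom c p ->
  differentiable_at f p <-> differentiable (f \o cinv c) (coord c p).
Proof.
by move=> cp; split; apply: differentiable_chart => //; exact: chart_at_dom.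
Qed.

Definition dchart c f (x : 'rV[R]_n) : 'rV[R]_n := \row_j partial j (f \o cinv c) x.

Lemma dchart_change f c c' p : dom c p -> dom c' p ->
  differentiable (f \o cinv c') (coord c' p) ->
  dchart c f (coord c p) =
  dchart c' f (coord c' p) *m ('J (transition c c') (coord c p))^T.
Proof.
move=> cp c'p df; apply/rowP => i.
have dT := differentiable_transition cp c'p.
have df' : differentiable (f \o cinv c') (transition c c' (coord c p)).
  by rewrite transition_coord.
rewrite !mxE -(near_partial _ _ (near_chart_change f cp c'p)); last first.
  exact: differentiable_comp.
rewrite partial_chain // transition_coord //; apply: eq_bigr => k _.
by rewrite !mxE mulrC -jacobianE // !mxE.
Qed.

Lemma posdef_gmx c x : chart_img c x -> posdef (gmx g c x).
Proof. by move=> cx; split; [exact: gmx_sym|exact: gmx_pos]. Qed.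

(** In coordinates g^jk d_j f d_k h, the inner product of the two gradients, with indices raised
    only once. *)
Definition gam c f h (x : 'rV[R]_n) : R :=
  gform (invmx (gmx g c x)) (dchart c f x) (dchart c h x).

Lemma gam_change f h c c' p : dom c p -> dom c' p ->
  differentiable_at f p -> differentiable_at h p ->
  gam c f h (coord c p) = gam c' f h (coord c' p).
Proof.
move=> cp c'p /(differentiable_atP _ c'p) df /(differentiable_atP _ c'p) dh.
rewrite /gam /gform (dchart_change cp c'p df) (dchart_change cp c'p dh).
have G := @gmx_transition _ _ _ _ g c c' p cp c'p.
have uG := posdef_unitmx (posdef_gmx (chart_img_coord cp)).
by rewrite -(invmx_congr uG G) trmx_mul trmxK !mulmxA.
Qed.

Definition Gam f h p : R := metric_inner g p (grad g f p) (grad g h p).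

Lemma GamE f h c p : dom c p -> differentiable_at f p -> differentiable_at h p ->
  Gam f h p = gam c f h (coord c p).
Proof.
move=> cp df dh; rewrite (gam_change cp (chart_at_dom A p) df dh).
rewrite /gam -gform_invmx //; exact/posdef_gmx/chart_img_coord/chart_at_dom.
Qed.

Definition is_C1 f := forall c, Ck 1 (chart_img c) (f \o cinv c).

Lemma smooth_is_C1 f : smooth A f -> is_C1 f.
Proof. by move=> sf c; exact: sf. Qed.

Lemma is_C1_differentiable f p : is_C1 f -> differentiable_at f p.
Proof.
move=> Cf; apply: C1_differentiable (Cf _) _.
exact/chart_img_coord/chart_at_dom.
Qed.

Lemma continuous_chart f c p : dom c p ->
  {for coord c p, continuous (f \o cinv c)} -> {for p, continuous f}.
Proof.
move=> cp cf; rewrite /prop_for /continuous_at.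
have <- : (f \o cinv c) (coord c p) = f p by rewrite /= coordK.
have cfc : {for p, continuous (f \o cinv c \o coord c)}.
  by apply: continuous_comp => //; exact: coord_continuous.
apply: cvg_trans cfc.
apply: near_eq_cvg; have := near_dom cp; apply: filterS => q cq.
by rewrite /= coordK.
Qed.

Lemma is_C1_continuous f : is_C1 f -> continuous f.
Proof.
move=> Cf p; have cp := chart_at_dom A p; apply: (continuous_chart cp).
apply: C1_continuous (Cf _) _; exact: chart_img_coord.
Qed.

Lemma is_C1_mul f h : is_C1 f -> is_C1 h -> is_C1 (fun p => f p * h p).
Proof.
by move=> Cf Ch c; exact: (C1_mul (@open_chart_img c) (Cf c) (Ch c)).
Qed.

End charts.

(** * Bump functions *)

Section plateau.
Variable R : realType.

(** A C1 cut-off is enough: bump functions enter the Green identity only through their first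
    derivatives. *)
Definition pos_sqr (t : R) : R := Num.max 0 t ^+ 2.

Lemma is_derive_pos_sqr (t : R) : is_derive t (1 : R) pos_sqr (2 * Num.max 0 t).
Proof.
have [t0|t0|<-] := ltgtP 0 t.
- apply: (@near_eq_is_derive _ _ _ ((@id R) ^+ 2)).
    have : \forall s \near t, 0 < s by apply: open_nbhs_nbhs; split=> //; exact: open_gt.
    by apply: filterS => s s0; rewrite /pos_sqr max_r ?ltW.
  apply: is_derive_eq; rewrite expr1 -[LHS]/(_ * _) mulr1.
  by rewrite -[id t]/t.
- apply: (@near_eq_is_derive _ _ _ (cst 0)).
    have : \forall s \near t, s < 0 by apply: open_nbhs_nbhs; split=> //; exact: open_lt.
    by apply: filterS => s s0; rewrite /pos_sqr max_l ?ltW // expr0n.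
  by rewrite mulr0; exact: is_derive_cst.
have c : (fun h => h^-1 *: (pos_sqr (h *: 1 + 0) - pos_sqr 0)) @ 0^' --> (0 : R).
  apply/cvgrPdist_le => e e0; near=> h.
  have h0 : h != 0 by near: h; exact: nbhs_dnbhs_neq.
  rewrite sub0r normrN addr0 {2}/pos_sqr maxxx expr0n subr0.
  rewrite -[X in `|X|]/(_ * _) -[X in pos_sqr X]/(_ * _) mulr1 normrM normfV.
  have he : `|h| <= e by near: h; exact: dnbhs0_le.
  apply: le_trans he; rewrite ler_pdivrMl ?normr_gt0 // -expr2 real_normK ?num_real //.
  rewrite ger0_norm ?sqr_ge0 // /pos_sqr.
  by have [h1|h1] := leP 0 h; rewrite ?expr0n ?sqr_ge0.
rewrite mulr0; apply: DeriveDef; first by apply/cvg_ex; exists 0.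
exact/cvg_lim.
Unshelve. all: by end_near. Qed.

Lemma pos_sqr_ge0 t : 0 <= pos_sqr t.
Proof. exact: sqr_ge0. Qed.

Lemma pos_sqr_le0 t : t <= 0 -> pos_sqr t = 0.
Proof. by move=> t0; rewrite /pos_sqr max_l // expr0n. Qed.

Lemma pos_sqr_le1 t : t <= 1 -> pos_sqr t <= 1.
Proof.
move=> t1; rewrite /pos_sqr expr_le1 ?le_max ?lexx //.
by rewrite ge_max ler01 t1.
Qed.

(* Equal to 1 for [s <= 1] and to 0 for [2 <= s]. *)
Definition plateau (s : R) : R := pos_sqr (1 - pos_sqr (s - 1)).

Lemma plateau1 s : s <= 1 -> plateau s = 1.
Proof.
move=> s1; rewrite /plateau [pos_sqr (s - 1)]pos_sqr_le0 ?subr_le0 // subr0.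
by rewrite /pos_sqr max_r ?ler01 // expr1n.
Qed.

Lemma plateau0 s : 2 <= s -> plateau s = 0.
Proof.
move=> s2; rewrite /plateau pos_sqr_le0 // subr_le0 /pos_sqr max_r; last by lra.
by rewrite exprn_ege1 //; lra.
Qed.

Lemma plateau_ge0 s : 0 <= plateau s. Proof. exact: pos_sqr_ge0. Qed.

Lemma plateau_le1 s : plateau s <= 1.
Proof. by apply: pos_sqr_le1; rewrite gerBl pos_sqr_ge0. Qed.

Lemma C1_pos_sqr n (O : set 'rV[R]_n) f : open O -> Ck 1 O f ->
  Ck 1 O (fun x => pos_sqr (f x)).
Proof.
move=> oO Cf; apply: (C1_comp oO Cf (dh := fun t => 2 * Num.max 0 t)).
  by move=> x _; exact: is_derive_pos_sqr.
move=> x _; apply: continuousM; first exact: cst_continuous.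
by apply: continuous_max; [exact: cst_continuous|exact: cvg_id].
Qed.

Lemma C1_coord n (O : set 'rV[R]_n) i : open O -> Ck 1 O (fun x => x 0 i).
Proof.
move=> oO; apply: (C1_make oO (df := fun j _ => (delta_mx 0 j : 'rV_n) 0 i)).
- by move=> x _; exact: differentiable_coord.
- move=> j x _; rewrite /partial -(@diff_rV _ _ _ id) //.
  by rewrite (_ : 'd id x = id :> (_ -> _)) // diff_val.
- by move=> j x _; exact: cst_continuous.
Qed.

Lemma C1_sqr_dist n (O : set 'rV[R]_n) (x0 : 'rV[R]_n) K : open O ->
  Ck 1 O (fun x => K * \sum_i (x 0 i - x0 0 i) ^+ 2).
Proof.
move=> oO; have Cc a : Ck 1 O (fun=> a : R) by exact: C1_cst.
have Ci i : Ck 1 O (fun x => x 0 i - x0 0 i).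
  exact: (C1_add oO (C1_coord i oO) (Cc (- x0 0 i))).
have Csq := C1_sum oO (index_enum 'I_n) predT (fun i => C1_mul oO (Ci i) (Ci i)).
exact: (C1_mul oO (Cc K) Csq).
Qed.

Lemma C1_plateau_ball n (O : set 'rV[R]_n) (x0 : 'rV[R]_n) K : open O ->
  Ck 1 O (fun x => plateau (K * \sum_i (x 0 i - x0 0 i) ^+ 2)).
Proof.
move=> oO; have Cc a : Ck 1 O (fun=> a : R) by exact: C1_cst.
have Cs := C1_pos_sqr oO (C1_add oO (C1_sqr_dist x0 K oO) (Cc (- 1))).
have C1s := C1_add oO (Cc 1) (C1_mul oO (Cc (- 1)) Cs).
have CP := C1_pos_sqr oO C1s.
apply: (C1_ext oO _ CP) => x _.
by rewrite /plateau mulN1r.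
Qed.

End plateau.

Section bump.
Variables (R : realType) (n : nat) (M : topologicalType).
Variable A : smooth_atlas R n M.
Implicit Types (c : chart A) (f : M -> R) (p q : M).

Lemma is_C1_local f : (forall c p, dom c p -> exists O : set 'rV[R]_n,
  [/\ open O, O (coord c p) & Ck 1 O (f \o cinv c)]) -> is_C1 A f.
Proof.
move=> fP c; split=> [_ [p cp <-]|i _ [p cp <-]].
  have [W [oW Wp CW]] := fP c p cp; exact: (C1_differentiable CW).
have [W [oW Wp CW]] := fP c p cp; exact: (C1_continuous_partial CW).
Qed.

Lemma closed_support_sub f (K : set M) : closed K ->
  (forall p, ~ K p -> f p = 0) -> closed_support f `<=` K.
Proof.
move=> cK f0; rewrite /closed_support closureE => p; apply; split => // q /= fq.
by apply: contrapT => /f0 fq0; rewrite fq0 eqxx in fq.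
Qed.

Lemma support_closed_support f p : f p != 0 -> closed_support f p.
Proof. by move=> fp; exact: subset_closure. Qed.

(** The plateau of a rescaled squared coordinate distance lives on a compact part of one chart.
    Compact sets are closed in a Hausdorff space, so its extension by zero is C1 in every chart. *)
Lemma bump_exists p0 (U : set M) : nbhs p0 U -> exists eta : M -> R,
  [/\ is_C1 A eta, forall p, 0 <= eta p <= 1, \forall p \near p0, eta p = 1,
      compact (closed_support eta) &
      closed_support eta `<=` U `&` dom (chart_at A p0)].
Proof.
move=> U0; set c0 := chart_at A p0; have c0p : dom c0 p0 by exact: chart_at_dom.
set x0 := coord c0 p0.
have [e /= e0 eU] : exists2 e : R, 0 < e &
    ball x0 e `<=` chart_img c0 `&` (cinv c0 @^-1` U).
  apply/nbhs_ballP; apply: filterI; first exact/near_chart_img/chart_img_coord.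
  exact: near_cinv.
(* [K * e ^+ 2 = 4] exceeds 2, the value from which [plateau] vanishes, so [sq x <= 2] keeps [x] in
   the ball of radius [e]. *)
pose K := (2 / e) ^+ 2.
have K0 : 0 < K by rewrite exprn_gt0 // divr_gt0.
pose sq (x : 'rV[R]_n) : R := K * \sum_i (x 0 i - x0 0 i) ^+ 2.
have sq_coord (x : 'rV[R]_n) i : K * (x 0 i - x0 0 i) ^+ 2 <= sq x.
  rewrite /sq (bigD1 i) //= mulrDr lerDl mulr_ge0 ?(ltW K0) //.
  by apply: sumr_ge0 => k _; exact: sqr_ge0.
have sq_ball (x : 'rV[R]_n) : sq x <= 2 -> ball x0 e x.
  move=> sx; split => // a i; rewrite ord1 /ball /=.
  have := le_trans (sq_coord x i) sx; rewrite -real_normK ?num_real // distrC => h.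
  have : `|x0 0 i - x 0 i| ^+ 2 < e ^+ 2.
    have KE : K * e ^+ 2 = 4.
      by rewrite /K expr_div_n mulfVK ?expf_neq0 ?gt_eqF // -natrX.
    rewrite -(ltr_pM2l K0) KE; apply: le_lt_trans h _.
    by rewrite ltr_nat.
  by rewrite ltr_pXn2r // nnegrE // ltW.
have csq : continuous sq.
  by move=> x; exact: (C1_continuous (C1_sqr_dist x0 K openT) I).
pose B := [set x | sq x <= 2].
have cB : compact B.
  apply: bounded_closed_compact.
    exists (`|x0| + e); split; first exact: num_real.
    move=> r rx x /sq_ball; rewrite -ball_normE /= => xe.
    apply/ltW/(le_lt_trans _ rx); rewrite -[x](subKr x0).
    by rewrite (le_trans (ler_normB _ _)) // lerD2l ltW.
  have := @closed_comp _ _ sq [set y | y <= 2] _ (@closed_le R 2).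
  by apply => x _; exact: csq.
pose Kc := cinv c0 @` B.
have Bimg x : B x -> chart_img c0 x by move=> /sq_ball/eU [].
have BU x : B x -> U (cinv c0 x) by move=> /sq_ball/eU [].
have cKc : compact Kc.
  apply: continuous_compact cB; apply: continuous_in_subspaceT => x.
  by rewrite inE => /Bimg; exact: cinv_continuous.
have clKc : closed Kc by exact: compact_closed (atlas_hausdorff A) cKc.
pose eta p := if pselect (dom c0 p) then plateau (sq (coord c0 p)) else 0.
have eta0 p : ~ Kc p -> eta p = 0.
  move=> Kp; rewrite /eta; case: pselect => // cp; apply: plateau0.
  rewrite leNgt; apply/negP => sp; apply: Kp; exists (coord c0 p).
    exact: ltW.
  exact: coordK.
have sKc := closed_support_sub clKc eta0.
exists eta; split.
- apply: is_C1_local => c p cp; have [c0q|c0q] := pselect (dom c0 p).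
    exists (overlap c c0); split; [exact: open_overlap|exact: overlap_coord|].
    have CP := @C1_plateau_ball R n setT x0 K openT.
    have Ch := C1_chain (@open_overlap _ _ _ _ c c0) (fun x _ => I) CP
      (@transition_C1 _ _ _ _ c c0).
    apply: (C1_ext (@open_overlap _ _ _ _ c c0) _ Ch) => x [q [cq c0q'] <-].
    by rewrite /= transition_coord // coordK // /eta; case: pselect.
  (* Outside the domain of [c0] the point avoids the closed set [Kc], so [eta] vanishes on a whole
     neighbourhood. *)
  have nK : ~ Kc p by move=> [x /Bimg/dom_cinv + xp]; rewrite xp.
  pose O := chart_img c `&` (cinv c @^-1` (~` Kc)).
  have oO : open O.
    rewrite openE => _ [[q cq <-]]; rewrite /= coordK // => nKq.
    apply: filterI; first exact/near_chart_img/chart_img_coord.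
    by apply: near_cinv => //; apply: open_nbhs_nbhs; split; [exact: closed_openC|].
  exists O; split => //.
    by split; [exact: chart_img_coord|rewrite /= coordK].
  by apply: (C1_ext oO _ (C1_cst oO 0)) => x [_ /eta0] /= ->.
- move=> p; rewrite /eta; case: pselect => [?|?] /=; last by rewrite lexx ler01.
  by rewrite plateau_ge0 plateau_le1.
- have : \forall x \near x0, sq x < 1.
    apply: (csq x0 [set y | y < 1]); apply: open_nbhs_nbhs; split.
      exact: open_lt.
    rewrite /= /sq big1 ?mulr0 // => i _.
    by rewrite subrr expr0n.
  move=> /(near_coord c0p); apply: filterS2 (near_dom c0p) => p cp sp.
  by rewrite /eta; case: pselect => //= ?; rewrite plateau1 // ltW.
- exact: subclosed_compact (@closed_closure _ _) cKc sKc.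
- by move=> _ /sKc [x Bx <-]; split; [exact: BU|apply: dom_cinv; exact: Bimg].
Qed.

End bump.

(** * Lipschitz functions for the Riemannian distance *)

Section real_lipschitz.
Variable R : realType.

Lemma derive_lipschitz_near (F dF : R -> R) (a : R) :
  (\forall s \near a, is_derive s (1 : R) F (dF s)) -> {for a, continuous dF} ->
  lipschitz_near F a.
Proof.
move=> nF cdF.
have nL : \forall s \near a,
    is_derive s (1 : R) F (dF s) /\ `|dF s| <= `|dF a| + 1.
  apply: filterI => //; move/cvgrPdist_le: cdF => /(_ 1 ltr01).
  apply: filterS => s sa; have := lerB_dist (dF s) (dF a); rewrite distrC.
  by move=> /le_trans /(_ sa); rewrite lerBlDl.
move: nL => /nbhs_ballP[e /= e0 eL].
exists (`|dF a| + 1), (ball a e); first exact: nbhsx_ballx.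
move=> y z ay az.
wlog yz : y z ay az / y <= z => [h|].
  have [/h|/ltW/h] := leP y z; first exact.
  by rewrite distrC [X in _ -> _ <= _ * X]distrC; exact.
have ball_yz t : t \in `[y, z]%R -> ball a e t.
  rewrite in_itv /= => /andP[yt tz].
  by move: ay az; rewrite -ball_normE /= !ltr_distlC => /andP[? ?] /andP[? ?]; lra.
have [t tyz E] : exists2 t, t \in `[y, z]%R & F z - F y = dF t * (z - y).
  apply: MVT_segment => // [t /subset_itv_oo_cc /ball_yz /eL []//|].
  apply: derivable_within_continuous => t /ball_yz /eL [[? _] _].
  by [].
rewrite distrC E normrM [`|y - z|]distrC ler_wpM2r //.
by have [] := eL _ (ball_yz _ tyz).
Qed.

Lemma lipschitz_near_mul (U : normedModType R) (f h : U -> R) x :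
  lipschitz_near f x -> lipschitz_near h x ->
  lipschitz_near (fun y => f y * h y) x.
Proof.
move=> lf lh.
have cf := lipschitz_near_continuous lf; have ch := lipschitz_near_continuous lh.
move: lf lh => [L [X nX LX]] [K [Y nY KY]].
have nb (k : U -> R) : {for x, continuous k} ->
    \forall y \near x, `|k y| <= `|k x| + 1.
  move=> /cvgrPdist_le /(_ 1 ltr01); apply: filterS => y yx.
  have := lerB_dist (k y) (k x); rewrite distrC.
  by move=> /le_trans /(_ yx); rewrite lerBlDl.
pose W y := X y /\ Y y /\ `|f y| <= `|f x| + 1 /\ `|h y| <= `|h x| + 1.
exists ((`|f x| + 1) * K + L * (`|h x| + 1)), W.
  by do 2 apply: filterI => //; apply: filterI; exact: nb.
move=> y z [Xy [Yy [fy hy]]] [Xz [Yz [fz hz]]].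
rewrite (_ : _ - _ = f y * (h y - h z) + (f y - f z) * h z); last by ring.
rewrite (le_trans (ler_normD _ _)) // !normrM mulrDl lerD //.
  by rewrite -mulrA ler_pM //; exact: KY.
by rewrite mulrAC ler_pM //; exact: LX.
Qed.

(** The comparison goes through simple functions, so a pointwise bound on the speed is enough to
    bound the length of an arc. *)
Lemma Rintegral01_le (f : R -> R) (b : R) :
  (forall t, 0 <= t <= 1 -> 0 <= f t <= b) ->
  (\int[lebesgue_measure]_(t in `[0, 1]) f t <= b)%R.
Proof.
move=> fb.
have I : `[(0 : R), 1]%classic = [set t : R | 0 <= t <= 1].
  by apply/seteqP; split=> t /=; rewrite in_itv.
have f0 : (0 <= \int[lebesgue_measure]_(t in `[0%R, 1%R]) (f t)%:E)%E.
  by apply: integral_ge0 => t; rewrite I lee_fin /= => /fb /andP[].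
have fle : (\int[lebesgue_measure]_(t in `[0%R, 1%R]) (f t)%:E <= b%:E)%E.
  have -> : b%:E = (\int[lebesgue_measure]_(t in `[0%R, 1%R]) b%:E)%E.
    rewrite integral_cst //= lebesgue_measure_itv /= lte_fin ltr01.
    by rewrite -EFinB subr0 mule1.
  rewrite integral_mkcond [leRHS]integral_mkcond.
  apply: ae_ge0_le_integral_nonmeasurable.
  - move=> t; rewrite /patch; case: ifPn => //.
    by rewrite I inE lee_fin => /fb /andP[].
  - move=> t; rewrite /patch; case: ifPn => //.
    by rewrite I inE lee_fin => /fb /andP[ft0]; exact: le_trans.
  - apply: aeW => t; rewrite /patch; case: ifPn => //.
    by rewrite I inE lee_fin => /fb /andP[].
rewrite -lee_fin fineK //; apply: fin_real.
by rewrite (lt_le_trans _ f0) // (le_lt_trans fle) // ltry.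
Qed.

End real_lipschitz.

Section distance.
Variables (R : realType) (n : nat) (M : topologicalType).
Variables (A : smooth_atlas R n M) (g : riemannian_metric A).
Implicit Types (c : chart A) (f h : M -> R) (p q : M).
Local Notation dist := (riemannian_dist g).

Definition speed c (x : R -> 'rV[R]_n) t : R :=
  Num.sqrt (gform (gmx g c (x t)) (derive1 x t) (derive1 x t)).

Lemma C1_arc_ge0 p q l : C1_arc g p q l -> 0 <= l.
Proof.
move=> [c [x [_ _ _ _ ->]]]; apply: Rintegral_ge0 => t _; exact: sqrtr_ge0.
Qed.

Lemma curve_length_ge0 p q l : curve_length g p q l -> 0 <= l.
Proof.
elim=> // p' q' r' l' l'' /C1_arc_ge0 l'0 _ l''0; exact: addr_ge0.
Qed.

Lemma dist_ge0 p q : (0 <= dist p q)%E.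
Proof.
apply: le_ereal_inf_tmp => _ [l pql <-].
rewrite lee_fin; exact: curve_length_ge0 pql.
Qed.

Lemma dist_le_arc p q l : C1_arc g p q l -> (dist p q <= l%:E)%E.
Proof.
move=> pql; apply: ereal_inf_lbound; exists (l + 0); last by rewrite addr0.
exact: curve_cons pql (curve_nil _ _).
Qed.

Lemma le_dist_curve (K : R) (d : R) p q : 0 < K ->
  (forall l, curve_length g p q l -> d <= K * l) -> (d%:E <= K%:E * dist p q)%E.
Proof.
move=> K0 dl; rewrite -lee_pdivrMl //; apply: le_ereal_inf_tmp => _ [l pql <-].
by rewrite -EFinM lee_fin ler_pdivrMl //; exact: dl.
Qed.

Lemma C1_gmx c j k : Ck 1 (chart_img c) (fun x => gmx g c x j k).
Proof. exact: (gmx_smooth g c j k 1). Qed.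

Lemma gform_le (G : 'M[R]_n) v :
  gform G v v <= (\sum_j \sum_k `|G j k|) * `|v| ^+ 2.
Proof.
rewrite /gform mxE; under eq_bigr do rewrite mxE mulr_suml.
rewrite exchange_big mulr_suml; apply: ler_sum => j _.
rewrite mulr_suml; apply: ler_sum => k _; rewrite mxE.
rewrite (le_trans (ler_norm _)) // !normrM mulrAC [leRHS]mulrC.
by rewrite ler_pM ?mulr_ge0 // expr2 ler_pM // ler_norm_coord.
Qed.

(** A coordinate ball is convex, and on a small one the metric form is at most [b x + 1] times the
    squared coordinate norm. The straight segment is thus an arc of length at most
    [Num.sqrt (b x + 1)] times its coordinate norm. *)
Lemma dist_le_norm c x : chart_img c x -> exists2 K : R, 0 < K &
  exists2 W, nbhs x W & forall y z, W y -> W z ->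
    (dist (cinv c y) (cinv c z) <= (K * `|y - z|)%:E)%E.
Proof.
move=> cx; pose b (y : 'rV[R]_n) := \sum_j \sum_k `|gmx g c y j k|.
have cb : {for x, continuous b}.
  apply: continuous_at_sum => j; apply: continuous_at_sum => k.
  apply: continuous_comp; last exact: norm_continuous.
  exact: C1_continuous (C1_gmx c j k) cx.
have nb : \forall y \near x, chart_img c y /\ b y <= b x + 1.
  apply: filterI; first exact: near_chart_img.
  move/cvgrPdist_le: cb => /(_ 1 ltr01); apply: filterS => y.
  by rewrite ler_distlC => /andP[].
have b0 : 0 <= b x by apply: sumr_ge0 => j _; apply: sumr_ge0.
move: nb => /nbhs_ballP[e /= e0 eb]; pose K := Num.sqrt (b x + 1).
exists K; first by rewrite sqrtr_gt0 ltr_wpDl.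
exists (ball x e); first exact: nbhsx_ballx.
move=> y z; rewrite -ball_normE /= => xy xz.
pose s t : 'rV[R]_n := y + t *: (z - y).
have ds (t : R) : is_derive t (1 : R) s (z - y) by exact: is_derive_line.
have ds1 : derive1 s = fun=> z - y.
  by apply/funext => t; rewrite derive1E derive_val.
have sb t : 0 <= t <= 1 -> ball x e (s t).
  by rewrite -ball_normE /=; exact: norm_segment.
have arc : C1_arc g (cinv c y) (cinv c z)
    (\int[lebesgue_measure]_(t in `[0, 1]) speed c s t)%R.
  exists c, s; split => //.
  - by split=> [t|]; [have [] := ds t|rewrite ds1; exact: cst_continuous].
  - by move=> t /sb/eb [].
  - by rewrite /s scale0r addr0.
  - by rewrite /s scale1r addrC subrK.
apply: (le_trans (dist_le_arc arc)); rewrite lee_fin.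
have sK t : 0 <= t <= 1 -> speed c s t <= K * `|y - z|.
  move=> /sb/eb [_ bK]; rewrite /speed ds1 -[`|y - z|]ger0_norm // -sqrtr_sqr.
  rewrite -sqrtrM ?ltr_wpDl // ?addr_ge0 // ler_wsqrtr //.
  by rewrite (le_trans (gform_le _ _)) // distrC ler_wpM2r ?sqr_ge0.
apply: Rintegral01_le => t t01; rewrite sqrtr_ge0; exact: sK.
Qed.

End distance.

Section gam_regularity.
Variables (R : realType) (n : nat) (M : topologicalType).
Variables (A : smooth_atlas R n M) (g : riemannian_metric A).
Implicit Types (c : chart A) (f h : M -> R) (p q : M).

Lemma unit_gmx c x : chart_img c x -> gmx g c x \in unitmx.
Proof. by move=> cx; apply: posdef_unitmx; exact: posdef_gmx. Qed.

Lemma C1_invgmx c j k : Ck 1 (chart_img c) (fun x => invmx (gmx g c x) j k).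
Proof.
apply: C1_invmx; [exact: open_chart_img|exact: C1_gmx|exact: unit_gmx].
Qed.

Lemma gamE c f h x : gam g c f h x =
  \sum_k \sum_j partial j (f \o cinv c) x * invmx (gmx g c x) j k *
                partial k (h \o cinv c) x.
Proof.
rewrite /gam /gform mxE; apply: eq_bigr => k _; rewrite mxE mulr_suml.
by apply: eq_bigr => j _; rewrite !mxE.
Qed.

Lemma continuous_gam c f h x : is_C1 A f -> is_C1 A h -> chart_img c x ->
  {for x, continuous (gam g c f h)}.
Proof.
move=> Cf Ch cx.
have -> : gam g c f h = (fun x => \sum_k \sum_j partial j (f \o cinv c) x *
    invmx (gmx g c x) j k * partial k (h \o cinv c) x).
  by apply/funext => y; exact: gamE.
apply: continuous_at_sum => k; apply: continuous_at_sum => j.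
apply: continuousM; last exact: C1_continuous_partial (Ch c) cx.
apply: continuousM; first exact: C1_continuous_partial (Cf c) cx.
exact: C1_continuous (C1_invgmx c j k) cx.
Qed.

Lemma continuous_Gam f h : is_C1 A f -> is_C1 A h -> continuous (Gam g f h).
Proof.
move=> Cf Ch p; have cp := chart_at_dom A p; apply: (continuous_chart cp).
have cx := chart_img_coord cp.
apply: (continuous_on_near (@open_chart_img _ _ _ _ _) cx _ (continuous_gam Cf Ch cx)).
move=> _ [q cq <-]; rewrite /= coordK // (GamE g cq) //; exact: is_C1_differentiable.
Qed.

Lemma gam_ge0 c f x : chart_img c x -> 0 <= gam g c f f x.
Proof. by move=> cx; apply/gform_ge0/posdef_invmx/posdef_gmx. Qed.

(** The differential is the metric product with the gradient, so this is Cauchy-Schwarz. *)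
Lemma diff_gam c f x v : chart_img c x ->
  `|'d (f \o cinv c) x v| <= Num.sqrt (gam g c f f x) * Num.sqrt (gform (gmx g c x) v v).
Proof.
move=> cx; have pG := posdef_gmx g cx; have uG := unit_gmx cx.
have -> : 'd (f \o cinv c) x v = gform (gmx g c x) (dchart c f x *m invmx (gmx g c x)) v.
  rewrite /gform mulmxKV // diff_partial mxE; apply: eq_bigr => k _.
  by rewrite !mxE mulrC.
rewrite -sqrtrM ?gam_ge0 // -sqrtr_sqr ler_wsqrtr // /gam -gform_invmx //.
exact: gform_cauchy_schwarz.
Qed.

Lemma continuous_compact_support_bounded (f : M -> R) : continuous f ->
  compact (closed_support f) -> exists2 K, 0 < K & forall p, `|f p| <= K.
Proof.
move=> cf sf; have [K [_ KP]] := compact_bounded (continuous_compact (continuous_subspaceT cf) sf).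
have K1 : 0 < `|K| + 1 by rewrite ltr_wpDl.
exists (`|K| + 1) => // p; have [->|fp] := eqVneq (f p) 0; first by rewrite normr0 ltW.
apply: (KP (`|K| + 1)); first by rewrite (le_lt_trans (ler_norm K)) // ltrDl.
by exists p => //; exact: support_closed_support.
Qed.

Lemma Gam_support f h p : ~ closed_support f p -> Gam g f h p = 0.
Proof.
move=> fp; have cp := chart_at_dom A p.
rewrite /Gam /grad /grad_in (_ : \row_j _ = 0) ?mul0mx.
  by rewrite /metric_inner !mul0mx mxE.
apply/rowP => j; rewrite !mxE.
have nf : \forall y \near coord (chart_at A p) p, cst 0 y = (f \o cinv (chart_at A p)) y.
  apply: (near_cinv (P := fun q => 0 = f q) cp).
  have : nbhs p (~` closed_support f).
    by apply: open_nbhs_nbhs; split; [exact/closed_openC/closed_closure|].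
  apply: filterS => q fq; apply/esym/eqP; apply: contra_notT fq.
  exact: support_closed_support.
by rewrite -(near_partial _ _ nf) //; exact: partial_cst.
Qed.

(** [Gam g f f] is continuous with compact support, hence bounded by some [B]. The derivative of [f]
    along an arc is then at most [Num.sqrt B] times the speed, and the fundamental theorem of
    calculus integrates this bound. *)
Lemma is_C1_lipschitz_arc f : is_C1 A f -> compact (closed_support f) ->
  exists2 K, 0 < K & forall p q l, C1_arc g p q l -> `|f p - f q| <= K * l.
Proof.
move=> Cf sf.
have cG : continuous (Gam g f f) by exact: continuous_Gam.
have sG : compact (closed_support (Gam g f f)).
  apply: subclosed_compact sf _; first exact: closed_closure.
  apply: closed_support_sub; first exact: closed_closure.
  exact: Gam_support.
have [B B0 BP] := continuous_compact_support_bounded cG sG.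
exists (Num.sqrt B) => [|p q l [c [x [[dx cdx] cx <- <- ->]]]]; first by rewrite sqrtr_gt0.
pose F := f \o cinv c; pose dF t := 'd F (x t) (derive1 x t).
have dFx (t : R) : 0 <= t <= 1 -> is_derive t (1 : R) (F \o x) (dF t).
  move=> t01; apply: is_derive_along; first exact: dx.
  exact: C1_differentiable (Cf c) (cx t t01).
have speedB (t : R) : 0 <= t <= 1 -> `|dF t| <= Num.sqrt B * speed g c x t.
  move=> t01; apply: (le_trans (diff_gam _ _ (cx t t01))).
  rewrite ler_wpM2r ?sqrtr_ge0 // ler_wsqrtr //.
  have [r cr xr] := cx t t01; rewrite -xr -(GamE g cr);
    try exact: is_C1_differentiable.
  exact: le_trans (ler_norm _) (BP r).
have cxt (t : R) : {for t, continuous x}.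
  by apply: differentiable_continuous; apply/derivable1_diffP; exact: dx.
have ccoord (y : R -> 'rV[R]_n) t k : {for t, continuous y} ->
    {for t, continuous (fun s => y s 0 k)}.
  move=> cy; apply: (@continuous_comp _ _ _ y (fun v : 'rV[R]_n => v 0 k)) => //.
  exact: matrix_normedtype.coord_continuous.
have cdF (t : R) : 0 <= t <= 1 -> {for t, continuous dF}.
  move=> t01.
  have -> : dF = fun t => \sum_k (derive1 x t) 0 k * partial k F (x t).
    by apply/funext => s; rewrite /dF diff_partial.
  apply: continuous_at_sum => k; apply: continuousM; first exact/ccoord/cdx.
  by apply: continuous_comp => //; exact: C1_continuous_partial (Cf c) (cx t t01).
have cspeed (t : R) : 0 <= t <= 1 -> {for t, continuous (speed g c x)}.
  move=> t01; rewrite /speed; apply: continuous_comp; last exact: sqrt_continuous.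
  have -> : (fun t => gform (gmx g c (x t)) (derive1 x t) (derive1 x t)) =
      fun t => \sum_k \sum_j (derive1 x t) 0 j * gmx g c (x t) j k * (derive1 x t) 0 k.
    apply/funext => s; rewrite /gform mxE; apply: eq_bigr => k _.
    by rewrite mxE mulr_suml mxE.
  apply: continuous_at_sum => k; apply: continuous_at_sum => j.
  apply: continuousM; last exact/ccoord/cdx.
  apply: continuousM; first exact/ccoord/cdx.
  apply: (@continuous_comp _ _ _ x (fun y => gmx g c y j k)) => //.
  exact: C1_continuous (C1_gmx g c j k) (cx t t01).
have I01 (t : R) : t \in `[0, 1]%classic -> 0 <= t <= 1 by rewrite inE /= in_itv.
have wdF : {within `[0, 1], continuous dF}.
  by apply: continuous_in_subspaceT => t /I01; exact: cdF.
have wspeed : {within `[0, 1], continuous (speed g c x)}.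
  by apply: continuous_in_subspaceT => t /I01; exact: cspeed.
have cFx (t : R) : 0 <= t -> t <= 1 -> {for t, continuous (F \o x)}.
  move=> t0 t1; apply: differentiable_continuous; apply/derivable1_diffP.
  by have [] : is_derive t (1 : R) (F \o x) (dF t) by apply: dFx; rewrite t0.
have ftc : (\int[lebesgue_measure]_(t in `[0%R, 1%R]) (dF t)%:E =
    (F (x 1))%:E - (F (x 0))%:E)%E.
  apply: (@continuous_FTC2 R dF (F \o x) 0 1) => //.
    split.
    - by move=> t /subset_itv_oo_cc; rewrite in_itv => /dFx [].
    - by apply: cvg_at_right_filter; exact: (cFx 0 (lexx 0) ler01).
    - by apply: cvg_at_left_filter; exact: (cFx 1 ler01 (lexx 1)).
  by move=> t /subset_itv_oo_cc; rewrite in_itv => /dFx [_ <-]; rewrite derive1E.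
have idF : lebesgue_measure.-integrable `[0%R, 1%R] (EFin \o dF).
  exact: continuous_compact_integrable (@segment_compact _ _ _) wdF.
have ispeed : lebesgue_measure.-integrable `[0%R, 1%R] (EFin \o (speed g c x)).
  exact: continuous_compact_integrable (@segment_compact _ _ _) wspeed.
have -> : f (cinv c (x 0)) - f (cinv c (x 1)) = - (F (x 1) - F (x 0)).
  by rewrite opprB.
have -> : F (x 1) - F (x 0) = (\int[lebesgue_measure]_(t in `[0, 1]) dF t)%R.
  by rewrite /Rintegral ftc.
rewrite normrN (le_trans (le_normr_Rintegral _ _)) //.
rewrite -RintegralZl //; apply: le_Rintegral => //.
- exact: integrable_norm.
- exact: (integrableZl _ (Num.sqrt B) ispeed).
Qed.

Lemma is_C1_lipschitz f : is_C1 A f -> compact (closed_support f) ->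
  exists2 K : R, 0 < K & forall p q, (`|f p - f q|%:E <= K%:E * riemannian_dist g p q)%E.
Proof.
move=> Cf sf; have [K K0 KP] := is_C1_lipschitz_arc Cf sf.
exists K => // p q; apply: le_dist_curve => // l; elim => [r|p' q' r l' l'' arc _ IH].
  by rewrite subrr normr0 mulr0.
rewrite -(subrKA (f q')) (le_trans (ler_normD _ _)) // mulrDr lerD //.
exact: KP arc.
Qed.

End gam_regularity.

Section lipschitz_functions.
Variables (R : realType) (n : nat) (M : topologicalType).
Variables (A : smooth_atlas R n M) (g : riemannian_metric A).
Implicit Types (c : chart A) (f h : M -> R) (p q : M).
Local Notation dist := (riemannian_dist g).

Definition lipschitz_at f p := exists2 U, nbhs p U & lipschitz_in g U f.

Lemma lipschitz_inP (U : set M) f : lipschitz_in g U f -> exists2 K : R, 0 < K &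
  forall p q, U p -> U q -> (`|f p - f q|%:E <= K%:E * dist p q)%E.
Proof.
move=> [K KP]; exists (`|K| + 1); first by rewrite ltr_wpDl.
move=> p q Up Uq; apply: (le_trans (KP p q Up Uq)); apply: lee_wpmul2r.
  exact: dist_ge0.
by rewrite lee_fin (le_trans (ler_norm K)) // lerDl.
Qed.

Lemma lipschitz_at_chart f c p : dom c p -> lipschitz_at f p ->
  lipschitz_near (f \o cinv c) (coord c p).
Proof.
move=> cp [U pU /lipschitz_inP[K K0 KP]].
have [L L0 [W xW LP]] := dist_le_norm g (chart_img_coord cp).
exists (K * L), (W `&` (cinv c @^-1` U)).
  by apply: filterI => //; exact: near_cinv.
move=> y z [Wy Uy] [Wz Uz]; rewrite -lee_fin.
apply: (le_trans (KP _ _ Uy Uz)).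
rewrite -mulrA EFinM; apply: lee_wpmul2l; first by rewrite lee_fin ltW.
exact: LP.
Qed.

Lemma lipschitz_at_continuous f p : lipschitz_at f p -> {for p, continuous f}.
Proof.
move=> lf; have cp := chart_at_dom A p.
apply: (continuous_chart cp); apply: lipschitz_near_continuous.
exact: lipschitz_at_chart.
Qed.

Lemma near_lipschitz_at f h p : (\forall q \near p, f q = h q) ->
  lipschitz_at f p -> lipschitz_at h p.
Proof.
move=> fh [U pU [K KP]]; exists (U `&` [set q | f q = h q]); first exact: filterI.
by exists K => q r [Uq <-] [Ur <-]; exact: KP.
Qed.

Lemma lipschitz_at_cst a p : lipschitz_at (fun=> a) p.
Proof.
exists setT; first exact: filterT.
by exists 0 => q r _ _; rewrite subrr normr0 mul0e.
Qed.

Lemma near_bounded f p : {for p, continuous f} ->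
  \forall q \near p, `|f q| <= `|f p| + 1.
Proof.
move=> /cvgrPdist_le /(_ 1 ltr01); apply: filterS => y yx.
have := lerB_dist (f y) (f p); rewrite distrC.
by move=> /le_trans /(_ yx); rewrite lerBlDl.
Qed.

Lemma lipschitz_at_mul f h p : lipschitz_at f p -> lipschitz_at h p ->
  lipschitz_at (fun q => f q * h q) p.
Proof.
move=> lf lh.
have nf := near_bounded (lipschitz_at_continuous lf).
have nh := near_bounded (lipschitz_at_continuous lh).
move: lf lh => [X nX /lipschitz_inP[L L0 LX]] [Y nY /lipschitz_inP[K K0 KY]].
exists ((X `&` Y) `&`
    ([set q | `|f q| <= `|f p| + 1] `&` [set q | `|h q| <= `|h p| + 1])).
  by do 2 apply: filterI => //; apply: filterI.
exists ((`|f p| + 1) * K + L * (`|h p| + 1)) => q r [[Xq Yq] [fq hq]] [[Xr Yr] [fr hr]].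
rewrite (_ : _ - _ = f q * (h q - h r) + (f q - f r) * h r); last by ring.
have f1 : 0 <= `|f p| + 1 by rewrite addr_ge0.
have h1 : 0 <= `|h p| + 1 by rewrite addr_ge0.
apply: (@le_trans _ _ (`|f q * (h q - h r)| + `|(f q - f r) * h r|)%:E).
  by rewrite lee_fin ler_normD.
rewrite !normrM EFinD [X in (_ <= X * _)%E]EFinD ge0_muleDl; last 2 first.
- by rewrite lee_fin mulr_ge0 // ltW.
- by rewrite lee_fin mulr_ge0 // ltW.
apply: leeD.
  rewrite !EFinM -muleA; apply: lee_pmul; rewrite ?lee_fin //; exact: KY.
rewrite EFinM muleC [X in (_ <= X * _)%E]EFinM [X in (_ <= X * _)%E]muleC -muleA.
by apply: lee_pmul; rewrite ?lee_fin //; exact: LX.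
Qed.

Lemma lipschitz_at_comp f (F : R -> R) p : lipschitz_at f p ->
  lipschitz_near F (f p) -> lipschitz_at (F \o f) p.
Proof.
move=> lf [L [X nX LX]]; have cf := lipschitz_at_continuous lf.
move: lf => [U nU /lipschitz_inP[K K0 KU]].
exists (U `&` (f @^-1` X)); first by apply: filterI => //; exact: cf.
exists (`|L| * K) => q r [Uq Xq] [Ur Xr].
apply: (@le_trans _ _ (`|L| * `|f q - f r|)%:E).
  by rewrite lee_fin (le_trans (LX _ _ Xq Xr)) // ler_wpM2r // ler_norm.
by rewrite !EFinM -muleA; apply: lee_wpmul2l; [rewrite lee_fin|exact: KU].
Qed.

(** For [p] near [p0], a point [q] in [U] is handled by the local constant. For [q] outside [U], a
    bump equal to 1 near [p0] and supported in [U] drops from 1 to 0; being globally Lipschitz, it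
    bounds the distance from below, while [f] varies by at most [2 * B]. *)
Lemma compact_support_lipschitz f : (forall p, lipschitz_at f p) ->
  compact (closed_support f) -> lipschitz_in g setT f.
Proof.
move=> lf sf.
have cf : continuous f by move=> p; exact: lipschitz_at_continuous.
have [B B0 BP] := continuous_compact_support_bounded cf sf.
have fB p q : `|f p - f q| <= 2 * B.
  by rewrite (le_trans (ler_normB _ _)) // mulr_natl mulr2n lerD.
(* Both orders, because the point lying in the compact support may be either argument of [dist]. *)
pose P (k : nat) p := forall q,
  ((`|f p - f q|%:E <= k%:R%:E * dist p q) /\
   (`|f p - f q|%:E <= k%:R%:E * dist q p))%E.
have /compact_near_coveringP cov := sf.
have [|N _ /(_ N (leqnn N)) NP] := cov nat \oo P _.
  move=> p0 _; have [U nU /lipschitz_inP[K K0 KU]] := lf p0.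
  have [eta [Ceta eta01 eta1 seta etaU]] := bump_exists A nU.
  have [L L0 LP] := is_C1_lipschitz g Ceta seta.
  near=> p k => q.
  have Up : U p by near: p.
  have etap : eta p = 1 by near: p.
  have Kk : K <= k%:R by near: k; exact: nbhs_infty_ger.
  have Lk : 2 * B * L <= k%:R by near: k; exact: nbhs_infty_ger.
  have step (d : \bar R) : (0 <= d)%E ->
      ((U q -> `|f p - f q|%:E <= K%:E * d) ->
       (`|eta p - eta q|%:E <= L%:E * d) ->
       `|f p - f q|%:E <= k%:R%:E * d)%E.
    move=> d0 Kd Ld; have [Uq|Uq] := pselect (U q).
      apply: (le_trans (Kd Uq)); apply: lee_wpmul2r => //.
    have etaq : eta q = 0.
      apply/eqP; apply: contra_notT Uq => /support_closed_support/etaU [].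
      by [].
    apply: (@le_trans _ _ ((2 * B * L)%:E * d)%E); last exact: lee_wpmul2r.
    rewrite EFinM -muleA; apply: (@le_trans _ _ ((2 * B)%:E * 1%:E)%E).
      by rewrite mule1 lee_fin.
    apply: lee_wpmul2l; first by rewrite lee_fin mulr_ge0 // ltW.
    by move: Ld; rewrite etap etaq subr0 normr1.
  split; apply: step; rewrite ?dist_ge0 //.
  - by move=> Uq; exact: KU.
  - by move=> Uq; rewrite distrC; exact: KU.
  - by rewrite distrC.
exists N%:R => p q _ _.
have [fp|fp] := pselect (closed_support f p); first by have [] := NP p fp q.
have [fq|fq] := pselect (closed_support f q).
  by have [_] := NP q fq p; rewrite distrC.
have f0 r : ~ closed_support f r -> f r = 0.
  by move=> fr; apply/eqP; apply: contra_notT fr; exact: support_closed_support.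
by rewrite !f0 // subrr normr0 mule_ge0 ?dist_ge0 // lee_fin.
Unshelve. all: by end_near. Qed.

End lipschitz_functions.

(** * Riemannian volume in charts *)

Section change_of_variables.
Context d1 d2 (S : measurableType d1) (T : measurableType d2) (R : realType).
Variables (m : {measure set S -> \bar R}) (mu : {measure set T -> \bar R}).
Variables (phi : S -> T) (w : S -> R) (D : set T).
Hypotheses (mphi : measurable_fun setT phi) (mw : measurable_fun setT w).
Hypothesis w0 : forall x, 0 <= w x.
Hypothesis muE : forall B, measurable B -> B `<=` D ->
  (mu B = \int[m]_x (w x * \1_B (phi x))%:E)%E.

Import HBNNSimple.

(** [mu] is described only on subsets of [D]. The level sets of [h] for nonzero values lie in [D],
    and the level 0 contributes nothing to either side. *)
Lemma nnsfun_change_of_variables (h : {nnsfun T >-> R}) :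
  (forall y, ~ D y -> h y = 0) ->
  (\int[mu]_y (h y)%:E = \int[m]_x (w x * h (phi x))%:E)%E.
Proof.
move=> hD; have mh y : measurable (h @^-1` [set y]) by exact: measurable_sfunP.
rewrite integralT_nnsfun sintegralE.
transitivity (\sum_(y \in range h)
    \int[m]_x (y%:E * (w x * \1_(h @^-1` [set y]) (phi x))%:E))%E.
  apply: eq_fsbigr => y; rewrite inE => -[t _ <-].
  have [->|ht0] := eqVneq (h t) 0.
    by rewrite mul0e integral0_eq // => x _; rewrite mul0e.
  rewrite muE //; last first.
    by move=> z /= hz; apply: contrapT => /hD hz0; rewrite -hz hz0 eqxx in ht0.
  rewrite ge0_integralZl ?lee_fin //.
  - apply/measurable_EFinP/measurable_funM => //.
    apply: measurableT_comp mphi; exact: measurable_indic.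
  - by move=> x _; rewrite lee_fin mulr_ge0.
rewrite -ge0_integral_fsum //.
- apply: eq_integral => x _; rewrite fimfunE fsbig_finite // fsbig_finite //=.
  rewrite mulr_sumr -sumEFin; apply: eq_bigr => y _.
  by rewrite -EFinM mulrCA.
- move=> y; apply/measurable_EFinP; apply: measurable_funM => //.
  apply: measurable_funM => //.
  by apply: measurableT_comp mphi; exact: measurable_indic.
- move=> y x _; rewrite -EFinM lee_fin indicE.
  have [hxy|] := boolP (phi x \in _); last by rewrite !mulr0.
  move: hxy; rewrite inE /= => <-.
  by rewrite !mulr_ge0.
Qed.

Lemma ge0_change_of_variables (f : T -> \bar R) : measurable_fun setT f ->
  (forall y, 0 <= f y)%E -> (forall y, ~ D y -> f y = 0%E) ->
  (\int[mu]_y f y = \int[m]_x ((w x)%:E * f (phi x)))%E.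
Proof.
move=> mf f0 fD; pose h := nnsfun_approx measurableT mf.
have hf y : (EFin \o h ^~ y) @ \oo --> f y by exact: cvg_nnsfun_approx.
have mEh k : measurable_fun setT (EFin \o h k) by exact/measurable_EFinP.
have mwh k : measurable_fun setT (fun x => (w x * h k (phi x))%:E).
  by apply/measurable_EFinP/measurable_funM => //; exact: measurableT_comp mphi.
transitivity (limn (fun k => \int[mu]_y (h k y)%:E))%E.
  rewrite -monotone_convergence //.
  - by apply: eq_integral => y _; apply/esym/cvg_lim => //; exact: hf.
  - by move=> k y _; rewrite lee_fin.
  - by move=> y _ a b ab; rewrite lee_fin; exact/lefP/nd_nnsfun_approx.
(* The simple approximations stay below [f], so they vanish off [D] too. *)
have hD k y : ~ D y -> h k y = 0.
  move=> Dy; have : ((h k y)%:E <= f y)%E.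
    by rewrite /h nnsfun_approxE; apply: le_approx.
  by rewrite fD // lee_fin => hk0; apply/eqP; rewrite eq_le hk0 fun_ge0.
under eq_fun do rewrite (nnsfun_change_of_variables (hD _)).
rewrite -monotone_convergence //.
- apply: eq_integral => x _; apply/cvg_lim => //.
  under eq_fun do rewrite EFinM.
  by apply: cvgeZl => //; exact: hf.
- by move=> k x _; rewrite lee_fin mulr_ge0.
- move=> x _ a b ab; rewrite lee_fin ler_wpM2l //.
  exact/lefP/nd_nnsfun_approx.
Qed.

End change_of_variables.

Section continuous_on.
Variable R : realType.

Lemma measurable_continuous_on (T1 T2 : ptopologicalType) (W : set T1) (f : T1 -> T2) :
  open W -> (forall x, W x -> {for x, continuous f}) ->
  measurable_fun (W : set (borelType T1)) (f : borelType T1 -> borelType T2).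
Proof.
move=> oW cf; apply: (@measurability _ _ _ (borelType T2) _ _ (@open T2)) => //.
move=> _ [U oU <-]; apply: open_borel; rewrite openE => x [Wx Ufx].
apply: filterI; first exact: open_nbhs_nbhs.
by apply: (cf x Wx); exact: open_nbhs_nbhs.
Qed.

Lemma measurable_continuous_on_real (T : ptopologicalType) (W : set T) (f : T -> R) :
  open W -> (forall x, W x -> {for x, continuous f}) ->
  measurable_fun (W : set (borelType T)) (f : borelType T -> R).
Proof.
move=> oW cf.
apply: (@measurability _ _ (borelType T) (measurableTypeR R) _ _ _
  (RGenOInfty.measurableE R)).
move=> _ [_ [a ->] <-]; apply: open_borel; rewrite openE => x [Wx Ufx].
apply: filterI; first exact: open_nbhs_nbhs.
by apply: (cf x Wx); apply: open_nbhs_nbhs; split => //; exact: interval_open.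
Qed.

End continuous_on.

Section volume.
Variables (R : realType) (n : nat) (M : ptopologicalType).
Variables (A : smooth_atlas R n M) (g : riemannian_metric A).
Variable vol : {measure set (borelType M) -> \bar R}.
Hypothesis volP : is_riemannian_volume g vol.
Implicit Types (c : chart A) (f h : M -> R) (p q : M).
Local Notation lam := (rV_lebesgue R n).

(* [density], [cinvT] and [coordT] are made total in a measurable way; nothing is
   known of [gmx], [cinv] and [coord] outside the chart. *)
Definition density c (x : 'rV[R]_n) : R :=
  if pselect (chart_img c x) then Num.sqrt (\det (gmx g c x)) else 0.

Definition cinvT c (x : 'rV[R]_n) : M :=
  if pselect (chart_img c x) then cinv c x else point.

Definition coordT c (p : M) : 'rV[R]_n :=
  if pselect (dom c p) then coord c p else 0.

Lemma measurable_dom c : measurable (dom c : set (borelType M)).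
Proof. by apply: open_borel; exact: dom_open. Qed.

Lemma measurable_chart_img c : measurable (chart_img c : set (borel_rV R n)).
Proof. by apply: open_borel; exact: open_chart_img. Qed.

Lemma measurable_if_set d1 d2 (T1 : measurableType d1) (T2 : measurableType d2)
    (W : set T1) (f : T1 -> T2) (a : T2) : measurable W -> measurable_fun W f ->
  measurable_fun setT (fun x => if pselect (W x) then f x else a).
Proof.
move=> mW mf _ B mB; rewrite setTI.
rewrite (_ : _ @^-1` B = (W `&` f @^-1` B) `|` (~` W `&` (cst a) @^-1` B)).
  apply: measurableU; first exact: mf.
  apply: measurableI; first exact: measurableC.
  by rewrite -[X in measurable X]setTI; exact: measurable_cst.
apply/seteqP; split=> x /=; case: pselect => Wx /=.
- by left.
- by right.
- by case=> [[]//|[]].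
- by case=> [[]//|[]].
Qed.

Lemma det_gmx_gt0 c x : chart_img c x -> 0 < \det (gmx g c x).
Proof. by move=> cx; apply: posdef_det_gt0; exact: posdef_gmx. Qed.

Lemma density_gt0 c x : chart_img c x -> 0 < density c x.
Proof.
by move=> cx; rewrite /density; case: pselect => //= ?; rewrite sqrtr_gt0 det_gmx_gt0.
Qed.

Lemma density_ge0 c x : 0 <= density c x.
Proof. by rewrite /density; case: pselect => //= ?; rewrite sqrtr_ge0. Qed.

Lemma C1_sqrt_det c : Ck 1 (chart_img c) (fun x => Num.sqrt (\det (gmx g c x))).
Proof.
have oI := @open_chart_img _ _ _ _ c.
have Cd : Ck 1 (chart_img c) (fun x => \det (gmx g c x)).
  by apply: C1_det => // j k; exact: C1_gmx.
apply: (C1_comp oI Cd (dh := fun y => (2 * Num.sqrt y)^-1)) => x cx.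
  exact/is_derive1_sqrt/det_gmx_gt0.
apply: continuousV; first by rewrite mulf_neq0 // gt_eqF // sqrtr_gt0 det_gmx_gt0.
by apply: continuousM; [exact: cst_continuous|exact: sqrt_continuous].
Qed.

Lemma measurable_density c : measurable_fun setT (density c : borel_rV R n -> R).
Proof.
apply: measurable_if_set; first exact: measurable_chart_img.
apply: measurable_continuous_on_real; first exact: open_chart_img.
by move=> x cx; exact: C1_continuous (C1_sqrt_det c) cx.
Qed.

Lemma measurable_cinvT c : measurable_fun setT (cinvT c : borel_rV R n -> borelType M).
Proof.
apply: measurable_if_set; first exact: measurable_chart_img.
apply: measurable_continuous_on; first exact: open_chart_img.
by move=> x; exact: cinv_continuous.
Qed.

Lemma measurable_coordT c : measurable_fun setT (coordT c : borelType M -> borel_rV R n).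
Proof.
apply: measurable_if_set; first exact: measurable_dom.
apply: measurable_continuous_on; first exact: dom_open.
by move=> x; exact: coord_continuous.
Qed.

Lemma cinvTE c x : chart_img c x -> cinvT c x = cinv c x.
Proof. by rewrite /cinvT; case: pselect. Qed.

Lemma coordTE c p : dom c p -> coordT c p = coord c p.
Proof. by rewrite /coordT; case: pselect. Qed.

Lemma vol_domE c (B : set (borelType M)) : measurable B -> B `<=` dom c ->
  vol B = (\int[lam]_x (density c x * \1_B (cinvT c x))%:E)%E.
Proof.
move=> mB BD; rewrite (volP mB BD).
have mf : measurable_fun setT
    ((fun x => (density c x * \1_B (cinvT c x))%:E) : borel_rV R n -> \bar R).
  apply/measurable_EFinP/measurable_funM; first exact: measurable_density.
  by apply: measurableT_comp (measurable_cinvT c); exact: measurable_indic.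
rewrite (rV_lebesgueE mf); last first.
  by move=> x; rewrite lee_fin mulr_ge0 // density_ge0.
congr Rn_integral; apply/funext => x; congr EFin.
rewrite /density /cinvT !indicE; case: pselect => cx /=.
  congr (_ * (nat_of_bool _)%:R); apply/idP/idP; rewrite !inE.
    by move=> [p Bp <-]; rewrite coordK //; exact: BD.
  by move=> Bx; exists (cinv c x) => //; rewrite cinvK.
rewrite mul0r memNset ?mulr0 // => -[p Bp xp]; apply: cx.
by exists p => //; exact: BD.
Qed.

Lemma integral_dom c (f : borelType M -> \bar R) : measurable_fun setT f ->
  (forall p, 0 <= f p)%E -> (forall p, ~ dom c p -> f p = 0%E) ->
  (\int[vol]_p f p = \int[lam]_x ((density c x)%:E * f (cinvT c x)))%E.
Proof.
move=> mf f0 fD.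
have H := @ge0_change_of_variables _ _ _ _ _ lam vol (cinvT c) (density c) (dom c).
exact: (H (measurable_cinvT c) (measurable_density c) (density_ge0 c) (@vol_domE c) f mf f0 fD).
Qed.

(** The density is positive on the whole chart, so a null integral of density times indicator makes
    the indicator vanish almost everywhere. *)
Lemma ae_chart c (P : M -> Prop) : {ae vol, forall p, P p} ->
  {ae lam, forall x, chart_img c x -> P (cinv c x)}.
Proof.
move=> [N [mN N0 PN]].
have mND : measurable (N `&` dom c) by apply: measurableI => //; exact: measurable_dom.
have ND0 : vol (N `&` dom c) = 0%E.
  by apply: subset_measure0 N0 => // p [].
move: ND0; rewrite (@vol_domE c _ mND); last by move=> p [].
set f := (fun x => (density c x * \1_(N `&` dom c) (cinvT c x))%:E).
have mf : measurable_fun setT (f : borel_rV R n -> \bar R).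
  apply/measurable_EFinP/measurable_funM; first exact: measurable_density.
  by apply: measurableT_comp (measurable_cinvT c); exact: measurable_indic.
have f0 x : (0 <= f x)%E by rewrite lee_fin mulr_ge0 // density_ge0.
move=> If; have : (\int[lam]_x `|f x| = 0)%E.
  by rewrite -[RHS]If; apply: eq_integral => x _; rewrite gee0_abs.
move/(ae_eq_integral_abs _ measurableT mf); apply: ae_mono => x /(_ Logic.I) /= fx cx.
apply: contrapT => Px; move: fx; rewrite /f cinvTE //.
rewrite indicE mem_set; last by split; [exact: PN|exact: dom_cinv].
by rewrite mulr1 => -[] /eqP; rewrite gt_eqF // density_gt0.
Qed.

Lemma ae_chart_inv c (P : 'rV[R]_n -> Prop) : {ae lam, forall x, P x} ->
  {ae vol, forall p, dom c p -> P (coord c p)}.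
Proof.
move=> [N [mN N0 PN]].
pose B : set (borelType M) := dom c `&` (coordT c @^-1` N).
have mB : measurable B.
  apply: measurableI; first exact: measurable_dom.
  by rewrite -[X in measurable X]setTI; exact: (measurable_coordT c measurableT mN).
exists B; split => //.
  rewrite (@vol_domE c _ mB); last by move=> p [].
  have -> : 0%E = (\int[lam]_(x in N) (density c x * \1_B (cinvT c x))%:E)%E.
    rewrite null_set_integral //.
    apply: measurable_funTS; apply/measurable_EFinP/measurable_funM; first exact: measurable_density.
    by apply: measurableT_comp (measurable_cinvT c); exact: measurable_indic.
  rewrite [RHS]integral_mkcond; apply: eq_integral => x _; rewrite /patch.
  case: ifPn => // xN; congr EFin; rewrite indicE.
  have [|] := boolP (_ \in B); last by rewrite mulr0.
  rewrite inE => -[Dx Nx]; rewrite /density; case: pselect => /= cx; last by rewrite mul0r.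
  move: Nx xN; rewrite /= cinvTE // coordTE ?cinvK //; last exact: dom_cinv.
  by move=> Nx; rewrite notin_setE.
move=> p /= /not_implyP[cp Pp]; split => //=; rewrite coordTE //.
exact: PN.
Qed.

(** The representative [h] of the chart expression, divided by the density and pulled back to [M],
    gives a measurable representative of [F]. *)
Lemma has_integral_chart c (F : M -> R) s : (forall p, ~ dom c p -> F p = 0) ->
  has_integral lam (fun x => density c x * F (cinvT c x)) s ->
  has_integral vol F s.
Proof.
move=> FD [h [ih Fh hs]]; have mh : measurable_fun setT h.
  by have /measurable_EFinP := measurable_int _ ih.
pose k (x : borel_rV R n) : R :=
  h x * if pselect (chart_img c x) then (Num.sqrt (\det (gmx g c x)))^-1 else 0.
have kE x : chart_img c x -> k x = h x / density c x.
  by move=> cx; rewrite /k /density; case: pselect.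
have mk : measurable_fun setT k.
  apply: measurable_funM => //; apply: measurable_if_set.
    exact: measurable_chart_img.
  apply: measurable_continuous_on_real; first exact: open_chart_img.
  move=> x cx; apply: continuousV; last exact: C1_continuous (C1_sqrt_det c) cx.
  by rewrite gt_eqF // sqrtr_gt0 det_gmx_gt0.
pose Ft (p : borelType M) : R := if pselect (dom c p) then k (coordT c p) else 0.
have mFt : measurable_fun setT Ft.
  apply: measurable_if_set; first exact: measurable_dom.
  by apply: measurable_funTS; exact: measurableT_comp mk (measurable_coordT c).
have FtD p : ~ dom c p -> Ft p = 0 by rewrite /Ft; case: pselect.
have FE : {ae vol, forall p, F p = Ft p}.
  apply: ae_mono (ae_chart_inv c Fh) => p Fp; rewrite /Ft.
  case: pselect => /= cp; last exact: FD.
  have cx := chart_img_coord cp; have := Fp cp.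
  rewrite cinvTE // coordK // coordTE // kE // => <-.
  by rewrite mulrC mulKf // gt_eqF // density_gt0.
(* For a positively homogeneous [psi] the density cancels: density times [psi (h / density)] is
   [psi h]. The absolute value gives integrability; the positive and negative parts give the value
   of the integral. *)
have intE (psi : R -> R) : measurable_fun setT psi -> (forall t, 0 <= psi t) ->
    psi 0 = 0 -> (forall a t, 0 < a -> a * psi (t / a) = psi t) ->
    (\int[vol]_p (psi (Ft p))%:E = \int[lam]_x (psi (h x))%:E)%E.
  move=> mpsi psi0 psi00 psiZ; rewrite (@integral_dom c); last 3 first.
  - exact/measurable_EFinP/measurableT_comp.
  - by move=> p; rewrite lee_fin.
  - by move=> p /FtD ->; rewrite psi00.
  apply: ae_eq_integral_nonmeasurable; apply: ae_mono Fh => x Fx; rewrite -Fx.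
  rewrite -EFinM; congr EFin.
  have [cx|cx] := pselect (chart_img c x); last first.
    by rewrite /density; case: pselect => //= ?; rewrite !mul0r psi00.
  have FtE : Ft (cinvT c x) = F (cinvT c x).
    rewrite cinvTE // /Ft; case: pselect => /= [Dx|]; last by case; exact: dom_cinv.
    rewrite coordTE // cinvK // kE // -Fx cinvTE //.
    by rewrite mulrC mulKf // gt_eqF // density_gt0.
  rewrite FtE -(psiZ _ (density c x * F (cinvT c x)) (density_gt0 cx)).
  by rewrite [density c x * F _]mulrC mulfK // gt_eqF // density_gt0.
have Iabs : (\int[vol]_p (`|Ft p|)%:E = \int[lam]_x (`|h x|)%:E)%E.
  apply: (intE Num.norm) => //.
    by rewrite normr0.
  move=> a t a0; rewrite normrM normfV (gtr0_norm a0) mulrCA mulfV ?mulr1 //.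
  by rewrite gt_eqF.
have Ipos : (\int[vol]_p (Num.max (Ft p) 0)%:E = \int[lam]_x (Num.max (h x) 0)%:E)%E.
  apply: (intE (fun t => Num.max t 0)) => //.
  - exact: measurable_maxr.
  - by move=> t; rewrite le_max lexx orbT.
  - by rewrite maxxx.
  - move=> a t a0; rewrite maxr_pMr ?ltW // mulr0 mulrCA mulfV ?mulr1 //.
    by rewrite gt_eqF.
have Ineg : (\int[vol]_p (Num.max (- Ft p) 0)%:E = \int[lam]_x (Num.max (- h x) 0)%:E)%E.
  apply: (intE (fun t => Num.max (- t) 0)) => //.
  - exact: measurable_maxr.
  - by move=> t; rewrite le_max lexx orbT.
  - by rewrite oppr0 maxxx.
  - move=> a t a0; rewrite maxr_pMr ?ltW // mulr0 mulrN mulrCA mulfV ?mulr1 //.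
    by rewrite gt_eqF.
exists Ft; split => //.
  apply/integrableP; split; first exact/measurable_EFinP.
  by have /integrableP[_] := ih; rewrite /= -Iabs.
rewrite -hs integralE [RHS]integralE; congr (_ - _)%E.
  under eq_integral do rewrite funeposE -EFin_max; rewrite Ipos.
  by apply: eq_integral => x _; rewrite funeposE -EFin_max.
under eq_integral do rewrite funenegE -EFinN -EFin_max; rewrite Ineg.
by apply: eq_integral => x _; rewrite funenegE -EFinN -EFin_max.
Qed.

End volume.

(** * Local finiteness and positivity of the volume *)

Section finiteness.
Variables (R : realType) (n : nat) (M : ptopologicalType).
Variables (A : smooth_atlas R n M) (g : riemannian_metric A).
Variable vol : {measure set (borelType M) -> \bar R}.
Hypothesis volP : is_riemannian_volume g vol.
Implicit Types (c : chart A) (f h : M -> R) (p q : M).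
Local Notation lam := (rV_lebesgue R n).

Lemma compact_seq_cover (K : set M) (U : M -> set M) :
  (forall p, K p -> nbhs p (U p)) -> compact K ->
  exists s : seq M, forall q, K q -> exists2 p, p \in s & U p q.
Proof.
move=> KU; rewrite compact_cover => /(_ M K (fun p => (U p)°)) [].
- by move=> p _; exact: open_interior.
- by move=> p Kp; exists p => //; exact: KU.
move=> s _ Ks; exists (finmap.enum_fset s) => q /Ks [p /= ps Upq].
by exists p => //; exact: interior_subset.
Qed.

Lemma vol_locally_finite p : exists U, [/\ nbhs p U, 
  measurable (U : set (borelType M)) & (vol U < +oo)%E].
Proof.
pose c := chart_at A p; have cp : dom c p by exact: chart_at_dom.
have cx := chart_img_coord cp.
have nB : \forall y \near coord c p,
    chart_img c y /\ `|Num.sqrt (\det (gmx g c y))| <= `|Num.sqrt (\det (gmx g c (coord c p)))| + 1.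
  apply: filterI; first exact: near_chart_img.
  have /cvgrPdist_le /(_ 1 ltr01) := C1_continuous (C1_sqrt_det g c) cx.
  apply: filterS => y yx.
  have := lerB_dist (Num.sqrt (\det (gmx g c y))) (Num.sqrt (\det (gmx g c (coord c p)))).
  by rewrite distrC => /le_trans /(_ yx); rewrite lerBlDl.
move: nB => /nbhs_ballP[e /= e0 eB]; set K := _ + 1 in eB.
have K0 : 0 <= K by rewrite addr_ge0.
pose U : set (borelType M) := dom c `&` (coordT c @^-1` ball (coord c p) e).
have mU : measurable U.
  apply: measurableI; first exact: measurable_dom.
  rewrite -[X in measurable X]setTI.
  exact: (measurable_coordT c measurableT (measurable_rV_ball _ _)).
exists U; split => //.
  apply: filterI; first exact: near_dom.
  have := near_coord cp (nbhsx_ballx (coord c p) e e0).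
  by apply: filterS2 (near_dom cp) => q cq; rewrite /= coordTE.
rewrite (@vol_domE _ _ _ _ _ _ volP c _ mU); last by move=> q [].
have mB := measurable_rV_ball (coord c p) e.
have mI : measurable_fun setT
    (fun x : borel_rV R n => (\1_(ball (coord c p) e) x : R)%:E).
  exact: measurable_EFin_indic.
apply: (@le_lt_trans _ _ (\int[lam]_x (K%:E * (\1_(ball (coord c p) e) x)%:E))%E).
  apply: ae_ge0_le_integral_nonmeasurable.
  - by move=> x; rewrite lee_fin mulr_ge0 // density_ge0.
  - by move=> x; rewrite mule_ge0 // lee_fin.
  - apply: aeW => x; rewrite -EFinM lee_fin !indicE /density.
    case: pselect => /= cx'; last by rewrite mul0r mulr_ge0.
    have [|] := boolP (cinvT c x \in U); last by rewrite mulr0 mulr_ge0.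
    rewrite inE => -[_]; rewrite /= cinvTE // coordTE ?cinvK //; last exact: dom_cinv.
    move=> xB; rewrite mem_set // !mulr1; have [_] := eB _ xB.
    exact: le_trans (ler_norm _).
rewrite ge0_integralZl // (@integral_indic _ _ _ _ _ measurableT _ mB) setIT.
apply: lte_mul_pinfty; rewrite ?lee_fin //.
by rewrite [X in (X < _)%E](rV_lebesgue_ball (coord c p) e0) ltry.
Qed.

Lemma vol_compact_lty (K : set (borelType M)) : compact (K : set M) ->
  exists2 B : set (borelType M), measurable B & (vol B < +oo)%E /\ K `<=` B.
Proof.
move=> cK; have [U UP] := choice vol_locally_finite.
have [s sK] := compact_seq_cover (fun p _ => let: And3 a _ _ := UP p in a) cK.
exists (\big[setU/set0]_(p <- s) U p).
  by apply: bigsetU_measurable => p _; have [] := UP p.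
split; last first.
  by move=> q /sK [p ps Upq]; rewrite -bigcup_seq; exists p.
elim: s {sK} => [|p s IH]; first by rewrite big_nil measure0.
rewrite big_cons; have [_ mU Ufin] := UP p.
have mV : measurable (\big[setU/set0]_(p <- s) U p : set (borelType M)).
  by apply: bigsetU_measurable => q _; have [] := UP q.
apply: le_lt_trans (measureU2 _ mU mV) _; exact: lte_add_pinfty.
Qed.

Lemma continuous_has_integral f : continuous f -> compact (closed_support f) ->
  exists s, has_integral vol f s.
Proof.
move=> cf sf; apply: integrable_has_integral.
have [B mB [Bfin fB]] := vol_compact_lty sf.
have [K K0 KP] := continuous_compact_support_bounded cf sf.
apply: (@integrable_le_indic _ _ _ vol _ B K) => //; first exact: continuous_borel_real.
move=> p; have [->|fp] := eqVneq (f p) 0; first by rewrite normr0 mulr_ge0 // ltW.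
by rewrite indicE mem_set ?mulr1 //; apply: fB; exact: support_closed_support.
Qed.

(** If the volume were null, a coordinate ball would be Lebesgue null. This is what turns an almost
    everywhere equality into a contradiction at a single point. *)
Lemma vol_open_gt0 p (U : set (borelType M)) : nbhs p (U : set M) ->
  measurable U -> vol U != 0%E.
Proof.
move=> pU mU; apply/eqP => U0.
pose c := chart_at A p; have cp : dom c p by exact: chart_at_dom.
have U0' : {ae vol, forall q, ~ U q}.
  by exists U; split => // q /= /contrapT.
have := ae_chart volP c U0'.
have : \forall y \near coord c p, chart_img c y /\ U (cinv c y).
  apply: filterI; first exact/near_chart_img/chart_img_coord.
  exact: near_cinv.
move=> /nbhs_ballP[e /= e0 eB] [N [mN N0 NP]].
have : (lam (ball (coord c p) e) <= lam N)%E.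
  apply: le_measure; rewrite ?inE //; first exact: measurable_rV_ball.
  move=> y /eB [cy Uy]; apply: NP => /= h; exact: h.
by rewrite N0 rV_lebesgue_ball // leNgt lte_fin exprn_gt0 // mulr_gt0.
Qed.

End finiteness.

(** * The Green identity *)

Section divergence.
Variables (R : realType) (n : nat) (M : ptopologicalType).
Variables (A : smooth_atlas R n M) (g : riemannian_metric A).
Implicit Types (c : chart A) (f h : M -> R) (p q : M) (X : 'rV[R]_n -> 'rV[R]_n).

Definition sqrt_det c (x : 'rV[R]_n) : R := Num.sqrt (\det (gmx g c x)).

Lemma differentiable_gmx c x j k : chart_img c x ->
  differentiable (fun y => gmx g c y j k) x.
Proof. by move=> cx; exact: (C1_differentiable (C1_gmx g c j k)). Qed.

Lemma partial_gmxC c x i j k : chart_img c x ->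
  partial i (fun y => gmx g c y j k) x = partial i (fun y => gmx g c y k j) x.
Proof.
move=> cx; apply: near_partial; first exact: differentiable_gmx.
apply: filterS (near_chart_img cx) => y cy.
by rewrite -[in LHS](gmx_sym g cy) mxE.
Qed.

Lemma invmx_gmxC c x j k : chart_img c x ->
  invmx (gmx g c x) j k = invmx (gmx g c x) k j.
Proof. by move=> cx; rewrite -[in LHS](trmx_invmx (posdef_gmx g cx)) mxE. Qed.

Lemma sqrt_det_gt0 c x : chart_img c x -> 0 < sqrt_det c x.
Proof. by move=> cx; rewrite sqrtr_gt0 posdef_det_gt0 //; exact: posdef_gmx. Qed.

(* This is half the logarithmic derivative of [\det g]. *)
Lemma christoffel_trace c x j : chart_img c x ->
  \sum_i christoffel g c x i j i =
  2^-1 * \sum_i \sum_k invmx (gmx g c x) k i * partial j (fun y => gmx g c y i k) x.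
Proof.
move=> cx; rewrite /christoffel -mulr_sumr; congr (_ * _).
(* The terms [a i l] and [a l i] cancel once the two sums are exchanged, leaving only the derivative
   in the direction [j]. *)
pose a i l := invmx (gmx g c x) i l * partial i (fun y => gmx g c y j l) x.
transitivity (\sum_i \sum_l (a i l +
    invmx (gmx g c x) i l * partial j (fun y => gmx g c y i l) x - a l i)).
  apply: eq_bigr => i _; apply: eq_bigr => l _; rewrite mulrBr mulrDr /a.
  by rewrite (invmx_gmxC l i cx) (partial_gmxC l j i cx).
under eq_bigr do rewrite sumrB big_split.
rewrite sumrB big_split /= [X in _ - X]exchange_big /= addrAC subrr add0r.
by apply: eq_bigr => i _; apply: eq_bigr => l _; rewrite (invmx_gmxC i l cx).
Qed.

(** Jacobi's formula, the factor [2^-1] of [christoffel_trace] coming from the derivative of the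
    square root. *)
Lemma partial_sqrt_det c x j : chart_img c x ->
  partial j (sqrt_det c) x = sqrt_det c x * \sum_i christoffel g c x i j i.
Proof.
move=> cx; have dg0 := posdef_det_gt0 (posdef_gmx g cx).
have s0 := sqrt_det_gt0 cx.
have dG j' k : differentiable (fun y => gmx g c y j' k) x by exact: differentiable_gmx.
have dd : differentiable (fun y => \det (gmx g c y)) x.
  apply: (C1_differentiable (O := chart_img c)) => //.
  by apply: C1_det => [|j' k]; [exact: open_chart_img|exact: C1_gmx].
have := partial_comp j dd (is_derive1_sqrt dg0).
rewrite (_ : Num.sqrt \o _ = sqrt_det c) // => ->.
rewrite (partial_det_unit _ dG (unit_gmx g cx)) (christoffel_trace _ cx) !mulrA.
congr (_ * _); rewrite -[X in _ * X]sqr_sqrtr ?ltW // -/(sqrt_det c x).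
by field; rewrite lt0r_neq0.
Qed.

(** The classical formula div X = s^-1 sum_i d_i (s X^i), with s = [sqrt_det c], expanded by the
    product rule. *)
Lemma div_inE c X x : chart_img c x -> div_in g c X x =
  \sum_i (partial i (fun y => X y 0 i) x +
          (sqrt_det c x)^-1 * partial i (sqrt_det c) x * X x 0 i).
Proof.
move=> cx; have s0 : sqrt_det c x != 0 by rewrite lt0r_neq0 ?sqrt_det_gt0.
rewrite /div_in /mxtrace /covariant_derivative.
under eq_bigr do rewrite mxE.
rewrite !big_split /= exchange_big /=; congr (_ + _); apply: eq_bigr => j _.
by rewrite (partial_sqrt_det _ cx) -mulr_suml mulKf.
Qed.

Lemma C1_grad_in c f i : smooth A f -> Ck 1 (chart_img c) (fun x => grad_in g c f x 0 i).
Proof.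
move=> sf; have oI := @open_chart_img _ _ _ _ c.
apply: (@C1_ext _ _ _ oI (fun x => \sum_j partial j (f \o cinv c) x * invmx (gmx g c x) j i)).
  by move=> x _; rewrite /grad_in mxE; apply: eq_bigr => j _; rewrite mxE.
apply: C1_sum => // j; apply: C1_mul => //; last exact: C1_invgmx.
by have [_ /(_ j)] := sf c 2%N.
Qed.

Lemma continuous_div_in c X x : (forall i, Ck 1 (chart_img c) (fun y => X y 0 i)) ->
  chart_img c x -> {for x, continuous (div_in g c X)}.
Proof.
move=> CX cx; have oI := @open_chart_img _ _ _ _ c.
apply: (continuous_on_near oI cx
  (fun y (cy : chart_img c y) => esym (div_inE X cy))).
have Cs := C1_sqrt_det g c.
apply: continuous_at_sum => i; apply: continuousD.
  exact: C1_continuous_partial (CX i) cx.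
apply: continuousM; last exact: C1_continuous (CX i) cx.
apply: continuousM; last exact: C1_continuous_partial Cs cx.
by apply: continuousV; [rewrite lt0r_neq0 ?sqrt_det_gt0|exact: C1_continuous Cs cx].
Qed.

Lemma gam_grad_in c f h x : chart_img c x ->
  gam g c f h x = \sum_i partial i (f \o cinv c) x * grad_in g c h x 0 i.
Proof.
move=> cx; rewrite /gam gformC; last exact: trmx_invmx (posdef_gmx g cx).
rewrite -/(gam g c h f x) gamE; apply: eq_bigr => i _.
by rewrite mulrC /grad_in mxE -mulr_suml; congr (_ * _); apply: eq_bigr => j _; rewrite mxE.
Qed.

Let product_rule (p f E s X ds dX a du : R) : s != 0 ->
  p * (E * (s * X)) + f * (E * (a * du) * (s * X) + E * (ds * X + s * dX)) =
  s * E * (p * X + f * (dX + s^-1 * ds * X + a * (du * X))).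
Proof. by move=> s0; field. Qed.

(** This identifies the Green integrand, multiplied by the Riemannian density, with a plain
    coordinate divergence, to which [integral_partial] applies componentwise. *)
Lemma weighted_divergence c (a : R) (f u : M -> R) X x : chart_img c x ->
  differentiable (f \o cinv c) x -> differentiable (u \o cinv c) x ->
  (forall i, differentiable (fun y => X y 0 i) x) ->
  \sum_i partial i (fun y => f (cinv c y) *
     (expR (a * u (cinv c y)) * (sqrt_det c y * X y 0 i))) x =
  sqrt_det c x * (expR (a * u (cinv c x)) *
    (\sum_i partial i (f \o cinv c) x * X x 0 i +
     f (cinv c x) * (div_in g c X x +
       a * \sum_i partial i (u \o cinv c) x * X x 0 i))).
Proof.
move=> cx df du dX.
have s0 : sqrt_det c x != 0 by rewrite lt0r_neq0 ?sqrt_det_gt0.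
have ds : differentiable (sqrt_det c) x by exact: (C1_differentiable (C1_sqrt_det g c)).
have dau : differentiable (fun y => a * u (cinv c y)) x.
  exact: (differentiable_partialM (differentiable_cst a x) du).
have dE : differentiable (fun y => expR (a * u (cinv c y))) x.
  apply: (@differentiable_comp _ _ _ _ (fun y => a * u (cinv c y)) expR) => //.
  exact/derivable1_diffP.
have pE i : partial i (fun y => expR (a * u (cinv c y))) x =
    expR (a * u (cinv c x)) * (a * partial i (u \o cinv c) x).
  rewrite -(partialZ a i du).
  exact: (partial_comp i dau (is_derive_expR _)).
have dsX i := differentiable_partialM ds (dX i).
have dEsX i := differentiable_partialM dE (dsX i).
transitivity (\sum_i (sqrt_det c x * expR (a * u (cinv c x)) *
  (partial i (f \o cinv c) x * X x 0 i + f (cinv c x) *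
   (partial i (fun y => X y 0 i) x +
          (sqrt_det c x)^-1 * partial i (sqrt_det c) x * X x 0 i +
    a * (partial i (u \o cinv c) x * X x 0 i))))).
  apply: eq_bigr => i _; rewrite (partialM _ df (dEsX i)) (partialM _ dE (dsX i)).
  by rewrite (partialM _ ds (dX i)) pE; exact: product_rule.
rewrite -mulr_sumr big_split /= -mulr_sumr big_split /= -mulr_sumr -(div_inE X cx).
by rewrite mulrA.
Qed.

End divergence.

Section local_green.
Variables (R : realType) (n : nat) (M : ptopologicalType).
Variables (A : smooth_atlas R n M) (g : riemannian_metric A).
Variable vol : {measure set (borelType M) -> \bar R}.
Hypothesis volP : is_riemannian_volume g vol.
Variables (a : R) (u phi : M -> R).
Hypotheses (su : smooth A u) (sphi : smooth A phi).
Implicit Types (c : chart A) (f h psi : M -> R) (p q : M).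
Local Notation lam := (rV_lebesgue R n).

(* With [W = expR (a * u)] this is [div (W grad phi) / W]. *)
Definition chart_laplacian c (x : 'rV[R]_n) : R :=
  div_in g c (grad_in g c phi) x + a * gam g c u phi x.

Lemma continuous_chart_laplacian c x : chart_img c x ->
  {for x, continuous (chart_laplacian c)}.
Proof.
move=> cx; apply: continuousD.
  by apply: continuous_div_in => // i; exact: C1_grad_in.
apply: continuousM; first exact: cst_continuous.
by apply: continuous_gam => //; exact: smooth_is_C1.
Qed.

(** The components of the coordinate field [psi W s grad phi], where W is the exponential weight and
    s the density, are Lipschitz with compact support and differentiable almost everywhere, so their
    partial derivatives integrate to 0. *)
Lemma local_green c psi : (forall p, lipschitz_at g psi p) ->
  {ae vol, forall p, differentiable_at A psi p} ->
  compact (closed_support psi) -> closed_support psi `<=` dom c ->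
  has_integral vol (fun p => expR (a * u p) *
    (Gam g psi phi p + psi p * chart_laplacian c (coord c p))) 0.
Proof.
move=> lpsi dpsi cpsi psic.
have psi0 p : ~ closed_support psi p -> psi p = 0.
  by move=> pp; apply: contrapT => /eqP /support_closed_support.
pose X := grad_in g c phi.
pose F0 i y := psi (cinv c y) * (expR (a * u (cinv c y)) * (sqrt_det g c y * X y 0 i)).
(* Nothing is known of [F0] outside the chart image. The extension by zero is still locally
   Lipschitz, since it vanishes near every point off the compact set [K]. *)
pose F i y := if pselect (chart_img c y) then F0 i y else 0.
pose K := coord c @` closed_support psi.
have cK : compact K.
  apply: continuous_compact => //; apply: continuous_in_subspaceT => p.
  by rewrite inE => /psic; exact: Defs.coord_continuous.
have KI x : K x -> chart_img c x by move=> [p /psic cp <-]; exact: chart_img_coord.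
have F0K i x : ~ K x -> F i x = 0.
  move=> Kx; rewrite /F; case: pselect => // cx; rewrite /F0 psi0 ?mul0r //.
  by move=> px; apply: Kx; exists (cinv c x) => //; rewrite cinvK.
have nFK i x : ~ K x -> \forall y \near x, F i y = 0.
  move=> Kx; have : nbhs x (~` K).
    apply: open_nbhs_nbhs; split => //; apply: closed_openC.
    by apply: compact_closed cK; exact: norm_hausdorff.
  by apply: filterS => y; exact: F0K.
have nFF i x : chart_img c x -> \forall y \near x, F0 i y = F i y.
  move=> cx; apply: filterS (near_chart_img cx) => y cy.
  by rewrite /F; case: pselect.
have CX i : Ck 1 (chart_img c) (fun y => X y 0 i) by exact: C1_grad_in.
have Cu := smooth_is_C1 su c.
have oI := @open_chart_img _ _ _ _ c.
have CE : Ck 1 (chart_img c) (fun y => expR (a * u (cinv c y))).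
  apply: (C1_comp oI (f := fun y => a * u (cinv c y)) (h := @expR R) (dh := @expR R)).
  - exact: (C1_mul oI (C1_cst oI a) Cu).
  - by move=> y _; exact: continuous_expR.
have CW i : Ck 1 (chart_img c)
    (fun y => expR (a * u (cinv c y)) * (sqrt_det g c y * X y 0 i)).
  exact: (C1_mul oI CE (C1_mul oI (C1_sqrt_det g c) (CX i))).
have dF0 i x : chart_img c x -> differentiable (psi \o cinv c) x ->
    differentiable (F0 i) x.
  by move=> cx dpx; apply: differentiable_partialM dpx _; exact: (C1_differentiable (CW i)).
have lF i x : lipschitz_near (F i) x.
  have [Kx|Kx] := pselect (K x); last first.
    apply: near_lipschitz_near (lipschitz_near_cst 0 x).
    by apply: filterS (nFK i x Kx) => y.
  apply: (near_lipschitz_near (nFF i x (KI x Kx))).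
  have cx := KI x Kx; have cp := dom_cinv cx.
  apply: lipschitz_near_mul.
    by have := lipschitz_at_chart cp (lpsi (cinv c x)); rewrite cinvK.
  exact: (C1_lipschitz_near oI (CW i)).
have dF : {ae lam, forall x i, differentiable (F i) x}.
  apply: ae_mono (ae_chart volP c dpsi) => x dx i.
  have [Kx|Kx] := pselect (K x); last first.
    by apply: near_differentiable (differentiable_cst 0 x); apply: filterS (nFK i x Kx) => y.
  have cx := KI x Kx.
  apply: near_differentiable (nFF i x cx) _.
  apply: dF0 => //.
  by have /(differentiable_atP _ (dom_cinv cx)) := dx cx; rewrite cinvK.
have hF i : has_integral lam (partial i (F i)) 0.
  apply: (integral_partial _ cK (F0K i) (lF i)).
  by apply: ae_mono dF => x.
have := has_integral_sum (index_enum 'I_n) hF; rewrite big1 // => hS.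
apply: (has_integral_chart volP (c := c)).
  move=> p cp; have pp : ~ closed_support psi p by move/psic.
  by rewrite (Gam_support g phi pp) (psi0 _ pp) mul0r addr0 mulr0.
apply: eq_has_integral hS.
apply: ae_mono (ae_chart volP c dpsi) => x dx.
have [Kx|Kx] := pselect (K x); last first.
  rewrite big1; last first.
    move=> i _; rewrite -(partial_cst 0 i x); apply: near_partial.
      by apply: near_differentiable (differentiable_cst 0 x); apply: filterS (nFK i x Kx) => y.
    exact: nFK.
  rewrite /density; case: pselect => cx; last by rewrite mul0r.
  have pp : ~ closed_support psi (cinv c x).
    by move=> px; apply: Kx; exists (cinv c x) => //; rewrite cinvK.
  by rewrite cinvTE // (Gam_support g phi pp) (psi0 _ pp) mul0r addr0 !mulr0.
have cx := KI x Kx.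
have dpx : differentiable (psi \o cinv c) x.
  by have /(differentiable_atP _ (dom_cinv cx)) := dx cx; rewrite cinvK.
rewrite cinvTE // cinvK //.
have -> : density g c x = sqrt_det g c x by rewrite /density; case: pselect.
rewrite (GamE g (dom_cinv cx) (dx cx)); last exact/is_C1_differentiable/smooth_is_C1.
rewrite cinvK // /chart_laplacian !(gam_grad_in g _ _ cx).
rewrite -(weighted_divergence g a cx dpx (C1_differentiable Cu cx)
  (fun i => C1_differentiable (CX i) cx)).
apply: eq_bigr => i _; apply: near_partial.
  by apply: near_differentiable (nFF i x cx) _; exact: dF0.
by apply: filterS (nFF i x cx) => y.
Qed.

End local_green.

(** * Calculus of gradients at points of differentiability *)

Section gradient_rules.
Variables (R : realType) (n : nat) (M : topologicalType).
Variables (A : smooth_atlas R n M) (g : riemannian_metric A).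
Implicit Types (c : chart A) (f h : M -> R) (p q : M).

Lemma near_differentiable_at f h p : (\forall q \near p, f q = h q) ->
  differentiable_at A f p -> differentiable_at A h p.
Proof.
move=> fh; apply: near_differentiable.
exact: (near_cinv (chart_at_dom A p) fh).
Qed.

Lemma gradE f p : grad g f p =
  dchart (chart_at A p) f (coord (chart_at A p) p) *m
  invmx (gmx g (chart_at A p) (coord (chart_at A p) p)).
Proof. by []. Qed.

Lemma differentiable_at_cst a p : differentiable_at A (fun=> a) p.
Proof. exact: differentiable_cst. Qed.

Lemma differentiable_at_mul f h p : differentiable_at A f p ->
  differentiable_at A h p -> differentiable_at A (fun q => f q * h q) p.
Proof. by move=> df dh; exact: differentiable_partialM. Qed.

Lemma differentiable_at_comp f (F : R -> R) dF p : differentiable_at A f p ->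
  is_derive (f p) 1 F dF -> differentiable_at A (F \o f) p.
Proof.
move=> df [dFp _]; have cp := chart_at_dom A p.
apply: (@differentiable_comp _ _ _ _ (f \o cinv _) F) => //=.
by rewrite coordK //; exact/derivable1_diffP.
Qed.

Lemma dchartM c f h x : differentiable (f \o cinv c) x ->
  differentiable (h \o cinv c) x -> dchart c (fun q => f q * h q) x =
  h (cinv c x) *: dchart c f x + f (cinv c x) *: dchart c h x.
Proof.
move=> df dh; apply/rowP => i; rewrite [LHS]mxE (partialM i df dh).
by rewrite [RHS]mxE [X in _ = X + _]mxE [X in _ = _ + X]mxE ![dchart _ _ _ _ _]mxE mulrC.
Qed.

Lemma gradM f h p : differentiable_at A f p -> differentiable_at A h p ->
  grad g (fun q => f q * h q) p = h p *: grad g f p + f p *: grad g h p.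
Proof.
move=> df dh; rewrite !gradE (dchartM df dh) mulmxDl !scalemxAl coordK //.
exact: chart_at_dom.
Qed.

Lemma grad_comp f (F : R -> R) dF p : differentiable_at A f p ->
  is_derive (f p) 1 F dF -> grad g (F \o f) p = dF *: grad g f p.
Proof.
move=> df dFp; rewrite !gradE scalemxAl; apply: (congr1 (mulmxr _)).
apply/rowP => i; rewrite [LHS]mxE [RHS]mxE [dchart _ _ _ _ _]mxE.
apply: (partial_comp i df); rewrite /= coordK //; exact: chart_at_dom.
Qed.

(* Since the pointwise gradient is 0 where [f] is not differentiable, the eikonal
   equation forces differentiability almost everywhere. *)
Lemma grad_neq0_differentiable f p : grad g f p != 0 -> differentiable_at A f p.
Proof.
move=> f0; apply: contrapT => df; move/eqP: f0; apply.
rewrite gradE (_ : dchart _ _ _ = 0) ?mul0mx //.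
by apply/rowP => i; rewrite [LHS]mxE [RHS]mxE; exact: not_differentiable_diff.
Qed.

Lemma GamE_gform f h p : Gam g f h p =
  gform (gmx g (chart_at A p) (coord (chart_at A p) p)) (grad g f p) (grad g h p).
Proof. by []. Qed.

Lemma GamC f h p : Gam g f h p = Gam g h f p.
Proof.
apply: gformC; apply: (gmx_sym g); apply: chart_img_coord; exact: chart_at_dom.
Qed.

Lemma GamM f f' h p : differentiable_at A f p -> differentiable_at A f' p ->
  Gam g (fun q => f q * f' q) h p = f' p * Gam g f h p + f p * Gam g f' h p.
Proof. by move=> df df'; rewrite /Gam (gradM df df'); apply: etrans (gformDl _ _ _ _) _;
  congr (_ + _); exact: gformZl. Qed.

Lemma Gam_comp f (F : R -> R) dF h p : differentiable_at A f p ->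
  is_derive (f p) 1 F dF -> Gam g (F \o f) h p = dF * Gam g f h p.
Proof. by move=> df dFp; rewrite /Gam (grad_comp df dFp); exact: gformZl. Qed.

End gradient_rules.

(** * Chart independence of the Laplacian and the global Green identity *)

Section global_green.
Variables (R : realType) (n : nat) (M : ptopologicalType).
Variables (A : smooth_atlas R n M) (g : riemannian_metric A).
Variable vol : {measure set (borelType M) -> \bar R}.
Hypothesis volP : is_riemannian_volume g vol.
Variables (a : R) (u phi : M -> R).
Hypotheses (su : smooth A u) (sphi : smooth A phi).
Implicit Types (c : chart A) (f h psi : M -> R) (p q : M).
Local Notation chlap := (chart_laplacian g a u phi).

Lemma is_C1_lipschitz_at f p : is_C1 A f -> compact (closed_support f) ->
  lipschitz_at g f p.
Proof.
move=> Cf cf; have [K _ KP] := is_C1_lipschitz g Cf cf.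
by exists setT; [exact: filterT|exists K => q r _ _; exact: KP].
Qed.

Lemma continuous_chlap_coord c p : dom c p ->
  {for p, continuous (fun q => chlap c (coord c q))}.
Proof.
move=> cp; apply: continuous_comp; first exact: Defs.coord_continuous.
by apply: continuous_chart_laplacian => //; exact: chart_img_coord.
Qed.

(* Both charts compute the same weak divergence, tested here against a bump
   function supported where the two expressions would differ. *)
Lemma chart_laplacian_le c c' p : dom c p -> dom c' p ->
  chlap c (coord c p) <= chlap c' (coord c' p).
Proof.
move=> cp cp'; rewrite leNgt; apply/negP => lt_p.
pose D q := chlap c (coord c q) - chlap c' (coord c' q).
have cD : {for p, continuous D}.
  by apply: continuousB; exact: continuous_chlap_coord.
have nD : \forall q \near p, 0 < D q.
  have : 0 < D p by rewrite subr_gt0.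
  by move=> Dp; apply: cvgr_gt Dp.
have nU : nbhs p ([set q | 0 < D q] `&` (dom c `&` dom c')).
  apply: filterI => //; apply: filterI; exact: near_dom.
have [eta [Ceta eta01 eta1 seta etaU]] := bump_exists A nU.
have dge q : differentiable_at A eta q by exact: is_C1_differentiable.
have leta q : lipschitz_at g eta q by exact: is_C1_lipschitz_at.
have dae : {ae vol, forall q, differentiable_at A eta q} by exact: aeW.
have gc : closed_support eta `<=` dom c by move=> q /etaU [[_ []]].
have gc' : closed_support eta `<=` dom c' by move=> q /etaU [[_ []]].
have G1 := local_green volP a su sphi leta dae seta gc.
have G2 := local_green volP a su sphi leta dae seta gc'.
have aux (E T e L L' : R) :
    E * (T + e * L) + -1 * (E * (T + e * L')) = E * (e * (L - L')) by ring.
have := has_integralD G1 (has_integralZ (-1) G2); rewrite mulr0 addr0 => G.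
have {}G : has_integral vol (fun q => expR (a * u q) * (eta q * D q)) 0.
  by apply: eq_has_integral G; apply: aeW => q; exact: aux.
have etaD0 q : 0 <= eta q * D q.
  have [->|eq0] := eqVneq (eta q) 0; first by rewrite mul0r.
  have [[/= Dq _] _] := etaU _ (support_closed_support eq0).
  by apply: mulr_ge0; [case/andP: (eta01 q)|exact: ltW].
(* A nonnegative integrand of zero integral vanishes almost everywhere, but this one is positive
   near [p]. *)
have := has_integral_eq0 _ G => /(_ (fun q => mulr_ge0 (expR_ge0 _) (etaD0 q))).
move=> [N [mN N0 NP]].
have pN : nbhs p (N : set M).
  apply: filterS2 eta1 nD => q eta1 Dq; apply: NP => /=.
  by rewrite eta1 mul1r => /eqP; rewrite mulf_eq0 !gt_eqF ?expR_gt0.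
by have /eqP := vol_open_gt0 volP pN mN.
Qed.

(** For [a = 2 * mu + n%:R * lambda] this is the affine Laplacian of [phi] divided by V^(mu -
    lambda). *)
Definition weighted_laplacian p := laplacian g phi p + a * Gam g u phi p.

Lemma weighted_laplacianE c p : dom c p ->
  weighted_laplacian p = chlap c (coord c p).
Proof.
move=> cp; have cp' := chart_at_dom A p.
transitivity (chlap (chart_at A p) (coord (chart_at A p) p)).
  rewrite /weighted_laplacian /chart_laplacian (GamE g cp') //;
  exact/is_C1_differentiable/smooth_is_C1.
by apply/le_anti/andP; split; exact: chart_laplacian_le.
Qed.

Lemma continuous_weighted_laplacian : continuous weighted_laplacian.
Proof.
move=> p; have cp := chart_at_dom A p.
rewrite /continuous_at (weighted_laplacianE cp).
apply: cvg_trans (continuous_chlap_coord cp); apply: near_eq_cvg.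
by apply: filterS (near_dom cp) => q cq; rewrite (weighted_laplacianE cq).
Qed.

(* Bumps [eta] equal to 1 near the points of a finite cover replace a partition of
   unity: [psi * eta] is supported in a chart and [psi * (1 - eta)] vanishes on one
   more member of the cover. *)
Lemma green_identity psi : (forall p, lipschitz_at g psi p) ->
  {ae vol, forall p, differentiable_at A psi p} -> compact (closed_support psi) ->
  has_integral vol (fun p => expR (a * u p) *
    (Gam g psi phi p + psi p * weighted_laplacian p)) 0.
Proof.
move=> lpsi dpsi cpsi.
have bump p : exists e : M -> R, [/\ is_C1 A e, \forall q \near p, e q = 1,
    compact (closed_support e) & closed_support e `<=` dom (chart_at A p)].
  have [e [Ce _ e1 se eU]] := bump_exists A (filterT : nbhs p setT).
  by exists e; split => // q /eU [].
have [eta etaP] := choice bump.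
have [s sP] := compact_seq_cover (U := fun p q => eta p q = 1)
  (fun p _ => let: And4 _ b _ _ := etaP p in b) cpsi.
have {sP} : forall q, psi q != 0 -> exists2 p, p \in s & eta p q = 1.
  by move=> q /support_closed_support; exact: sP.
elim: s psi lpsi dpsi cpsi => [|p s IH] psi lpsi dpsi cpsi sP.
  apply: eq_has_integral (has_integral0 _); apply: aeW => q.
  have psi0 : psi = fun=> 0.
    by apply/funext => r; apply/eqP; apply: contrapT => /negP /sP[].
  rewrite Gam_support ?psi0 ?mul0r ?addr0 ?mulr0 //.
  suff: closed_support (fun=> 0 : R) `<=` (set0 : set M) by apply.
  by apply: closed_support_sub => //; exact: closed0.
have [Ce _ se ec] := etaP p; set e := eta p in Ce se ec sP.
have le q : lipschitz_at g e q by exact: is_C1_lipschitz_at.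
have de q : differentiable_at A e q by exact: is_C1_differentiable.
pose e' q := 1 - e q.
have e'_der t : is_derive t (1 : R) (fun x : R => 1 - x) (-1).
  have := is_deriveB (is_derive_cst (1 : R) t 1) (is_derive_id t (1 : R)).
  by rewrite sub0r.
have le' q : lipschitz_at g e' q.
  apply: (lipschitz_at_comp (F := fun x : R => 1 - x) (le q)).
  exists 1, setT; first exact: filterT.
  by move=> y z _ _; rewrite mul1r [X in _ <= X]distrC (_ : 1 - y - (1 - z) = z - y) //; ring.
have de' q : differentiable_at A e' q by exact: (differentiable_at_comp (de q)).
have supp f : closed_support (fun q => psi q * f q) `<=` closed_support psi.
  apply: closed_support_sub; first exact: closed_closure.
  move=> q pq; have [->|/support_closed_support //] := eqVneq (psi q) 0.
  by rewrite mul0r.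
have supp' : closed_support (fun q => psi q * e q) `<=` closed_support e.
  apply: closed_support_sub; first exact: closed_closure.
  move=> q pq; have [->|/support_closed_support //] := eqVneq (e q) 0.
  by rewrite mulr0.
have sub f : compact (closed_support (fun q => psi q * f q)).
  by apply: subclosed_compact cpsi (supp f); exact: closed_closure.
have G1 : has_integral vol (fun q => expR (a * u q) *
    (Gam g (fun q => psi q * e q) phi q + psi q * e q * weighted_laplacian q)) 0.
  have := local_green volP a su sphi (c := chart_at A p) (psi := fun q => psi q * e q).
  move=> /(_ (fun q => lipschitz_at_mul (lpsi q) (le q))).
  have dpe : {ae vol, forall q, differentiable_at A (fun q => psi q * e q) q}.
    by apply: ae_mono dpsi => q dq; exact: differentiable_at_mul.
  move=> /(_ dpe (sub e) (subset_trans supp' ec)).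
  apply: eq_has_integral; apply: aeW => q.
  have [eq0|eq0] := eqVneq (e q) 0; first by rewrite eq0 mulr0 !mul0r.
  by rewrite (weighted_laplacianE (ec _ (support_closed_support eq0))).
have G2 := IH (fun q => psi q * e' q) (fun q => lipschitz_at_mul (lpsi q) (le' q)).
have dpe' : {ae vol, forall q, differentiable_at A (fun q => psi q * e' q) q}.
  by apply: ae_mono dpsi => q dq; exact: differentiable_at_mul.
have {}G2 := G2 dpe' (sub e').
have {G2} : has_integral vol (fun q => expR (a * u q) *
    (Gam g (fun q => psi q * e' q) phi q + psi q * e' q * weighted_laplacian q)) 0.
  apply: G2 => q; rewrite mulf_eq0 negb_or => /andP[/sP[r]].
  rewrite inE => /predU1P[->|rs] er; last by exists r.
  by rewrite /e' /e er subrr eqxx.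
move=> /(has_integralD G1); rewrite addr0; apply: eq_has_integral.
apply: ae_mono dpsi => q dq; rewrite (GamM g phi dq (de q)) (GamM g phi dq (de' q)).
have -> : Gam g e' phi q = -1 * Gam g e phi q by exact: (Gam_comp g phi (de q)).
move: (Gam _ psi _ _) (Gam _ e _ _) (weighted_laplacian q) => T T' L.
by rewrite /e'; ring.
Qed.

End global_green.

(** * The weighted inequalities *)

Section quadratic_estimates.
Variables (R : realType) (alpha C G P Q H B : R).
(* [G], [P], [Q], [H], [B] stand for the integrals of [m r Gam phi phi],
   [m rho a^2 phi Gam rho phi], [m r phi L], [m phi^2] and [m r^2 L^2], where
   [m = rho^(alpha - 4) V^(tau + lambda - mu)], [a = V^(mu - lambda)],
   [r = a^2 rho^2] and [a L] is the affine Laplacian of [phi]. *)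
Hypotheses (GPQ : G + (alpha - 2) * P + Q = 0)
  (BQH : forall t, 0 <= B + 2 * t * Q + t ^+ 2 * H)
  (GPH : forall s, 0 <= s ^+ 2 * G + 2 * s * P + H).

Lemma quadratic_le : 2 < alpha < 3 - C -> - ((alpha - 3) * H + 2 * P) <= C * H ->
  2 * (alpha - 2) * (3 - alpha - C) * G <= B.
Proof.
move=> /andP[a2 aC] PH; set K := (alpha - 2) * (3 - alpha - C).
have K0 : 0 < K by apply: mulr_gt0; lra.
have PH' : 0 <= (alpha - 2) * (2 * P - (3 - alpha - C) * H).
  by apply: mulr_ge0; lra.
have QG : 0 <= - 2 * Q - 2 * G - K * H.
  have -> : - 2 * Q = 2 * G + 2 * ((alpha - 2) * P).
    by have -> : Q = - (G + (alpha - 2) * P); [move: GPQ; lra|ring].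
  by apply: le_trans PH' _; rewrite /K; lra.
(* With [t = K] the terms in [Q] and [H] cancel in the sum of the two inequalities, leaving
   [B - 2 * K * G]. *)
have := mulr_ge0 (ltW K0) QG; have := BQH K; rewrite /K; lra.
Qed.

Lemma quadratic_ge : (7 - C) / 3 < alpha < 2 -> C * H <= - ((alpha - 3) * H + 2 * P) ->
  (C - alpha + 1) ^+ 2 / 4 * G <= B.
Proof.
move=> /andP[aC a2] PH.
pose b := 2 - alpha; pose h := C + alpha - 3.
have b0 : 0 < b by rewrite /b; lra.
(* This is the lower bound on [alpha]. For the final [t = h * k / 4] the coefficient of [H] in the
   lower bound for [B] is [- t * h * (h - 2 * b) / 4]; it is negative, so an upper bound on [H] is
   what closes the estimate. *)
have hb : 2 * b < h by move: aC; rewrite ltr_pdivrMr // /b /h => ?; lra.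
have h0 : 0 < h by lra.
have hP : 0 <= - 2 * P - h * H by move: PH; rewrite /h; lra.
(* For [s >= 0], [GPH] and [hP] give [(s * h - 1) * H <= s ^+ 2 * G]; the best choice is
   [s = 2 / h]. *)
have HG : h ^+ 2 * H <= 4 * G.
  have s0 : 0 <= h * 2 by lra.
  have := mulr_ge0 s0 hP; have := mulr_ge0 (sqr_ge0 h) (GPH (2 / h)).
  have -> : h ^+ 2 * ((2 / h) ^+ 2 * G + 2 * (2 / h) * P + H) =
    4 * G + 4 * (h * P) + h ^+ 2 * H by field; lra.
  lra.
have QG : - Q = G - b * P by move: GPQ; rewrite /b; lra.
pose k := h + 2 * b; have k0 : 0 < k by rewrite /k; lra.
have -> : C - alpha + 1 = k by rewrite /k /b /h; ring.
have bP := mulr_ge0 (ltW b0) hP.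
have t0 : 0 <= h * k / 2 by apply: divr_ge0 => //; apply: mulr_ge0; lra.
have tQ := mulr_ge0 t0 bP.
have hb0 : 0 <= k * (h - 2 * b) / 16 by apply: divr_ge0 => //; apply: mulr_ge0; lra.
have HG' := mulr_ge0 hb0 (_ : 0 <= 4 * G - h ^+ 2 * H); rewrite subr_ge0 in HG'.
have {}HG' := HG' HG.
(* When the coefficient of [H] is negative, [hP] and Hardy bound [B] below by [2 * t + 4 * (t * b *
   h - t ^+ 2) / h ^+ 2] times [G]. This factor is largest at [t = h * k / 4], where it equals
   [k ^+ 2 / 4]. *)
have := BQH (h * k / 4).
have -> : Q = b * P - G by rewrite -[Q]opprK QG; ring.
move: tQ HG'; rewrite /k; lra.
Qed.

End quadratic_estimates.

Lemma weighted_laplacian_support (R : realType) n (M : ptopologicalType)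
    (A : smooth_atlas R n M) (g : riemannian_metric A) a (u f : M -> R) p :
  ~ closed_support f p -> weighted_laplacian g a u f p = 0.
Proof.
move=> fp; have cp := chart_at_dom A p; have cx := chart_img_coord cp.
have nf : \forall q \near p, ~ closed_support f q.
  by apply: open_nbhs_nbhs; split => //; apply: closed_openC; exact: closed_closure.
have nX : \forall x \near coord (chart_at A p) p, grad_in g (chart_at A p) f x = 0.
  have /near_chart_img cx' := cx.
  apply: filterS2 (cx') (near_cinv cp nf) => x cxx fx.
  rewrite /grad_in (_ : \row_j _ = 0) ?mul0mx //; apply/rowP => j.
  rewrite [LHS]mxE [RHS]mxE -(partial_cst 0 j x).
  have nf0 : \forall y \near x, 0 = (f \o cinv (chart_at A p)) y :> R.
    have : \forall q \near cinv (chart_at A p) x, f q = 0.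
      have : \forall q \near cinv (chart_at A p) x, ~ closed_support f q.
        apply: open_nbhs_nbhs; split => //; apply: closed_openC; exact: closed_closure.
      by apply: filterS => q fq; apply/eqP; apply: contrapT => /negP /support_closed_support.
    move=> /(near_cinv (dom_cinv cxx)); rewrite cinvK //.
    by apply: filterS => y /= ->.
  by apply/esym/near_partial => //; exact: differentiable_cst.
rewrite /weighted_laplacian GamC (Gam_support g u fp) mulr0 addr0.
rewrite /laplacian (div_inE g _ cx) big1 // => i _.
rewrite (nbhs_singleton nX) mxE mulr0 addr0 -(partial_cst 0 i (coord (chart_at A p) p)).
apply/esym/near_partial; first exact: differentiable_cst.
by apply: filterS nX => x ->; rewrite mxE.
Qed.

(** * Powers of [rho] as weights on a compact set where [rho] is positive *)

Section weights.
Variables (R : realType) (n : nat) (M : ptopologicalType).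
Variables (A : smooth_atlas R n M) (g : riemannian_metric A).
Variable vol : {measure set (borelType M) -> \bar R}.
Hypothesis volP : is_riemannian_volume g vol.
Variables (rho : M -> R) (S : set M).
Hypotheses (rho0 : forall p, 0 <= rho p) (lrho : locally_lipschitz g rho).
Hypotheses (cS : closed S) (kS : compact S) (Srho : S `<=` [set p | rho p != 0]).
Implicit Types (f h k : M -> R) (p q : M) (s : R).

Lemma S_rho_gt0 p : S p -> 0 < rho p.
Proof. by move=> /Srho /= r0; rewrite lt_neqAle eq_sym r0 rho0. Qed.

Lemma off_S_near f p : (forall q, ~ S q -> f q = 0) -> ~ S p ->
  \forall q \near p, 0 = f q.
Proof.
move=> f0 Sp; have : \forall q \near p, ~ S q.
  by apply: open_nbhs_nbhs; split => //; exact: closed_openC.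
by apply: filterS => q /f0.
Qed.

Lemma support_S f : (forall q, ~ S q -> f q = 0) -> closed_support f `<=` S.
Proof. exact: closed_support_sub. Qed.

Lemma compact_support_S f : (forall q, ~ S q -> f q = 0) -> compact (closed_support f).
Proof.
by move=> f0; apply: subclosed_compact kS (support_S f0); exact: closed_closure.
Qed.

Lemma off_S_weight s h : (forall q, ~ S q -> h q = 0) ->
  forall q, ~ S q -> rho q `^ s * h q = 0.
Proof. by move=> h0 q /h0 ->; rewrite mulr0. Qed.

(** On [S] the function [rho] is positive and the power is differentiable with continuous derivative
    at its values. Off [S] the product vanishes on a neighbourhood because [S] is closed. *)
Lemma lipschitz_at_weight s h : is_C1 A h -> (forall q, ~ S q -> h q = 0) ->
  forall p, lipschitz_at g (fun q => rho q `^ s * h q) p.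
Proof.
move=> Ch h0 p; have [Sp|Sp] := pselect (S p); last first.
  exact: (near_lipschitz_at (off_S_near (off_S_weight s h0) Sp) (lipschitz_at_cst _ _ _)).
apply: lipschitz_at_mul; last exact: is_C1_lipschitz_at (compact_support_S h0).
apply: (lipschitz_at_comp (F := fun x : R => x `^ s)); first exact: lrho.
have r0 := S_rho_gt0 Sp.
have n0 : \forall x \near rho p, 0 < x by apply: open_nbhs_nbhs; split=> //; exact: open_gt.
apply: (@derive_lipschitz_near _ _ (fun x => s * x `^ (s - 1))).
  by apply: filterS n0 => x x0; exact: is_derive1_powR.
apply: continuousM; first exact: cst_continuous.
have [+ _] := is_derive1_powR (s - 1) r0.
by move=> /derivable1_diffP /differentiable_continuous.
Qed.

Lemma continuous_weight s h : continuous h -> (forall q, ~ S q -> h q = 0) ->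
  continuous (fun q => rho q `^ s * h q).
Proof.
move=> ch h0 p; have [Sp|Sp] := pselect (S p); last first.
  apply: (lipschitz_at_continuous (g := g)).
  exact: (near_lipschitz_at (off_S_near (off_S_weight s h0) Sp) (lipschitz_at_cst _ _ _)).
apply: (@continuousM R M (fun q => rho q `^ s) h p); last exact: ch.
apply: (@continuous_comp _ _ _ rho (fun x : R => x `^ s) p).
  exact: lipschitz_at_continuous (lrho p).
have [+ _] := is_derive1_powR s (S_rho_gt0 Sp).
by move=> /derivable1_diffP /differentiable_continuous.
Qed.

Lemma weight_has_integral s h : continuous h -> (forall q, ~ S q -> h q = 0) ->
  exists I, has_integral vol (fun q => rho q `^ s * h q) I.
Proof.
move=> ch h0; apply: continuous_has_integral => //; first exact: volP.
  exact: continuous_weight.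
exact/compact_support_S/off_S_weight.
Qed.

Lemma differentiable_weight s h p : is_C1 A h -> (forall q, ~ S q -> h q = 0) ->
  differentiable_at A rho p -> differentiable_at A (fun q => rho q `^ s * h q) p.
Proof.
move=> Ch h0 dr; have [Sp|Sp] := pselect (S p); last first.
  exact: (near_differentiable_at (off_S_near (off_S_weight s h0) Sp) (differentiable_at_cst _ _ _)).
apply: differentiable_at_mul; last exact: is_C1_differentiable.
exact: differentiable_at_comp dr (is_derive1_powR s (S_rho_gt0 Sp)).
Qed.

Lemma Gam_weight s h k p : is_C1 A h -> S p -> differentiable_at A rho p ->
  Gam g (fun q => rho q `^ s * h q) k p =
  h p * (s * rho p `^ (s - 1) * Gam g rho k p) + rho p `^ s * Gam g h k p.
Proof.
move=> Ch Sp dr; have D := is_derive1_powR s (S_rho_gt0 Sp).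
rewrite (GamM g k (differentiable_at_comp dr D) (is_C1_differentiable _ Ch)).
by rewrite (Gam_comp g k dr D).
Qed.

Lemma Gam_off_S f k p : (forall q, ~ S q -> f q = 0) -> ~ S p -> Gam g f k p = 0.
Proof. by move=> f0 Sp; apply: Gam_support => /(support_S f0). Qed.

Lemma test_function_weight s h : is_C1 A h -> (forall q, ~ S q -> h q = 0) ->
  (forall q, 0 <= h q) -> test_function g rho (fun q => rho q `^ s * h q).
Proof.
move=> Ch h0 hge0; have f0 := off_S_weight s h0; split.
- by move=> p; rewrite mulr_ge0 ?powR_ge0.
- apply: compact_support_lipschitz; [exact: lipschitz_at_weight|exact: compact_support_S].
- exact: compact_support_S.
- by apply: subset_trans Srho; exact: support_S.
Qed.

End weights.

(** * The integrals attached to [phi] and the relations between them *)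

Section integrals.
Variables (R : realType) (n : nat) (M : ptopologicalType).
Variables (A : smooth_atlas R n M) (g : riemannian_metric A).
Variable vol : {measure set (borelType M) -> \bar R}.
Hypothesis volP : is_riemannian_volume g vol.
Variables (u : M -> R) (lambda mu : R).
Hypothesis su : smooth A u.
Variable rho : M -> R.
Hypotheses (rho0 : forall p, 0 <= rho p) (erho : affine_eikonal g u lambda mu vol rho).
Variable phi : M -> R.
Hypotheses (sphi : smooth A phi) (kphi : compact (closed_support phi)).
Hypothesis (phirho : closed_support phi `<=` [set p | rho p != 0]).
Implicit Types (f h k : M -> R) (p q : M) (s t : R).

Local Notation S := (closed_support phi).
(** This drift coefficient equals [tau + mu - lambda], the total exponent of [V] in V^tau grad^D,
    which is why the weighted Green identity applies with it. The other exponent of the theorem,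
    [tau + lambda - mu], is [kap - 2 * nu]. *)
Let kap : R := 2 * mu + n%:R * lambda.
Let nu : R := mu - lambda.
Let e t p : R := expR (t * u p).
Let L := weighted_laplacian g kap u phi.

Lemma V_powR p t : V u p `^ t = expR (t * u p).
Proof. by rewrite /powR gt_eqF ?expR_gt0 // expRK. Qed.

Lemma e_kap p : e kap p = e (kap - 2 * nu) p * e nu p ^+ 2.
Proof. by rewrite /e expr2 -!expRD; congr expR; ring. Qed.

Lemma metric_innerZr p a v w : metric_inner g p v (a *: w) = a * metric_inner g p v w.
Proof. exact: gformZr. Qed.

Lemma affine_grad_norm_sqr f p :
  metric_norm g p (affine_grad g u lambda mu f p) ^+ 2 = e nu p ^+ 2 * Gam g f f p.
Proof.
have pg : posdef (gmx g (chart_at A p) (coord (chart_at A p) p)).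
  apply/posdef_gmx/chart_img_coord; exact: chart_at_dom.
rewrite sqr_sqrtr; last exact: (gform_ge0 _ pg).
rewrite /affine_grad V_powR metric_innerZr.
rewrite (_ : metric_inner _ _ _ _ = e nu p * Gam g f f p); last exact: gformZl.
by rewrite mulrA expr2.
Qed.

Lemma affine_laplacianE p : affine_laplacian g u lambda mu phi p = e nu p * L p.
Proof. by rewrite /affine_laplacian V_powR. Qed.

Lemma eikonal_Gam : {ae vol, forall p,
  differentiable_at A rho p /\ e nu p ^+ 2 * Gam g rho rho p = 1}.
Proof.
case: erho => _; apply: ae_mono => p rp; split; last first.
  by rewrite -affine_grad_norm_sqr rp expr1n.
apply: (@grad_neq0_differentiable _ _ _ _ g); apply/eqP => r0.
have := affine_grad_norm_sqr rho p.
rewrite rp expr1n GamE_gform r0 -(scale0r (0 : 'rV_n)) gformZl mul0r mulr0.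
by move/eqP; rewrite oner_eq0.
Qed.

Lemma off_S p : ~ S p -> phi p = 0.
Proof. by move=> Sp; apply/eqP; apply: contrapT => /negP /support_closed_support. Qed.

Lemma L_off_S p : ~ S p -> L p = 0.
Proof. exact: weighted_laplacian_support. Qed.

Lemma Gam_phi_off_S k p : ~ S p -> Gam g phi k p = 0.
Proof. exact: Gam_support. Qed.

Lemma continuous_e t : continuous (e t).
Proof.
move=> p; apply: (@continuous_comp _ _ _ (fun q => t * u q) expR).
  apply: (@continuousM R M (fun=> t) u); first exact: cst_continuous.
  exact: (is_C1_continuous (smooth_is_C1 su)).
exact: continuous_expR.
Qed.

Lemma powR_shift p s m : S p -> rho p `^ (s + m%:R) = rho p `^ s * rho p ^+ m.
Proof.
move=> /(phirho) /= r0; rewrite powRD ?powR_mulrn ?rho0 //.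
by rewrite r0 implybT.
Qed.

Lemma Gam_quadratic f h a b p :
  0 <= a ^+ 2 * Gam g f f p + 2 * (a * b) * Gam g f h p + b ^+ 2 * Gam g h h p.
Proof.
have pg : posdef (gmx g (chart_at A p) (coord (chart_at A p) p)).
  apply/posdef_gmx/chart_img_coord; exact: chart_at_dom.
exact: gform_quadratic.
Qed.

Lemma tau_eqD : tau n lambda mu + lambda - mu = kap - 2 * nu.
Proof. by rewrite /tau -natr1 /kap /nu; ring. Qed.

Lemma tau_eqB : tau n lambda mu + mu - lambda = kap.
Proof. by rewrite /tau -natr1 /kap; ring. Qed.

(* The two quadratic polynomials are the integrals of [m (r L + t phi)^2] and
   [m a^2 |s rho grad phi + phi grad rho|^2]. *)
Lemma pairing_integrals (alpha : R) : alpha != 2 -> exists G P Q H B : R,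
  let psi p := rho p `^ (alpha - 3) * (phi p * phi p) in
  [/\ G + (alpha - 2) * P + Q = 0,
      (forall t, 0 <= B + 2 * t * Q + t ^+ 2 * H) /\
      (forall s, 0 <= s ^+ 2 * G + 2 * s * P + H),
      (\int[vol]_p (rho p `^ (alpha - 2) *
           metric_norm g p (affine_grad g u lambda mu phi p) ^+ 2 *
           V u p `^ (tau n lambda mu + lambda - mu))%:E = G%:E)%E,
      (\int[vol]_p (rho p `^ alpha *
           affine_laplacian g u lambda mu phi p ^+ 2 *
           V u p `^ (tau n lambda mu + mu - lambda))%:E = B%:E)%E &
      [/\ test_function g rho psi,
        weak_laplacian_pairing g u lambda mu vol rho psi =
          (- ((alpha - 3) * H + 2 * P))%:E &
        forall C, weak_bound_pairing n u lambda mu vol C rho psi = (C * H)%:E]].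
Proof.
move=> a2; have [lrho _] := erho.
have cS : closed S by exact: closed_closure.
have Cphi := smooth_is_C1 sphi.
have cphi := is_C1_continuous Cphi.
have cL : continuous L by exact: (continuous_weighted_laplacian volP).
have cG : continuous (Gam g phi phi) by exact: continuous_Gam.
have weight := weight_has_integral volP rho0 lrho cS kphi phirho.
have [G hG] : exists G, has_integral vol (fun q => rho q `^ (alpha - 2) *
    (e kap q * Gam g phi phi q)) G.
  apply: weight => q; first by apply: continuousM; [exact: continuous_e|exact: cG].
  by move=> /Gam_phi_off_S ->; rewrite mulr0.
have [B hB] : exists B, has_integral vol (fun q => rho q `^ alpha *
    (e kap q * ((e nu q * L q) * (e nu q * L q)))) B.
  apply: weight => q; last by move=> /L_off_S ->; rewrite !mulr0.
  apply: continuousM; first exact: continuous_e.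
  by apply: continuousM; apply: continuousM; first [exact: continuous_e|exact: cL].
have [Q hQ] : exists Q, has_integral vol (fun q => rho q `^ (alpha - 2) *
    (e kap q * (phi q * L q))) Q.
  apply: weight => q; last by move=> /L_off_S ->; rewrite !mulr0.
  apply: continuousM; first exact: continuous_e.
  by apply: continuousM; first [exact: cphi|exact: cL].
have [H hH] : exists H, has_integral vol (fun q => rho q `^ (alpha - 4) *
    (e (kap - 2 * nu) q * (phi q * phi q))) H.
  apply: weight => q; last by move=> /off_S ->; rewrite !mulr0.
  apply: continuousM; first exact: continuous_e.
  by apply: continuousM; exact: cphi.
have shift3 p : S p -> rho p `^ (alpha - 3) = rho p `^ (alpha - 4) * rho p.
  move=> Sp; have := powR_shift (alpha - 4) 1 Sp; rewrite expr1 => <-.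
  by congr (_ `^ _); ring.
have shift2 p : S p -> rho p `^ (alpha - 2) = rho p `^ (alpha - 4) * rho p ^+ 2.
  by move=> Sp; rewrite -powR_shift //; congr (_ `^ _); ring.
have shift0 p : S p -> rho p `^ alpha = rho p `^ (alpha - 4) * rho p ^+ 4.
  by move=> Sp; rewrite -powR_shift //; congr (_ `^ _); ring.
pose hP p := rho p `^ (alpha - 3) * (e kap p * (phi p * Gam g rho phi p)).
have drho : {ae vol, forall p, differentiable_at A rho p}.
  by apply: ae_mono eikonal_Gam => p [].
pose psi1 q := rho q `^ (alpha - 2) * phi q.
have psi10 q : ~ S q -> psi1 q = 0 by move=> /off_S p0; rewrite /psi1 p0 mulr0.
have green : has_integral vol
    (fun p => e kap p * (Gam g psi1 phi p + psi1 p * L p)) 0.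
  apply: (green_identity volP kap su sphi (psi := psi1)).
  - exact: (lipschitz_at_weight rho0 lrho cS kphi phirho _ Cphi off_S).
  - apply: ae_mono drho => p dp.
    exact: (differentiable_weight rho0 cS phirho _ Cphi off_S dp).
  - exact: (compact_support_S cS kphi psi10).
have a20 : alpha - 2 != 0 by rewrite subr_eq0.
(* The integrand [hP] contains the gradient of [rho], so continuity cannot give its integrability.
   Green's identity expresses it almost everywhere through the integrands of [G] and [Q], up to the
   factor [alpha - 2]. *)
pose P := - (G + Q) / (alpha - 2).
have intP : has_integral vol hP P.
  have := has_integralD green (has_integralZ (-1) (has_integralD hG hQ)).
  move=> /(has_integralZ (alpha - 2)^-1).
  rewrite add0r mulN1r [_ * - _]mulrC -/P; apply: eq_has_integral.
  apply: ae_mono drho => p dp; have [Sp|Sp] := pselect (S p); last first.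
    by rewrite /hP psi10 // (Gam_off_S g cS phi psi10 Sp) (Gam_phi_off_S phi Sp) off_S // !(mulr0,mul0r,addr0).
  rewrite /psi1 (Gam_weight g rho0 phirho (alpha - 2) phi Cphi Sp dp) /hP.
  rewrite (_ : alpha - 2 - 1 = alpha - 3); last by ring.
  move: (rho p `^ (alpha - 2)) (rho p `^ (alpha - 3)) (e kap p) (Gam g rho phi p)
    (Gam g phi phi p) (L p) (phi p) => r2 r3 E T T' l f.
  by field.
have PE : G + (alpha - 2) * P + Q = 0 by rewrite /P; field.
exists G, P, Q, H, B; split=> //.
- split=> t.
    have I := has_integralD (has_integralD hB (has_integralZ (2 * t) hQ))
      (has_integralZ (t ^+ 2) hH).
    apply: (le_has_integral _ (has_integral0 vol) I); apply: aeW => p.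
    have [Sp|Sp] := pselect (S p); last first.
      by rewrite L_off_S // off_S // !(mulr0,mul0r,addr0).
    rewrite shift0 // shift2 // e_kap.
    have m0 : 0 <= rho p `^ (alpha - 4) * e (kap - 2 * nu) p.
      by rewrite mulr_ge0 ?powR_ge0 ?expR_ge0.
    move: m0; move: (rho p `^ (alpha - 4)) (e (kap - 2 * nu) p) => m E mE.
    move: (rho p) (e nu p) (L p) (phi p) => r a l f.
    have := mulr_ge0 mE (sqr_ge0 (r ^+ 2 * a ^+ 2 * l + t * f)).
    lra.
  have I := has_integralD (has_integralD (has_integralZ (t ^+ 2) hG)
      (has_integralZ (2 * t) intP)) hH.
  apply: (le_has_integral _ (has_integral0 vol) I).
  apply: ae_mono eikonal_Gam => p [dp ep]; have [Sp|Sp] := pselect (S p); last first.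
    by rewrite /hP (Gam_phi_off_S phi Sp) off_S // !(mulr0,mul0r,addr0).
  rewrite /hP shift3 // shift2 // e_kap.
  have m0 : 0 <= rho p `^ (alpha - 4) * e (kap - 2 * nu) p * e nu p ^+ 2.
    by rewrite !mulr_ge0 ?powR_ge0 ?expR_ge0 ?sqr_ge0.
  have := mulr_ge0 m0 (Gam_quadratic phi rho (t * rho p) (phi p) p).
  rewrite (GamC g phi rho); move: ep {m0}.
  move: (rho p `^ (alpha - 4)) (e (kap - 2 * nu) p) => m E.
  move: (rho p) (e nu p) (phi p) (Gam g rho rho p) (Gam g rho phi p)
    (Gam g phi phi p) => r a f T T' T'' ep.
  (* The eikonal equation turns the integrand of [H] into the [Gam rho rho] term that completes the
     square. *)
  have -> : E * (f * f) = E * (f * f) * (a ^+ 2 * T) by rewrite ep mulr1.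
  lra.
- apply: has_integralE; apply: eq_has_integral hG; apply: aeW => p.
  rewrite affine_grad_norm_sqr V_powR tau_eqD -/(e _ p) e_kap.
  move: (rho p `^ _) (e (kap - 2 * nu) p) (e nu p) (Gam g phi phi p) => x y z t; ring.
- apply: has_integralE; apply: eq_has_integral hB; apply: aeW => p.
  rewrite affine_laplacianE V_powR tau_eqB -/(e _ p).
  by move: (rho p `^ alpha) (e kap p) (e nu p) (L p) => x y z t; ring.
have Cpp : is_C1 A (fun p => phi p * phi p) by exact: is_C1_mul.
have pp0 q : ~ S q -> phi q * phi q = 0 by move=> /off_S ->; rewrite mul0r.
split.
- apply: (test_function_weight rho0 lrho cS kphi phirho _ Cpp pp0).
  by move=> q; rewrite -expr2 sqr_ge0.
- rewrite /weak_laplacian_pairing EFinN; congr (- _)%E; apply: has_integralE.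
  apply: eq_has_integral (has_integralD (has_integralZ (alpha - 3) hH) (has_integralZ 2 intP)).
  apply: ae_mono eikonal_Gam => p [dp ep].
  rewrite /affine_grad metric_innerZr !V_powR -/(Gam g _ _ p) -/(e nu p) -/(e _ p).
  have [Sp|Sp] := pselect (S p); last first.
    rewrite (Gam_off_S g cS rho (off_S_weight rho (alpha - 3) pp0) Sp) /hP off_S //.
    by rewrite !(mulr0,mul0r,addr0).
  rewrite (Gam_weight g rho0 phirho (alpha - 3) rho Cpp Sp dp).
  rewrite (GamM g rho (is_C1_differentiable p Cphi) (is_C1_differentiable p Cphi)).
  rewrite (GamC g phi rho) /hP (_ : alpha - 3 - 1 = alpha - 4); last by ring.
  have ek : e kap p = e nu p * e (tau n lambda mu) p.
    by rewrite -tau_eqB /e -expRD /nu; congr expR; ring.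
  (* By the eikonal equation, the part of the pairing where the derivative falls on the power of
     [rho] is a multiple of the integrand of [H]. *)
  have -> : e (kap - 2 * nu) p = e nu p * e (tau n lambda mu) p * Gam g rho rho p.
    by rewrite -ek e_kap -mulrA ep mulr1.
  rewrite ek; move: (rho p `^ (alpha - 4)) (rho p `^ (alpha - 3)) (e nu p)
    (e (tau n lambda mu) p) (phi p) (Gam g rho rho p) (Gam g rho phi p).
  by move=> r4 r3 a b f T T'; ring.
- move=> C; apply: has_integralE; apply: eq_has_integral (has_integralZ C hH).
  apply: aeW => p; have [Sp|Sp] := pselect (S p); last first.
    by rewrite off_S // !(mulr0,mul0r,addr0).
  have r0 : rho p != 0 by exact: phirho.
  rewrite V_powR tau_eqD -/(e _ p) shift3 //.
  by move: (rho p `^ (alpha - 4)) (e (kap - 2 * nu) p) (phi p) => x y z; field.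
Qed.

End integrals.

Theorem theorem4p2 (R : realType) (n : nat) (M : ptopologicalType)
    (A : smooth_atlas R n M) (g : riemannian_metric A)
    (vol : {measure set (borelType M) -> \bar R})
    (Hvol : is_riemannian_volume g vol)
    (Hcomplete : complete_metric g) (Hnoncompact : ~ compact [set: M])
    (u : M -> R) (Hu : smooth A u) (lambda mu : R)
    (rho : M -> R) (Hrho0 : forall p, 0 <= rho p)
    (Hrho : affine_eikonal g u lambda mu vol rho)
    (phi : M -> R) (Hphi : smooth A phi)
    (Hphi_compact : compact (closed_support phi))
    (Hphi_supp : closed_support phi `<=` [set p | rho p != 0]) :
  let V := V u in
  let tau := tau n lambda mu in
  (forall C alpha : R, C < 1 ->
     affine_laplacian_le g u lambda mu vol C rho ->
     2 < alpha < 3 - C ->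
     ((2 * (alpha - 2) * (3 - alpha - C))%:E *
        \int[vol]_p (rho p `^ (alpha - 2) *
           metric_norm g p (affine_grad g u lambda mu phi p) ^+ 2 *
           V p `^ (tau + lambda - mu))%:E
      <= \int[vol]_p (rho p `^ alpha *
           affine_laplacian g u lambda mu phi p ^+ 2 *
           V p `^ (tau + mu - lambda))%:E)%E) /\
  (forall C alpha : R, 1 < C ->
     affine_laplacian_ge g u lambda mu vol C rho ->
     (7 - C) / 3 < alpha < 2 ->
     (((C - alpha + 1) ^+ 2 / 4)%:E *
        \int[vol]_p (rho p `^ (alpha - 2) *
           metric_norm g p (affine_grad g u lambda mu phi p) ^+ 2 *
           V p `^ (tau + lambda - mu))%:E
      <= \int[vol]_p (rho p `^ alpha *
           affine_laplacian g u lambda mu phi p ^+ 2 *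
           V p `^ (tau + mu - lambda))%:E)%E).
Proof.
move=> W w; have pairing alpha := pairing_integrals Hvol Hu Hrho0 Hrho Hphi Hphi_compact
  Hphi_supp (alpha := alpha).
split=> C alpha C1 Clap aC.
  have a2 : alpha != 2 by case/andP: aC => a2 _; rewrite gt_eqF.
  have [G [P [Q [H [B [GPQ [BQH GPH] -> -> [tpsi wpsi bpsi]]]]]]] := pairing alpha a2.
  have := Clap _ tpsi; rewrite wpsi bpsi lee_fin => PH.
  by rewrite -EFinM lee_fin (quadratic_le GPQ BQH aC PH).
have a2 : alpha != 2 by case/andP: aC => _ a2; rewrite lt_eqF.
have [G [P [Q [H [B [GPQ [BQH GPH] -> -> [tpsi wpsi bpsi]]]]]]] := pairing alpha a2.
have := Clap _ tpsi; rewrite wpsi bpsi lee_fin => PH.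
by rewrite -EFinM lee_fin (quadratic_ge GPQ BQH GPH aC PH).
Qed.
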